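(* Let $f$ be a transcendental entire function. (a) If $U$ is a Fatou component of $f$ and $U \cap BU(f) \neq \emptyset$, then $U \subset BU(f)$ and $U$ is a wandering domain. (b) $J(f) = \partial BU(f)$.
   Context: For an entire function $f$, $f^n$ denotes its $n$th iterate. The Fatou set $F(f)$ is the set of $z\in\mathbb{C}$ such that $\{f^n\}_{n\in\mathbb{N}}$ is a normal family in some neighbourhood of $z$; a component of $F(f)$ is called a Fatou component. The Julia set is $J(f)=\mathbb{C}\setminus F(f)$. A Fatou component $U$ is a wandering domain if it is not eventually periodic; that is, if $U_n$ is the Fatou component containing $f^n(U)$, then $U_n=U_m$ only if $n=m$. The escaping set is $I(f)=\{z\in\mathbb{C}: f^n(z)\to\infty \text{ as } n\to\infty\}$, and $K(f)=\{z\in\mathbb{C}: \text{there exists } R>0 \text{ such that } |f^n(z)|\le R \text{ for all } n\ge 0\}$. Then $BU(f)=\mathbb{C}\setminus(I(f)\cup K(f))$ is the set of points whose orbits neither escape to infinity nor are bounded. Boundaries are taken in $\mathbb{C}$. *)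

(* Defs.v *)
From HB Require Import structures.
From mathcomp Require Import all_boot all_order all_algebra.
From mathcomp Require Import all_classical all_reals all_analysis.
From mathcomp Require Import complex.

Set Implicit Arguments.
Unset Strict Implicit.
Unset Printing Implicit Defensive.

Import Order.TTheory GRing.Theory Num.Theory.
Import numFieldNormedType.Exports.

Local Open Scope classical_set_scope.
Local Open Scope ring_scope.
Local Open Scope complex_scope.

(* The complex plane is [R[i]]; its topology and norm are those that
   MathComp-Analysis puts on every [numFieldType] (open discs, modulus). *)
HB.instance Definition _ (R : realType) := NormedModule.copy R[i] R[i]^o.

(* Over the scalar field [R[i]], derivability in the direction 1 is complex
   differentiability. *)
Definition entire (R : realType) (f : R[i] -> R[i]) : Prop :=
  forall z, derivable f z 1.

Definition transcendental_entire (R : realType) (f : R[i] -> R[i]) : Prop :=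
  entire f /\ ~ exists p : {poly R[i]}, forall z, f z = p.[z].

Definition compact_cvg (R : realType) (V : set R[i])
    (g : nat -> R[i] -> R[i]) (h : R[i] -> R[i]) : Prop :=
  forall K, compact K -> K `<=` V -> {uniform K, g @ \oo --> h}.

(* [`|w|] lives in [R[i]], whose order is the partial one with [x < y] iff
   [y - x] is a positive real; hence the injection [M%:C] of a real bound. *)
Definition compact_cvg_infty (R : realType) (V : set R[i])
    (g : nat -> R[i] -> R[i]) : Prop :=
  forall K, compact K -> K `<=` V ->
  forall M : R, \forall k \near \oo, forall z, K z -> M%:C < `|g k z|.

(* Normality of a family of holomorphic functions on a domain [V]: the limit
   infinity is allowed, and a finite limit [h] is holomorphic by Weierstrass'
   theorem. On a connected [V] this is normality for the spherical metric. *)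
Definition normal_family (R : realType) (V : set R[i])
    (F : set (R[i] -> R[i])) : Prop :=
  forall g : nat -> R[i] -> R[i], (forall k, F (g k)) ->
  exists s : nat -> nat, increasing_seq s /\
    ((exists h, compact_cvg V (g \o s) h) \/ compact_cvg_infty V (g \o s)).

Definition fatou_set (R : realType) (f : R[i] -> R[i]) : set R[i] :=
  [set z | exists V : set R[i], [/\ open V, connected V, V z &
    normal_family V (range (fun n => iter n f))]].

Definition julia_set (R : realType) (f : R[i] -> R[i]) : set R[i] :=
  ~` fatou_set f.

Definition fatou_component (R : realType) (f : R[i] -> R[i])
    (U : set R[i]) : Prop :=
  exists2 z, fatou_set f z & U = connected_component (fatou_set f) z.

(* [W n] is the (unique) Fatou component containing the [n]-th image of [U]. *)
Definition wandering_domain (R : realType) (f : R[i] -> R[i])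
    (U : set R[i]) : Prop :=
  fatou_component f U /\
  exists W : nat -> set R[i],
    (forall n, fatou_component f (W n) /\ iter n f @` U `<=` W n) /\
    (forall n m, W n = W m -> n = m).

Definition escaping_set (R : realType) (f : R[i] -> R[i]) : set R[i] :=
  [set z | forall M : R, \forall n \near \oo, M%:C < `|iter n f z|].

Definition bounded_orbit_set (R : realType) (f : R[i] -> R[i]) : set R[i] :=
  [set z | exists2 M : R, 0 < M & forall n, `|iter n f z| <= M%:C].

Definition bungee_set (R : realType) (f : R[i] -> R[i]) : set R[i] :=
  ~` (escaping_set f `|` bounded_orbit_set f).

Definition boundary (T : topologicalType) (A : set T) : set T :=
  closure A `\` interior A.

(* Main.v *)
(* Normality makes escaping, and having a bounded orbit, open and closed
   properties inside the Fatou set, so a Fatou component meeting BU(f) lies in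
   BU(f), and BU(f) has no boundary point in F(f). If such a component were not
   wandering, an iterate g of f would map some component W of F(f) in BU(f) into
   itself. If an orbit of g accumulates at a point of W, that point is recurrent,
   and normality makes its returns uniformly frequent, so its orbit is bounded.
   Otherwise Hurwitz' theorem makes every finite limit function of the iterates
   of g on W constant, with value a fixed point of g; as fixed points are
   isolated, an orbit that is unbounded and returns near such a point would have
   to accumulate in an annulus around it that contains no fixed point.

   Conversely, by Montel's theorem the iterates of f on a disc D centred in J(f)
   eventually omit at most one value. If D were contained in BU(f), at most one
   point would lie outside BU(f), and Picard's theorem would make f affine. If D
   missed BU(f), then BU(f) would be empty, J(f) unbounded, and nested discs would
   produce a point of D whose orbit is alternately near a fixed pair of Julia
   points and far away.

   The function theory is derived from Goursat's theorem for homotopies; Montel's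
   and Picard's theorems come from those of Bloch and Schottky. *)

Require Import Defs.
From HB Require Import structures.
From mathcomp Require Import all_boot all_order all_algebra.
From mathcomp Require Import all_classical all_reals all_analysis.
From mathcomp Require Import complex.
From mathcomp Require Import ring lra.

Set Implicit Arguments.
Unset Strict Implicit.
Unset Printing Implicit Defensive.

Import Order.TTheory GRing.Theory Num.Theory.
Import numFieldNormedType.Exports.

Local Open Scope classical_set_scope.
Local Open Scope ring_scope.
Local Open Scope complex_scope.

Local Notation Re := complex.Re.
Local Notation Im := complex.Im.

(** * The modulus and complex derivatives *)

Section Modulus.
Variable R : realType.
Notation C := R[i].
Implicit Types x y z w : C.

(** Part (a) is classically read off the classification of periodic Fatou components. The argument
    here uses only normality, Hurwitz' theorem and the isolation of fixed points, so basins,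
    rotation domains and Baker domains are never told apart. In part (b) the obstacle is that
    Montel's theorem tolerates one exceptional value. Targets therefore come in pairs: two points
    outside BU(f), a bungee point and its image, two fixed Julia points, two remote ones. A solution
    of f(f(p)) = p provides such a pair unless it is a fixed point. Unboundedness of J(f) is reached
    only under the assumption that BU(f) is empty: a bounded J(f) then leaves a connected exterior
    on which either all points escape or all orbits are bounded, and each case is refuted. Local
    statements concern concentric discs and may lose a fixed factor of the radius, since membership
    in the Fatou set only asks for some radius. *)

Definition cabs z : R := ComplexField.Normc.normc z.

Lemma cabsE z : `|z| = (cabs z)%:C.
Proof. by case: z. Qed.

Lemma cabs_ge0 z : 0 <= cabs z.
Proof. by case: z => a b /=; apply: sqrtr_ge0. Qed.

Lemma cabs0 : cabs 0 = 0.
Proof. exact: ComplexField.Normc.normc0. Qed.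

Lemma cabs1 : cabs 1 = 1.
Proof. exact: ComplexField.Normc.normc1. Qed.

Lemma cabs_eq0 z : (cabs z == 0) = (z == 0).
Proof.
apply/eqP/eqP => [|->]; last exact: cabs0.
exact: ComplexField.Normc.eq0_normc.
Qed.

Lemma cabs_gt0 z : (0 < cabs z) = (z != 0).
Proof. by rewrite lt_neqAle cabs_ge0 andbT eq_sym cabs_eq0. Qed.

Lemma cabsM x y : cabs (x * y) = cabs x * cabs y.
Proof. exact: ComplexField.Normc.normcM. Qed.

Lemma cabsV x : cabs x^-1 = (cabs x)^-1.
Proof. exact: ComplexField.Normc.normcV. Qed.

Lemma cabsX x n : cabs (x ^+ n) = cabs x ^+ n.
Proof. by elim: n => [|n IH]; rewrite ?cabs1 // !exprS cabsM IH. Qed.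

Lemma cabsD x y : cabs (x + y) <= cabs x + cabs y.
Proof. exact: le_normcD. Qed.

Lemma cabsN x : cabs (- x) = cabs x.
Proof. exact: normcN. Qed.

Lemma cabsB x y : cabs (x - y) = cabs (y - x).
Proof. by rewrite -cabsN opprB. Qed.

Lemma cabs_sub x y : cabs (x - y) <= cabs x + cabs y.
Proof. by rewrite -[cabs y]cabsN; exact: cabsD. Qed.

Lemma cabs_tri x y z : cabs (x - z) <= cabs (x - y) + cabs (y - z).
Proof. by rewrite -[x - z](subrKA y); exact: cabsD. Qed.

Lemma cabs_sub_ge x y : cabs x - cabs y <= cabs (x - y).
Proof. by rewrite lerBlDr; apply: le_trans (cabsD _ _); rewrite subrK. Qed.

Lemma cabs_real (r : R) : cabs r%:C = `|r|.
Proof. by rewrite /cabs /= expr0n /= addr0 sqrtr_sqr. Qed.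

Lemma cabs_i : cabs 'i = 1.
Proof. by rewrite /cabs /= expr0n /= add0r expr1n sqrtr1. Qed.

Lemma cabs_nat n : cabs n%:R = n%:R.
Proof. by rewrite -(rmorph_nat (real_complex R)) cabs_real ger0_norm ?ler0n. Qed.

Lemma sqr_cabs z : cabs z ^+ 2 = Re z ^+ 2 + Im z ^+ 2.
Proof. by case: z => a b /=; rewrite sqr_sqrtr ?addr_ge0 ?sqr_ge0. Qed.

Lemma Re_le_cabs z : `|Re z| <= cabs z.
Proof. by case: z => a b; rewrite -sqrtr_sqr ler_wsqrtr // lerDl sqr_ge0. Qed.

Lemma Im_le_cabs z : `|Im z| <= cabs z.
Proof. by case: z => a b; rewrite -sqrtr_sqr ler_wsqrtr // lerDr sqr_ge0. Qed.

Lemma cabs_le_ReIm z : cabs z <= `|Re z| + `|Im z|.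
Proof.
rewrite {1}[z]complexE; apply: le_trans (cabsD _ _) _.
by rewrite cabsM cabs_i mul1r !cabs_real.
Qed.

Lemma Re_sub z w : Re (z - w) = Re z - Re w.
Proof. by case: z; case: w. Qed.

Lemma Im_sub z w : Im (z - w) = Im z - Im w.
Proof. by case: z; case: w. Qed.

Definition disc (a : C) (r : R) : set C := [set w | cabs (w - a) < r].
Definition cdisc (a : C) (r : R) : set C := [set w | cabs (w - a) <= r].

Lemma disc_center a r : 0 < r -> disc a r a.
Proof. by rewrite /disc /= subrr cabs0. Qed.

Lemma disc_inner a r w : disc a r w -> exists2 s, 0 < s & disc w s `<=` disc a r.
Proof.
rewrite /disc /= => h; exists (r - cabs (w - a)); first by lra.
by move=> v /= hv; have := cabs_tri v w a; lra.
Qed.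

Lemma le_cdisc_disc a r s : r < s -> cdisc a r `<=` disc a s.
Proof. by move=> rs w /= h; apply: le_lt_trans rs. Qed.

Lemma disc_cdisc a r : disc a r `<=` cdisc a r.
Proof. by move=> w /ltW. Qed.

Lemma sub_disc a r s : r <= s -> disc a r `<=` disc a s.
Proof. by move=> rs w /= h; apply: lt_le_trans rs. Qed.

Lemma sub_cdisc a r s : r <= s -> cdisc a r `<=` cdisc a s.
Proof. by move=> rs w /= h; apply: le_trans rs. Qed.

End Modulus.

Section Derivative.
Variable R : realType.
Notation C := R[i].
Implicit Types (D E : set C) (f g h : C -> C) (z w d : C).

(* Derivatives are taken relative to a set [D], so that the same notion covers
   complex differentiability ([D] open) and differentiability along a real
   segment of the plane. *)
Definition ctn D f z := forall e : R, 0 < e -> exists2 s : R, 0 < s &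
  forall w, D w -> cabs (w - z) < s -> cabs (f w - f z) < e.

(* Caratheodory's form, which turns the product and chain rules into algebra. *)
Definition hasd D f z d := exists p : C -> C,
  [/\ forall w, D w -> f w = f z + (w - z) * p w, p z = d & ctn D p z].

Lemma ctn_const D c z : ctn D (fun=> c) z.
Proof. by move=> e e0; exists 1 => // w _ _; rewrite subrr cabs0. Qed.

Lemma ctn_id D z : ctn D id z.
Proof. by move=> e e0; exists e. Qed.

Lemma ctn_sub D E f z : D `<=` E -> ctn E f z -> ctn D f z.
Proof.
by move=> DE h e /h[s s0 hs]; exists s => // w Dw; apply: hs; apply: DE.
Qed.

Lemma ctn_ext D f g z : (forall w, D w -> f w = g w) -> f z = g z ->
  ctn D f z -> ctn D g z.
Proof.
move=> fg fgz h e /h[s s0 hs]; exists s => // w Dw ws.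
by rewrite -fg // -fgz; apply: hs.
Qed.

Lemma ctnD D f g z : ctn D f z -> ctn D g z -> ctn D (fun w => f w + g w) z.
Proof.
move=> hf hg e e0; have e2 : 0 < e / 2 by lra.
have [s s0 hs] := hf _ e2; have [t t0 ht] := hg _ e2.
exists (Num.min s t); first by rewrite lt_min s0.
move=> w Dw; rewrite lt_min => /andP[/(hs _ Dw) h1 /(ht _ Dw) h2].
rewrite opprD addrACA; have := cabsD (f w - f z) (g w - g z); lra.
Qed.

Lemma ctnN D f z : ctn D f z -> ctn D (fun w => - f w) z.
Proof.
move=> hf e /hf[s s0 hs]; exists s => // w Dw ws.
by rewrite -opprD cabsN; apply: hs.
Qed.

Lemma ctnM D f g z : ctn D f z -> ctn D g z -> ctn D (fun w => f w * g w) z.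
Proof.
move=> hf hg e e0.
pose A := cabs (f z) + 1; pose B := cabs (g z) + 1.
have A0 : 0 < A by have := cabs_ge0 (f z); rewrite /A; lra.
have B0 : 0 < B by have := cabs_ge0 (g z); rewrite /B; lra.
have eB : 0 < Num.min 1 (e / (2 * B)) by rewrite lt_min ltr01 divr_gt0 //; lra.
have eA : 0 < e / (2 * A) by rewrite divr_gt0 //; lra.
have [s s0 hs] := hf _ eB; have [t t0 ht] := hg _ eA.
exists (Num.min s t); first by rewrite lt_min s0.
move=> w Dw; rewrite lt_min => /andP[/(hs _ Dw) h1 /(ht _ Dw) h2].
move: h1; rewrite lt_min => /andP[h0 h1].
have -> : f w * g w - f z * g z = f w * (g w - g z) + (f w - f z) * g z by ring.
apply: le_lt_trans (cabsD _ _) _; rewrite !cabsM.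
have fw : cabs (f w) < A by have := cabsD (f w - f z) (f z); rewrite subrK /A; lra.
have u1 : cabs (f w) * cabs (g w - g z) <= A * cabs (g w - g z).
  by rewrite ler_wpM2r ?cabs_ge0 // ltW.
have u2 : A * cabs (g w - g z) < e / 2.
  have -> : e / 2 = A * (e / (2 * A)) by field; lra.
  by rewrite ltr_pM2l.
have u3 : cabs (f w - f z) * cabs (g z) <= cabs (f w - f z) * B.
  by rewrite ler_wpM2l ?cabs_ge0 // /B; lra.
have u4 : cabs (f w - f z) * B < e / 2.
  have -> : e / 2 = (e / (2 * B)) * B by field; lra.
  by rewrite ltr_pM2r.
lra.
Qed.

Lemma ctn_comp D E f g z : ctn D f z -> ctn E g (f z) ->
  (forall w, D w -> E (f w)) -> ctn D (fun w => g (f w)) z.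
Proof.
move=> hf hg fDE e /hg[s s0 hs]; have [t t0 ht] := hf _ s0.
by exists t => // w Dw wt; apply: hs; [exact: fDE|exact: ht].
Qed.

Lemma ctn_inv D f z : f z != 0 -> ctn D f z -> ctn D (fun w => (f w)^-1) z.
Proof.
move=> fz hf e e0; set m := cabs (f z).
have m0 : 0 < m by rewrite cabs_gt0.
have e1 : 0 < Num.min (m / 2) (e * m ^+ 2 / 2).
  by rewrite lt_min divr_gt0 //= divr_gt0 // mulr_gt0 // exprn_gt0.
have [s s0 hs] := hf _ e1; exists s => // w Dw ws.
have := hs _ Dw ws; rewrite lt_min => /andP[h1 h2].
have fw : m / 2 < cabs (f w) by have := cabs_sub_ge (f z) (f z - f w); rewrite -/m subKr cabsB in h1 *; lra.
have fw0 : f w != 0 by rewrite -cabs_gt0; lra.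
have -> : (f w)^-1 - (f z)^-1 = - (f w - f z) * ((f w)^-1 * (f z)^-1).
  by field; rewrite fw0 fz.
rewrite cabsM cabsN cabsM !cabsV -/m -invfM ltr_pdivrMr; last by nra.
apply: lt_le_trans h2 _.
have : m ^+ 2 / 2 <= cabs (f w) * m by rewrite expr2; nra.
rewrite -mulrA => h; apply: ler_wpM2l => //; exact: ltW.
Qed.

Lemma hasdP D f z d : (D z -> hasd D f z d) <-> (D z -> forall e : R, 0 < e -> exists2 s : R, 0 < s &
  forall w, D w -> cabs (w - z) < s -> cabs (f w - f z - (w - z) * d) <= e * cabs (w - z)).
Proof.
split=> [h Dz|h Dz].
  have [p [fp pz cp]] := h Dz; move=> e /cp[s s0 hs]; exists s => // w Dw ws.
  rewrite fp //.
  have -> : f z + (w - z) * p w - f z - (w - z) * d = (p w - d) * (w - z) by ring.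
  by rewrite cabsM ler_wpM2r ?cabs_ge0 // ltW // -pz; apply: hs.
exists (fun w => if w == z then d else (f w - f z) / (w - z)); split.
- move=> w Dw; case: eqP => [->|/eqP wz]; first by rewrite subrr mul0r addr0.
  by field; rewrite subr_eq0.
- by rewrite eqxx.
move=> e e0; have e2 : 0 < e / 2 by lra.
have [s s0 hs] := h Dz _ e2; exists s => // w Dw ws; rewrite eqxx.
case: eqP => [_|/eqP wz]; first by rewrite subrr cabs0.
have wz0 : w - z != 0 by rewrite subr_eq0.
have c0 : 0 < cabs (w - z) by rewrite cabs_gt0.
have -> : (f w - f z) / (w - z) - d = (f w - f z - (w - z) * d) / (w - z) by field.
rewrite cabsM cabsV ltr_pdivrMr //; apply: le_lt_trans (hs _ Dw ws) _.
by rewrite ltr_pM2r //; lra.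
Qed.

Lemma hasd_eps D f z d : D z -> hasd D f z d -> forall e : R, 0 < e -> exists2 s : R, 0 < s &
  forall w, D w -> cabs (w - z) < s -> cabs (f w - f z - (w - z) * d) <= e * cabs (w - z).
Proof. by move=> Dz h; apply: (proj1 (hasdP D f z d)). Qed.

Lemma eps_hasd D f z d : D z -> (forall e : R, 0 < e -> exists2 s : R, 0 < s &
  forall w, D w -> cabs (w - z) < s -> cabs (f w - f z - (w - z) * d) <= e * cabs (w - z)) ->
  hasd D f z d.
Proof. by move=> Dz h; apply: (proj2 (hasdP D f z d)). Qed.

Lemma hasd_ctn D f z d : hasd D f z d -> ctn D f z.
Proof.
move=> [p [fp _ cp]].
apply: (@ctn_ext _ (fun w => f z + (w - z) * p w)).
- by move=> w /fp ->.
- by rewrite subrr mul0r addr0.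
apply: ctnD; first exact: ctn_const.
apply: ctnM => //; apply: ctnD; [exact: ctn_id|exact: ctn_const].
Qed.

Lemma hasd_sub D E f z d : D `<=` E -> hasd E f z d -> hasd D f z d.
Proof.
move=> DE [p [h1 h2 h3]]; exists p; split => //; last exact: ctn_sub h3.
by move=> w /DE; apply: h1.
Qed.

Lemma hasd_ext D f g z d : (forall w, D w -> f w = g w) -> f z = g z ->
  hasd D f z d -> hasd D g z d.
Proof.
move=> fg fgz [p [h1 h2 h3]]; exists p; split => // w Dw.
by rewrite -fg // -fgz; apply: h1.
Qed.

Lemma hasd_const D c z : hasd D (fun=> c) z 0.
Proof. by exists (fun=> 0); split => // [w|]; [rewrite mulr0 addr0|exact: ctn_const]. Qed.

Lemma hasd_id D z : hasd D id z 1.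
Proof. by exists (fun=> 1); split => // [w|]; [rewrite mulr1 addrC subrK|exact: ctn_const]. Qed.

Lemma hasdD D f g z d e : hasd D f z d -> hasd D g z e ->
  hasd D (fun w => f w + g w) z (d + e).
Proof.
move=> [p [f1 f2 f3]] [q [g1 g2 g3]]; exists (fun w => p w + q w); split.
- by move=> w Dw; rewrite f1 // g1 //; ring.
- by rewrite f2 g2.
- exact: ctnD.
Qed.

Lemma hasdN D f z d : hasd D f z d -> hasd D (fun w => - f w) z (- d).
Proof.
move=> [p [f1 f2 f3]]; exists (fun w => - p w); split.
- by move=> w Dw; rewrite f1 //; ring.
- by rewrite f2.
- exact: ctnN.
Qed.

Lemma hasdB D f g z d e : hasd D f z d -> hasd D g z e ->
  hasd D (fun w => f w - g w) z (d - e).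
Proof. by move=> hf /hasdN; apply: hasdD. Qed.

Lemma hasdM D f g z d e : hasd D f z d -> hasd D g z e ->
  hasd D (fun w => f w * g w) z (d * g z + f z * e).
Proof.
move=> hf hg; have cg := hasd_ctn hg.
move: hf hg => [p [f1 f2 f3]] [q [g1 g2 g3]].
exists (fun w => p w * g w + f z * q w); split.
- move=> w Dw; have := g1 _ Dw; rewrite f1 // => ->; ring.
- by rewrite f2 g2.
- by apply: ctnD; apply: ctnM => //; exact: ctn_const.
Qed.

Lemma hasdZ D f z d c : hasd D f z d -> hasd D (fun w => c * f w) z (c * d).
Proof.
by move=> hf; have := hasdM (hasd_const D c z) hf; rewrite mul0r add0r.
Qed.

Lemma hasd_comp D E f g z d e : hasd D f z d -> hasd E g (f z) e ->
  (forall w, D w -> E (f w)) -> hasd D (fun w => g (f w)) z (e * d).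
Proof.
move=> hf; have cf := hasd_ctn hf; move: hf.
move=> [p [f1 f2 f3]] [q [g1 g2 g3]] DE.
exists (fun w => q (f w) * p w); split.
- move=> w Dw; rewrite (g1 (f w)); last exact: DE.
  by rewrite [X in X - _]f1 //; ring.
- by rewrite f2 g2.
- by apply: ctnM => //; apply: ctn_comp g3 DE.
Qed.

Lemma hasd_inv D f z d : f z != 0 -> hasd D f z d -> (forall w, D w -> f w != 0) ->
  hasd D (fun w => (f w)^-1) z (- d / f z ^+ 2).
Proof.
move=> fz hf f0; have cf := hasd_ctn hf; move: hf => [p [f1 f2 f3]].
exists (fun w => - p w * ((f z)^-1 * (f w)^-1)); split.
- move=> w Dw; have fw := f0 _ Dw.
  rewrite [LHS](_ : _ = (f z)^-1 - (f w - f z) * ((f z)^-1 * (f w)^-1)); last first.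
    by field; rewrite fw fz.
  have -> : f w - f z = (w - z) * p w by rewrite f1 //; ring.
  by ring.
- by rewrite f2; field.
- apply: ctnM; first exact: ctnN.
  by apply: ctnM; [exact: ctn_const|exact: ctn_inv].
Qed.

Lemma hasdX D f z d n : hasd D f z d ->
  hasd D (fun w => f w ^+ n) z (n%:R * f z ^+ n.-1 * d).
Proof.
move=> hf; elim: n => [|n IH].
  by rewrite !mul0r; exact: hasd_const.
have := hasdM hf IH.
have -> : d * f z ^+ n + f z * (n%:R * f z ^+ n.-1 * d) = n.+1%:R * f z ^+ n.+1.-1 * d.
  by case: n {IH} => [|n] /=; rewrite ?expr0 -?natr1 ?exprS; ring.
by apply: hasd_ext => [w _|]; rewrite exprS.
Qed.

End Derivative.

(** * Bisection and the mean value inequality *)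

Section MeanValue.
Variable R : realType.
Notation C := R[i].

Lemma half_pow_small (e : R) : 0 < e -> exists n, (2 ^+ n)^-1 < e.
Proof.
move=> e0; exists (Num.truncn e^-1).+1.
rewrite invf_plt ?posrE ?exprn_gt0 //; apply: lt_le_trans (truncnS_gt _) _.
by rewrite -natrX ler_nat ltnW // ltn_expl.
Qed.

(** Dependent choice with an invariant [P] and a step relation [Q]; all bisections, diagonal and
    nested-disc constructions go through it. *)
Lemma dep_choice (T : Type) (P : nat -> T -> Prop) (Q : nat -> T -> T -> Prop) (x0 : T) :
  P 0%N x0 -> (forall n x, P n x -> exists2 y, P n.+1 y & Q n x y) ->
  exists u : nat -> T, u 0%N = x0 /\ forall n, P n (u n) /\ Q n (u n) (u n.+1).
Proof.
move=> P0 H.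
have /choice[F HF] : forall p : nat * T, exists y, P p.1 p.2 -> P p.1.+1 y /\ Q p.1 p.2 y.
  move=> [n x]; have [/H[y Py Qy]|nP] := pselect (P n x); first by exists y.
  by exists x.
pose u := nat_rect (fun=> T) x0 (fun n x => F (n, x)).
have Pu n : P n (u n) by elim: n => //= n /(HF (n, _))[].
by exists u; split=> // n; split=> //; have [] := HF (n, u n) (Pu n).
Qed.

(** The intervals [[u n, u n + L / 2 ^+ n]] are nested, so the supremum of their left ends lies in
    all of them. *)
Lemma halving_lim (L : R) (u : nat -> R) : 0 <= L ->
  (forall n, u n <= u n.+1 <= u n + L / 2 ^+ n.+1) ->
  exists p, forall n, u n <= p <= u n + L / 2 ^+ n.
Proof.
move=> L0 hu.
have inc m n : u n <= u (m + n)%N.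
  by elim: m => //= m IH; apply: le_trans IH _; have /andP[] := hu (m + n)%N.
have ub m n : u (m + n)%N + L / 2 ^+ (m + n) <= u n + L / 2 ^+ n.
  elim: m => //= m IH; apply: le_trans IH; rewrite addSn.
  have /andP[_] := hu (m + n)%N.
  have -> : L / 2 ^+ (m + n) = 2 * (L / 2 ^+ (m + n).+1) :> R.
    by rewrite exprS; field; rewrite expf_neq0.
  lra.
have pos n : 0 <= L / 2 ^+ n by rewrite divr_ge0 // exprn_ge0.
have bnd n m : u m <= u n + L / 2 ^+ n.
  have h1 := inc n m; have h2 := ub m n; have h3 := pos (m + n)%N.
  by rewrite addnC in h1; lra.
exists (sup (range u)) => n; apply/andP; split.
  apply: ub_le_sup; last by exists n.
  by exists (u 0%N + L / 2 ^+ 0) => _ [m _ <-]; exact: bnd.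
by apply: ge_sup; [exists (u 0%N), 0%N|move=> _ [m _ <-]; exact: bnd].
Qed.

Definition rseg (a b : R) : set C := [set z | exists2 t, a <= t <= b & z = t%:C].

Lemma rseg_in (a b t : R) : a <= t <= b -> rseg a b t%:C.
Proof. by move=> h; exists t. Qed.

(** Rolle's theorem fails for complex values, hence bisection: if the bound fails with a slightly
    larger slope [M'], it fails on one of the two halves, and so on down to a point [p] where the
    derivative would be too large. *)
Lemma mean_value (f : C -> C) (a b M : R) : a <= b -> 0 <= M ->
  (forall t, a <= t <= b -> exists2 d, hasd (rseg a b) f t%:C d & cabs d <= M) ->
  cabs (f b%:C - f a%:C) <= M * (b - a).
Proof.
move=> ab M0 hf; have [//|bad] := leP (cabs (f b%:C - f a%:C)) (M * (b - a)).
pose L := b - a; have L0 : 0 <= L by rewrite /L; lra.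
have [M' M'M bad'] : exists2 M', M < M' & M' * L < cabs (f b%:C - f a%:C).
  (* Half of the excess, spread over the length [L + 1], which is positive even for [L = 0]. *)
  exists (M + (cabs (f b%:C - f a%:C) - M * L) / (2 * (L + 1))).
    by rewrite ltrDl divr_gt0 //; rewrite /L; lra.
  set X := cabs _ in bad *; rewrite mulrDl -ltrBrDl.
  set Y := (X - M * L); have Y0 : 0 < Y by rewrite /Y /L; lra.
  have -> : Y / (2 * (L + 1)) * L = Y * (L / (2 * (L + 1))) by field; lra.
  by rewrite gtr_pMr // ltr_pdivrMr; lra.
pose P n u := (a <= u /\ u + L / 2 ^+ n <= b) /\
  M' * (L / 2 ^+ n) < cabs (f (u + L / 2 ^+ n)%:C - f u%:C).
have P0 : P 0%N a.
  rewrite /P expr0 divr1 /L; split; first by split; lra.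
  by rewrite [a + _]addrC subrK.
have st n x : P n x -> exists2 y, P n.+1 y & x <= y <= x + L / 2 ^+ n.+1.
  move=> [[h1 h2] h3]; pose l := L / 2 ^+ n.+1.
  have l0 : 0 <= l by rewrite divr_ge0 // exprn_ge0.
  have e : L / 2 ^+ n = l + l.
    by rewrite /l exprS; field; rewrite expf_neq0.
  rewrite e in h2 h3.
  have [g1|g1] := ltP (M' * l) (cabs (f (x + l)%:C - f x%:C)).
    by exists x; [split => //; split; rewrite -/l; lra|rewrite -/l; lra].
  exists (x + l); last by rewrite -/l; lra.
  split; first by split; rewrite -/l; lra.
  rewrite -/l -addrA.
  have := cabs_tri (f (x + (l + l))%:C) (f (x + l)%:C) (f x%:C); lra.
have [u [_ hu]] := dep_choice P0 st.
have [p hp] := halving_lim L0 (fun n => (hu n).2).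
have pab : a <= p <= b.
  have h : a <= u 0%N := (hu 0%N).1.1.1.
  have h' : u 0%N + L / 2 ^+ 0 <= b := (hu 0%N).1.1.2.
  by have /andP[q1 q2] := hp 0%N; rewrite (le_trans h q1) (le_trans q2 h').
have [d fd dM] := hf _ pab.
have e0 : 0 < M' - M by lra.
have [s s0 hs] := hasd_eps (rseg_in pab) fd e0.
have [n hn] : exists n, L / 2 ^+ n < s.
  have s1 : 0 < s / (L + 1) by rewrite divr_gt0 //; lra.
  have [n hn] := half_pow_small s1; exists n.
  apply: (@le_lt_trans _ _ ((L + 1) / 2 ^+ n)).
    by rewrite ler_wpM2r ?invr_ge0 ?exprn_ge0 //; lra.
  by rewrite mulrC -ltr_pdivlMr //; lra.
have h1 : a <= u n := (hu n).1.1.1.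
have h2 : u n + L / 2 ^+ n <= b := (hu n).1.1.2.
have h3 : M' * (L / 2 ^+ n) < cabs (f (u n + L / 2 ^+ n)%:C - f (u n)%:C) := (hu n).1.2.
have /andP[q1 q2] := hp n.
set l := L / 2 ^+ n in h2 h3 hn q2.
(* Since [p] lies between the two ends, the errors at the ends add up to exactly [(M' - M) * l]. *)
have near t : u n <= t <= u n + l -> cabs (f t%:C - f p%:C - (t%:C - p%:C) * d) <= (M' - M) * `|t - p|.
  move=> /andP[t1 t2]; have -> : `|t - p| = cabs (t%:C - p%:C) by rewrite -rmorphB cabs_real.
  apply: hs; first by apply: rseg_in; apply/andP; split; lra.
  by rewrite -rmorphB cabs_real ltr_norml; apply/andP; split; lra.
have n1 : cabs (f (u n)%:C - f p%:C - ((u n)%:C - p%:C) * d) <= (M' - M) * (p - u n).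
  rewrite -[p - u n]ger0_norm ?subr_ge0 // distrC; apply: near; lra.
have n2 : cabs (f (u n + l)%:C - f p%:C - ((u n + l)%:C - p%:C) * d) <= (M' - M) * (u n + l - p).
  rewrite -[u n + l - p]ger0_norm ?subr_ge0 //; apply: near; lra.
have E : f (u n + l)%:C - f (u n)%:C = (f (u n + l)%:C - f p%:C - ((u n + l)%:C - p%:C) * d) -
  (f (u n)%:C - f p%:C - ((u n)%:C - p%:C) * d) + l%:C * d by rewrite rmorphD; ring.
have l0 : 0 <= l by lra.
have : cabs (l%:C * d) <= M * l by rewrite cabsM cabs_real ger0_norm // mulrC ler_wpM2r.
move: h3; rewrite E => h3.
have t1 := cabsD ((f (u n + l)%:C - f p%:C - ((u n + l)%:C - p%:C) * d) -
  (f (u n)%:C - f p%:C - ((u n)%:C - p%:C) * d)) (l%:C * d).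
have t2 := cabs_sub (f (u n + l)%:C - f p%:C - ((u n + l)%:C - p%:C) * d)
  (f (u n)%:C - f p%:C - ((u n)%:C - p%:C) * d).
lra.
Qed.

Lemma hasd0_const (f : C -> C) (a b : R) : a <= b ->
  (forall t, a <= t <= b -> hasd (rseg a b) f t%:C 0) -> f b%:C = f a%:C.
Proof.
move=> ab hf; apply/eqP; rewrite -subr_eq0 -cabs_eq0 eq_le cabs_ge0 andbT.
rewrite -(mul0r (b - a)); apply: mean_value => // t /hf h.
by exists 0; rewrite ?cabs0.
Qed.

End MeanValue.

(** * Primitives along the unit interval *)

Section Antiderivative.
Variable R : realType.
Notation C := R[i].

Lemma antiderivative_real (f : R -> R) : continuous f ->
  exists F : R -> R, forall x : R, 0 <= x <= 1 -> is_derive x 1 F (f x).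
Proof.
move=> cf.
(* Integrating from -1, inside [[-1, 2]], puts [[0, 1]] in the interior, where the fundamental
   theorem gives a two-sided derivative. *)
exists (fun x => \int[lebesgue_measure]_(t in `[-1, x]) f t)%R => x /andP[x0 x1].
have ci : lebesgue_measure.-integrable `[-1, 2] (EFin \o f).
  apply: continuous_compact_integrable; first exact: segment_compact.
  exact: continuous_subspaceT.
have x2 : x < 2 by lra.
have x3 : -1 < x by lra.
have [d1 d2] := continuous_FTC1_closed x2 ci x3 (cf x).
exact: (DeriveDef d1 (etrans (esym (derive1E _ _)) d2)).
Qed.

Lemma is_derive_hasd (f : R -> R) (x d : R) (D : set C) : is_derive x 1 f d ->
  D `<=` [set z | Im z = 0] ->
  hasd D (fun z => (f (Re z))%:C) x%:C d%:C.
Proof.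
move=> /is_derive1_caratheodory[g [g1 g2 g3]] D0.
exists (fun z => (g (Re z))%:C); split.
- move=> w /D0 w0; have -> : w = (Re w)%:C by rewrite [LHS]complexE w0 mulr0 addr0.
  have -> : f (Re w) = f x + (Re w - x) * g (Re w) by rewrite mulrC -g1 addrC subrK.
  by rewrite rmorphD rmorphM rmorphB.
- by rewrite /= g3.
move=> e e0; move: g2 => /cvgrPdist_lt /(_ _ e0) /nbhs_ballP[s /= s0 hs].
exists s => // w _ ws; change (cabs ((g (Re w))%:C - (g x)%:C) < e); rewrite -rmorphB cabs_real distrC; apply: hs.
rewrite /ball /= distrC; apply: le_lt_trans ws; rewrite -(_ : Re (w - x%:C) = Re w - x) ?Re_le_cabs //.
by rewrite Re_sub.
Qed.

Lemma antiderivative (f : C -> C) : (forall t, 0 <= t <= 1 -> ctn (rseg 0 1) f t%:C) ->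
  exists F : C -> C, forall t, 0 <= t <= 1 -> hasd (rseg 0 1) F t%:C (f t%:C).
Proof.
move=> cf.
(* [f] is continuous along the segment only; composing it with the 1-Lipschitz clamp [c] gives a
   function continuous on the whole line. *)
pose c (x : R) : R := Num.max 0 (Num.min 1 x).
have c01 x : 0 <= c x <= 1.
  by rewrite /c le_max lexx /= ge_max ler01 /= ge_min lexx.
have cid x : 0 <= x <= 1 -> c x = x.
  by move=> /andP[x0 x1]; rewrite /c min_r // max_r.
have cl x y : `|c x - c y| <= `|x - y|.
  rewrite /c; have [h1|h1] := leP 1 x; have [h2|h2] := leP 1 y;
  rewrite ?[Num.max 0 1]max_r //; 
  try (have [h3|h3] := leP 0 x); try (have [h4|h4] := leP 0 y); rewrite ?ler_norml;
  have := ler_norm (x - y); have := ler_norm (y - x); rewrite (distrC y x); lra.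
have cc (g : C -> R) : (forall z w, `|g z - g w| <= cabs (z - w)) ->
    continuous (fun x => g (f (c x)%:C)).
  move=> gl x; apply/cvgrPdist_lt => e e0; apply/nbhs_ballP.
  have [s s0 hs] := cf _ (c01 x) _ e0; exists s => // y /= xy.
  apply: le_lt_trans (gl _ _) _; rewrite cabsB; apply: hs; first exact: rseg_in.
  by rewrite -rmorphB cabs_real; apply: le_lt_trans (cl _ _) _; rewrite distrC.
have [F1 h1] : exists F : R -> R, forall x : R, 0 <= x <= 1 -> is_derive x 1 F (Re (f (c x)%:C)).
  by apply: antiderivative_real; apply: cc => z w; rewrite -Re_sub; exact: Re_le_cabs.
have [F2 h2] : exists F : R -> R, forall x : R, 0 <= x <= 1 -> is_derive x 1 F (Im (f (c x)%:C)).
  by apply: antiderivative_real; apply: cc => z w; rewrite -Im_sub; exact: Im_le_cabs.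
exists (fun z => (F1 (Re z))%:C + 'i * (F2 (Re z))%:C) => t t01.
have sub0 : rseg 0 1 `<=` [set z : C | Im z = 0] by move=> _ [? _ ->].
rewrite [f _]complexE -[t in Re (f t%:C)](cid t) // -[t in Im (f t%:C)](cid t) //.
apply: hasdD; first exact: is_derive_hasd (h1 _ t01) sub0.
by apply: hasdZ; exact: is_derive_hasd (h2 _ t01) sub0.
Qed.

End Antiderivative.

(** * Integration and Cauchy's theorem *)

Section Integral.
Variable R : realType.
Notation C := R[i].
Notation I01 := (rseg (0 : R) 1).
Implicit Types f g h : C -> C.

Definition is_prim (F g : C -> C) := forall t : R, 0 <= t <= 1 -> hasd I01 F t%:C (g t%:C).

Definition ctn01 (g : C -> C) := forall t : R, 0 <= t <= 1 -> ctn I01 g t%:C.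

(** The integral is the increment of a primitive, well defined by [hasd0_const]; the default 0 is
    taken when there is no primitive. *)
Definition cint (g : C -> C) : C := xget 0 [set v | exists2 F, is_prim F g & v = F 1 - F 0].

Lemma cintE (F g : C -> C) : is_prim F g -> cint g = F 1 - F 0.
Proof.
move=> hF; rewrite /cint; case: xgetP => [v _ [G hG ->]|/(_ (F 1 - F 0))[]]; last by exists F.
have := @hasd0_const R (fun z => G z - F z) 0 1 ler01.
have -> : (1%:C = 1 :> C) by [].
have -> : (0%:C = 0 :> C) by [].
move=> h; apply/eqP; rewrite -subr_eq0; apply/eqP.
have -> : G 1 - G 0 - (F 1 - F 0) = (G 1 - F 1) - (G 0 - F 0) by ring.
rewrite h ?subrr // => t t01; rewrite -(subrr (g t%:C)).
by apply: hasdB; [exact: hG|exact: hF].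
Qed.

Lemma ctn01_prim g : ctn01 g -> exists F, is_prim F g.
Proof. exact: antiderivative. Qed.

Lemma cint_ext g h : (forall t : R, 0 <= t <= 1 -> g t%:C = h t%:C) -> ctn01 g -> cint g = cint h.
Proof.
move=> gh /ctn01_prim[F hF]; rewrite (cintE hF); symmetry; apply: cintE => t t01.
by rewrite -gh //; apply: hF.
Qed.

Lemma cintD g h : ctn01 g -> ctn01 h -> cint (fun t => g t + h t) = cint g + cint h.
Proof.
move=> /ctn01_prim[F hF] /ctn01_prim[G hG]; rewrite (cintE hF) (cintE hG).
rewrite (@cintE (fun t => F t + G t)); first by ring.
by move=> t t01; apply: hasdD; [exact: hF|exact: hG].
Qed.

Lemma cintZ c g : ctn01 g -> cint (fun t => c * g t) = c * cint g.
Proof.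
move=> /ctn01_prim[F hF]; rewrite (cintE hF).
rewrite (@cintE (fun t => c * F t)); first by ring.
by move=> t t01; apply: hasdZ; exact: hF.
Qed.

Lemma cint_bound g (M : R) : ctn01 g ->
  (forall t : R, 0 <= t <= 1 -> cabs (g t%:C) <= M) -> cabs (cint g) <= M.
Proof.
move=> /ctn01_prim[F hF] hM; rewrite (cintE hF).
have M0 : 0 <= M by apply: le_trans (cabs_ge0 (g 0%:C)) (hM 0 _); rewrite lexx ler01.
have := @mean_value R F 0 1 M ler01 M0; rewrite subr0 mulr1; apply => t t01.
by exists (g t%:C); [exact: hF|exact: hM].
Qed.

Lemma hasd_lip F (L : R) : 0 <= L ->
  (forall t : R, 0 <= t <= 1 -> exists2 d, hasd I01 F t%:C d & cabs d <= L) ->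
  forall s t : R, 0 <= s <= 1 -> 0 <= t <= 1 -> cabs (F s%:C - F t%:C) <= L * `|s - t|.
Proof.
move=> L0 hF.
have W s t : 0 <= s -> s <= t -> t <= 1 -> cabs (F t%:C - F s%:C) <= L * `|t - s|.
  move=> s0 st t1; rewrite ger0_norm ?subr_ge0 //; apply: mean_value => // u /andP[su ut].
  have [|d h1 h2] := hF u; first by rewrite (le_trans s0 su) (le_trans ut t1).
  exists d => //; apply: hasd_sub h1 => _ [v /andP[v1 v2] ->]; exists v => //.
  by rewrite (le_trans s0 v1) (le_trans v2 t1).
move=> s t /andP[s0 s1] /andP[t0 t1]; have [st|/ltW ts] := leP s t; last exact: W.
by rewrite cabsB distrC; apply: W.
Qed.

(* The two sides are the integrals of [f] over the two halves of the boundary of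
   [H [0,1]^2]; their difference is additive under subdivision of the square. *)
Lemma goursat f (H Hx Hy : C -> C -> C) (L : R) :
  (forall x y : R, 0 <= x <= 1 -> 0 <= y <= 1 ->
     [/\ hasd I01 (H^~ y%:C) x%:C (Hx x%:C y%:C), hasd I01 (H x%:C) y%:C (Hy x%:C y%:C),
         ctn I01 (Hx^~ y%:C) x%:C, ctn I01 (Hy x%:C) y%:C &
         exists d, hasd setT f (H x%:C y%:C) d]) ->
  (forall x y : R, 0 <= x <= 1 -> 0 <= y <= 1 ->
     cabs (Hx x%:C y%:C) <= L /\ cabs (Hy x%:C y%:C) <= L) ->
  cint (fun t => f (H t 0) * Hx t 0) + cint (fun t => f (H 1 t) * Hy 1 t) =
  cint (fun t => f (H t 1) * Hx t 1) + cint (fun t => f (H 0 t) * Hy 0 t).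
Proof.
move=> hH hL.
have O01 : (0 : R) <= (0 : R) <= (1 : R) by apply/andP; split; [exact: lexx|exact: ler01].
have I1 : (0 : R) <= (1 : R) <= (1 : R) by apply/andP; split; [exact: ler01|exact: lexx].
have L0 : 0 <= L by have [h _] := hL 0 0 O01 O01; apply: le_trans h; exact: cabs_ge0.
have cfx y : 0 <= y <= 1 -> ctn01 (fun t => f (H t y%:C) * Hx t y%:C).
  move=> y01 t t01; have [h1 h2 h3 h4 [d hd]] := hH _ _ t01 y01.
  by apply: ctnM => //; apply: (@ctn_comp _ _ setT _ f _ (hasd_ctn h1) (hasd_ctn hd)).
have cfy x : 0 <= x <= 1 -> ctn01 (fun t => f (H x%:C t) * Hy x%:C t).
  move=> x01 t t01; have [h1 h2 h3 h4 [d hd]] := hH _ _ x01 t01.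
  by apply: ctnM => //; apply: (@ctn_comp _ _ setT _ f _ (hasd_ctn h2) (hasd_ctn hd)).
have /choice[Phi hPhi] : forall y : R, exists F, 0 <= y <= 1 -> is_prim F (fun t => f (H t y%:C) * Hx t y%:C).
  by move=> y; have [/cfx/ctn01_prim[F hF]|h] := pselect (0 <= y <= 1); [exists F|exists id => /h].
have /choice[Psi hPsi] : forall x : R, exists F, 0 <= x <= 1 -> is_prim F (fun t => f (H x%:C t) * Hy x%:C t).
  by move=> x; have [/cfy/ctn01_prim[F hF]|h] := pselect (0 <= x <= 1); [exists F|exists id => /h].
rewrite (cintE (hPhi 0 O01)) (cintE (hPhi 1 I1)) (cintE (hPsi 0 O01)) (cintE (hPsi 1 I1)).
pose D (x x' y y' : R) := (Phi y x'%:C - Phi y x%:C) + (Psi x' y'%:C - Psi x' y%:C)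
  - (Phi y' x'%:C - Phi y' x%:C) - (Psi x y'%:C - Psi x y%:C).
suff D0 : D 0 1 0 1 = 0 by apply/eqP; rewrite -subr_eq0; apply/eqP; apply: etrans D0; rewrite /D; ring.
apply/eqP; rewrite -cabs_eq0 eq_le cabs_ge0 andbT leNgt; apply/negP => bad.
set e := cabs (D 0 1 0 1) / 2; have e0 : 0 < e by rewrite /e; lra.
pose h n : R := 1 / 2 ^+ n.
have h0 n : 0 < h n by rewrite /h divr_gt0 // exprn_gt0.
have hS n : h n = h n.+1 + h n.+1 by rewrite /h exprS; field; rewrite expf_neq0.
pose P n (p : R * R) := [/\ 0 <= p.1, p.1 + h n <= 1, 0 <= p.2, p.2 + h n <= 1 &
  e * h n ^+ 2 < cabs (D p.1 (p.1 + h n) p.2 (p.2 + h n))].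
pose Q n (p q : R * R) := p.1 <= q.1 <= p.1 + h n.+1 /\ p.2 <= q.2 <= p.2 + h n.+1.
have P0 : P 0%N (0, 0).
  have h1 : h 0%N = 1 by rewrite /h expr0 divr1.
  by rewrite /P h1 /= !add0r expr1n; split => //; rewrite /e; lra.
have st n p : P n p -> exists2 q, P n.+1 q & Q n p q.
  case: p => x y []; rewrite /P /Q /= hS; set k := h n.+1.
  have k0 : 0 < k by exact: h0.
  move=> x0 x1 y0 y1 big.
  have [g1|g1] := ltP (e * k ^+ 2) (cabs (D x (x + k) y (y + k))).
    by exists (x, y) => /=; split => //=; clear -k0 x0 x1 y0 y1; try split; lra.
  have [g2|g2] := ltP (e * k ^+ 2) (cabs (D (x + k) (x + k + k) y (y + k))).
    by exists (x + k, y) => /=; split => //=; clear -k0 x0 x1 y0 y1; try split; lra.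
  have [g3|g3] := ltP (e * k ^+ 2) (cabs (D x (x + k) (y + k) (y + k + k))).
    by exists (x, y + k) => /=; split => //=; clear -k0 x0 x1 y0 y1; try split; lra.
  have [g4|g4] := ltP (e * k ^+ 2) (cabs (D (x + k) (x + k + k) (y + k) (y + k + k))).
    by exists (x + k, y + k) => /=; split => //=; clear -k0 x0 x1 y0 y1; try split; lra.
  exfalso; move: big; rewrite !addrA.
  have -> : D x (x + k + k) y (y + k + k) =
    (D x (x + k) y (y + k) + D (x + k) (x + k + k) y (y + k)) +
    (D x (x + k) (y + k) (y + k + k) + D (x + k) (x + k + k) (y + k) (y + k + k)).
    by rewrite /D; ring.
  have t1 := cabsD (D x (x + k) y (y + k) + D (x + k) (x + k + k) y (y + k))
    (D x (x + k) (y + k) (y + k + k) + D (x + k) (x + k + k) (y + k) (y + k + k)).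
  have t2 := cabsD (D x (x + k) y (y + k)) (D (x + k) (x + k + k) y (y + k)).
  have t3 := cabsD (D x (x + k) (y + k) (y + k + k)) (D (x + k) (x + k + k) (y + k) (y + k + k)).
  have E : e * (k + k) ^+ 2 = e * k ^+ 2 + e * k ^+ 2 + (e * k ^+ 2 + e * k ^+ 2) by ring.
  rewrite E; lra.
have [u [_ hu]] := dep_choice P0 st.
have [px hpx] := @halving_lim R 1 (fun n => (u n).1) ler01 (fun n => (hu n).2.1).
have [py hpy] := @halving_lim R 1 (fun n => (u n).2) ler01 (fun n => (hu n).2.2).
have [u1 u2 u3 u4 _] := (hu 0%N).1.
have px01 : 0 <= px <= 1 by have /andP[q1 q2] := hpx 0%N; rewrite (le_trans u1 q1) (le_trans q2 u2).
have py01 : 0 <= py <= 1 by have /andP[q1 q2] := hpy 0%N; rewrite (le_trans u3 q1) (le_trans q2 u4).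
set w0 := H px%:C py%:C.
have [_ _ _ _ [d hd]] := hH _ _ px01 py01; rewrite -/w0 in hd.
(* The four sides of a square of size [k] contribute at most [8 * e' * L ^+ 2 * k ^+ 2] in all; this
   choice keeps that below [e * k ^+ 2]. *)
pose e' := e / (16 * (L + 1) ^+ 2).
have e'0 : 0 < e' by rewrite divr_gt0 // mulr_gt0 // exprn_gt0 //; lra.
have [s s0 hs] := hasd_eps (I : setT w0) hd e'0.
have s2 : 0 < s / (2 * (L + 1)) by rewrite divr_gt0 //; lra.
have [n hn] := half_pow_small s2.
have [{}u1 {}u2 {}u3 {}u4 big] := (hu n).1.
have /andP[v1 v2] := hpx n; have /andP[v3 v4] := hpy n.
rewrite -/(h n) in v2 v4; rewrite -[(2 ^+ n)^-1]mul1r -/(h n) in hn.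
set k := h n in u2 u4 big v2 v4 hn; have k0 : 0 < k := h0 n.
move: (u n) u1 u2 u3 u4 big v1 v2 v3 v4 => [x y] /= x0 x1 y0 y1 big v1 v2 v3 v4 {hu hpx hpy u}.
have lipx (y' : R) : 0 <= y' <= 1 -> forall s t : R, 0 <= s <= 1 -> 0 <= t <= 1 ->
    cabs (H s%:C y'%:C - H t%:C y'%:C) <= L * `|s - t|.
  move=> y'01; apply: (@hasd_lip (H^~ y'%:C)) => // t t01.
  by have [g1 _ _ _ _] := hH _ _ t01 y'01; have [g2 _] := hL _ _ t01 y'01; exists (Hx t%:C y'%:C).
have lipy (x' : R) : 0 <= x' <= 1 -> forall s t : R, 0 <= s <= 1 -> 0 <= t <= 1 ->
    cabs (H x'%:C s%:C - H x'%:C t%:C) <= L * `|s - t|.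
  move=> x'01; apply: (@hasd_lip (H x'%:C)) => // t t01.
  by have [_ g1 _ _ _] := hH _ _ x'01 t01; have [_ g2] := hL _ _ x'01 t01; exists (Hy x'%:C t%:C).
have near (a b : R) : x <= a <= x + k -> y <= b <= y + k ->
    [/\ 0 <= a <= 1, 0 <= b <= 1 & cabs (f (H a%:C b%:C) - f w0 - (H a%:C b%:C - w0) * d) <= e' * (2 * L * k)].
  move=> /andP[a1 a2] /andP[b1 b2].
  have a01 : 0 <= a <= 1 by clear -a1 a2 x0 x1; apply/andP; split; lra.
  have b01 : 0 <= b <= 1 by clear -b1 b2 y0 y1; apply/andP; split; lra.
  have dist : cabs (H a%:C b%:C - w0) <= 2 * L * k.
    have t0 := cabs_tri (H a%:C b%:C) (H px%:C b%:C) w0.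
    have t1 := lipx _ b01 _ _ a01 px01; have t2 := lipy _ px01 _ _ b01 py01.
    have t3 : L * `|a - px| <= L * k by rewrite ler_wpM2l // ler_norml; clear -a1 a2 b1 b2 v1 v2 v3 v4; apply/andP; split; lra.
    have t4 : L * `|b - py| <= L * k by rewrite ler_wpM2l // ler_norml; clear -a1 a2 b1 b2 v1 v2 v3 v4; apply/andP; split; lra.
    by rewrite -mulrA; rewrite -/w0 in t2; clear -t0 t1 t2 t3 t4; lra.
  split => //; apply: le_trans (hs _ _ _) _ => //.
    apply: le_lt_trans dist _; clear -hn L0 k0; move: hn; rewrite ltr_pdivlMr; last by lra.
    by apply: le_lt_trans; nra.
  by rewrite ler_wpM2l // ltW.
(* A primitive of the affine approximation of [f] at [w0]. Its increments round the small square
   cancel, so only the first-order remainder of [f] is left. *)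
pose q w := f w0 * w + d / 2 * (w - w0) ^+ 2.
have dq w : hasd setT q w (f w0 + (w - w0) * d).
  have -> : f w0 + (w - w0) * d = f w0 * 1 + d / 2 * (2%:R * (w - w0) ^+ 1 * (1 - 0)) by field.
  apply: hasdD; first by apply: hasdZ; exact: hasd_id.
  apply: hasdZ; apply: (@hasdX _ _ _ _ _ 2); apply: hasdB; [exact: hasd_id|exact: hasd_const].
have sub01 (a : R) : 0 <= a -> a + k <= 1 -> rseg a (a + k) `<=` I01.
  by move=> a0 a1 _ [t /andP[t1 t2] ->]; exists t => //; rewrite (le_trans a0 t1) (le_trans t2 a1).
set B := e' * (2 * L * k) * L * k.
have B0 : 0 <= e' * (2 * L * k) * L.
  by apply: mulr_ge0 (L0); apply: mulr_ge0 (ltW e'0) _; apply: mulr_ge0 (ltW k0); apply: mulr_ge0 (L0); exact: ler0n.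
have kE (c : R) : c + k - c = k by rewrite addrC addKr.
have horiz (b : R) : y <= b <= y + k ->
    cabs ((Phi b (x + k)%:C - Phi b x%:C) - (q (H (x + k)%:C b%:C) - q (H x%:C b%:C))) <= B.
  move=> yb.
  have := @mean_value R (fun z => Phi b z - q (H z b%:C)) x (x + k) (e' * (2 * L * k) * L).
  rewrite kE -/B => mv.
  rewrite (_ : _ - _ = Phi b (x + k)%:C - q (H (x + k)%:C b%:C) - (Phi b x%:C - q (H x%:C b%:C))); last by ring.
  apply: mv; [by rewrite lerDl ltW|exact: B0|].
  move=> t t1; have [t01 b01 tn] := near _ _ t1 yb.
  have [g1 _ _ _ _] := hH _ _ t01 b01; have [g2 _] := hL _ _ t01 b01.
  exists (f (H t%:C b%:C) * Hx t%:C b%:C - (f w0 + (H t%:C b%:C - w0) * d) * Hx t%:C b%:C).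
    apply: hasdB; first by apply: hasd_sub (hPhi _ b01 _ t01); exact: sub01.
    apply: (@hasd_comp _ _ setT (H^~ b%:C) q) => //; first by apply: hasd_sub g1; exact: sub01.
  rewrite -mulrBl cabsM opprD addrA; apply: ler_pM => //; exact: cabs_ge0.
have vert (a : R) : x <= a <= x + k ->
    cabs ((Psi a (y + k)%:C - Psi a y%:C) - (q (H a%:C (y + k)%:C) - q (H a%:C y%:C))) <= B.
  move=> xa.
  have := @mean_value R (fun z => Psi a z - q (H a%:C z)) y (y + k) (e' * (2 * L * k) * L).
  rewrite kE -/B => mv.
  rewrite (_ : _ - _ = Psi a (y + k)%:C - q (H a%:C (y + k)%:C) - (Psi a y%:C - q (H a%:C y%:C))); last by ring.
  apply: mv; [by rewrite lerDl ltW|exact: B0|].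
  move=> t t1; have [a01 t01 tn] := near _ _ xa t1.
  have [_ g1 _ _ _] := hH _ _ a01 t01; have [_ g2] := hL _ _ a01 t01.
  exists (f (H a%:C t%:C) * Hy a%:C t%:C - (f w0 + (H a%:C t%:C - w0) * d) * Hy a%:C t%:C).
    apply: hasdB; first by apply: hasd_sub (hPsi _ a01 _ t01); exact: sub01.
    apply: (@hasd_comp _ _ setT (H a%:C) q) => //; first by apply: hasd_sub g1; exact: sub01.
  rewrite -mulrBl cabsM opprD addrA; apply: ler_pM => //; exact: cabs_ge0.
have xx : x <= x <= x + k by rewrite lexx lerDl ltW.
have xk : x <= x + k <= x + k by rewrite lexx lerDl ltW.
have yy : y <= y <= y + k by rewrite lexx lerDl ltW.
have yk : y <= y + k <= y + k by rewrite lexx lerDl ltW.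
have b1 := horiz _ yy; have b2 := horiz _ yk; have b3 := vert _ xx; have b4 := vert _ xk.
have E : D x (x + k) y (y + k) =
  (((Phi y (x + k)%:C - Phi y x%:C) - (q (H (x + k)%:C y%:C) - q (H x%:C y%:C))) +
   ((Psi (x + k) (y + k)%:C - Psi (x + k) y%:C) - (q (H (x + k)%:C (y + k)%:C) - q (H (x + k)%:C y%:C)))) -
  (((Phi (y + k) (x + k)%:C - Phi (y + k) x%:C) - (q (H (x + k)%:C (y + k)%:C) - q (H x%:C (y + k)%:C))) +
   ((Psi x (y + k)%:C - Psi x y%:C) - (q (H x%:C (y + k)%:C) - q (H x%:C y%:C)))) by rewrite /D; ring.
move: big; rewrite E; apply/negP; rewrite -leNgt.
apply: le_trans (cabs_sub _ _) _.
apply: le_trans (lerD (le_trans (cabsD _ _) (lerD b1 b4)) (le_trans (cabsD _ _) (lerD b2 b3))) _.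
have -> : B + B + (B + B) = e' * (8 * L ^+ 2) * k ^+ 2 by rewrite /B; ring.
rewrite ler_wpM2r ?sqr_ge0 // /e' -mulrA ler_piMr ?(ltW e0) //.
clear -L0; rewrite mulrC ler_pdivrMr; last by rewrite mulr_gt0 // exprn_gt0 //; lra.
by rewrite mul1r; nra.
Qed.

End Integral.

(** * The complex exponential *)

Arguments cabs {R} z : simpl never.

(* Locked, lest rewriting with [cabsM] or [hasdM] look through it to a product. *)
HB.lock Definition cexp {R : realType} (z : R[i]) : R[i] :=
  (expR (Re z))%:C * (cos (Im z) +i* sin (Im z)).

Section Exponential.
Variable R : realType.
Notation C := R[i].
Implicit Types z w : C.

Lemma cexp0 : cexp 0 = 1 :> C.
Proof. by rewrite cexp.unlock expR0 cos0 sin0 mul1r. Qed.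

Lemma cexpD z w : cexp (z + w) = cexp z * cexp w.
Proof.
case: z => a b; case: w => c d; rewrite cexp.unlock /= expRD cosD sinD.
by apply/eqP; rewrite eq_complex /=; apply/andP; split; apply/eqP; ring.
Qed.

Lemma cabs_cexp z : cabs (cexp z) = expR (Re z).
Proof.
rewrite cexp.unlock cabsM cabs_real ger0_norm ?expR_ge0 //.
by rewrite [X in _ * X]/cabs /= cos2Dsin2 sqrtr1 mulr1.
Qed.

Lemma cexp_neq0 z : cexp z != 0.
Proof. by rewrite -cabs_gt0 cabs_cexp expR_gt0. Qed.

Lemma cexpN z : cexp (- z) = (cexp z)^-1.
Proof.
apply: (mulIf (cexp_neq0 z)).
by rewrite -cexpD addNr cexp0 mulVf // cexp_neq0.
Qed.

Lemma is_derive_eps (f : R -> R) (x d : R) : is_derive x 1 f d ->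
  forall e : R, 0 < e -> exists2 s : R, 0 < s &
  forall y, `|y - x| < s -> `|f y - f x - (y - x) * d| <= e * `|y - x|.
Proof.
move=> /is_derive1_caratheodory[g [g1 g2 g3]] e e0.
move: g2 => /cvgrPdist_lt /(_ _ e0) /nbhs_ballP[s /= s0 hs].
exists s => // y ys; rewrite g1 mulrC -mulrBr normrM mulrC ler_wpM2r // -g3 distrC ltW //.
by apply: hs; rewrite /ball /= distrC.
Qed.

Lemma hasd_cexp0 : hasd setT (@cexp R) 0 1.
Proof.
apply: eps_hasd => // e e0.
(* The estimates below collect seven errors of at most [e / 8 * n] and a term [2 * n * n] with
   [n < e / 16], that is, exactly [e * n]. *)
have e8 : 0 < Num.min 1 (e / 8) by rewrite lt_min ltr01 divr_gt0.
have [s1 s10 h1] := is_derive_eps (is_derive_expR 0) e8.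
have [s2 s20 h2] := is_derive_eps (is_derive_cos (0 : R)) e8.
have [s3 s30 h3] := is_derive_eps (is_derive_sin (0 : R)) e8.
exists (Num.min (Num.min s1 s2) (Num.min s3 (Num.min 1 (e / 16)))).
  by rewrite !lt_min s10 s20 s30 ltr01 divr_gt0.
move=> [a b] _; rewrite subr0 !lt_min => /andP[/andP[w1 w2] /and3P[w3 w4 w5]].
have ra : `|a| <= cabs (a +i* b) := Re_le_cabs (a +i* b).
have rb : `|b| <= cabs (a +i* b) := Im_le_cabs (a +i* b).
set n := cabs _ in w1 w2 w3 w4 w5 ra rb *.
have {h1} := h1 a; rewrite subr0 expR0 [a * 1]mulr1 => /(_ (le_lt_trans ra w1)) h1.
have {h2} := h2 b; rewrite subr0 cos0 sin0 oppr0 [b * 0]mulr0 subr0 => /(_ (le_lt_trans rb w2)) h2.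
have {h3} := h3 b; rewrite subr0 cos0 sin0 [b * 1]mulr1 subr0 => /(_ (le_lt_trans rb w3)) h3.
rewrite cexp0.
set m := Num.min 1 _ in h1 h2 h3.
have m1 : m <= 1 by rewrite ge_min lexx.
have m2 : m <= e / 8 by rewrite ge_min lexx orbT.
have m0 : 0 <= m by rewrite ltW.
apply: le_trans (cabs_le_ReIm _) _; rewrite cexp.unlock /=; rewrite !mul0r !subr0 !addr0.
set A := expR a in h1 *; set c := cos b in h2 *; set d := sin b in h3 *.
have n0 : 0 <= n by apply: cabs_ge0.
have k1 : `|A - 1 - a| <= m * n by apply: le_trans h1 _; rewrite ler_wpM2l.
have k2 : `|c - 1| <= m * n by apply: le_trans h2 _; rewrite ler_wpM2l.
have k3 : `|d - b| <= m * n by apply: le_trans h3 _; rewrite ler_wpM2l.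
have mn : m * n <= n by rewrite ler_piMl.
have A2 : `|A| <= 3.
  have -> : A = (A - 1 - a) + (1 + a) by ring.
  have a1 : `|1 + a| <= 1 + n by apply: le_trans (ler_normD _ _) _; rewrite normr1 lerD2l.
  apply: le_trans (ler_normD _ _) _; apply: le_trans (lerD (le_trans k1 mn) a1) _.
  clear - w4; lra.
have A1 : `|A - 1| <= 2 * n.
  have -> : A - 1 = (A - 1 - a) + a by ring.
  by apply: le_trans (ler_normD _ _) _; lra.
have -> : A * c - 1 - (a * 1 - b * 0) = A * (c - 1) + (A - 1 - a) by ring.
have -> : A * d - (a * 0 + b * 1) = A * (d - b) + (A - 1) * b by ring.
have q1 : `|A * (c - 1)| <= 3 * (m * n) by rewrite normrM; apply: ler_pM.
have q2 : `|A * (d - b)| <= 3 * (m * n) by rewrite normrM; apply: ler_pM.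
have q3 : `|(A - 1) * b| <= (2 * n) * n by rewrite normrM; apply: ler_pM.
have q4 := ler_normD (A * (c - 1)) (A - 1 - a).
have q5 := ler_normD (A * (d - b)) ((A - 1) * b).
have q6 : m * n <= e / 8 * n by rewrite ler_wpM2r.
have q7 : n * n <= e / 16 * n by rewrite ler_wpM2r // ltW.
lra.
Qed.

Lemma hasd_cexp z : hasd setT cexp z (cexp z).
Proof.
apply: (@hasd_ext _ _ (fun w => cexp z * cexp (w - z))).
- by move=> w _; rewrite -cexpD addrC subrK.
- by rewrite subrr cexp0 mulr1.
have := @hasd_comp _ setT setT (fun w => w - z) cexp z (1 - 0) 1 (hasdB (hasd_id setT z) (hasd_const setT z z)).
rewrite subrr => /(_ hasd_cexp0 (fun _ _ => I)); rewrite subr0 mulr1 => h.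
by have := hasdZ (cexp z) h; rewrite mulr1.
Qed.

Definition tau : C := 0 +i* (2 * pi).

Lemma cexp_tau : cexp tau = 1.
Proof.
by rewrite cexp.unlock /tau /= expR0 mul1r mulrC mulr_natr cos2pi -[pi *+ 2]add0r sinD2pi sin0.
Qed.

Lemma tau_neq0 : tau != 0.
Proof. by rewrite eq_complex /= negb_and mulf_neq0 ?orbT // gt_eqF // pi_gt0. Qed.

Lemma cabs_tau : cabs tau = 2 * pi.
Proof. by rewrite /cabs /tau /= expr0n /= add0r sqrtr_sqr ger0_norm // mulr_ge0 // pi_ge0. Qed.

Lemma Re_tauM (t : R) : Re (tau * t%:C) = 0.
Proof. by rewrite /tau /=; ring. Qed.

Lemma cexp_surj z : z != 0 -> exists w, cexp w = z.
Proof.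
case: z => a b z0; pose r := cabs (a +i* b).
have r0 : 0 < r by rewrite cabs_gt0.
have E : a ^+ 2 + b ^+ 2 = r ^+ 2 by rewrite /r sqr_cabs.
pose u := a / r.
have u1 : -1 <= u <= 1.
  by rewrite -ler_norml /u normrM normfV (gtr0_norm r0) ler_pdivrMr // mul1r; exact: (Re_le_cabs (a +i* b)).
have ca : cos (acos u) = u by rewrite acosK.
have sa : sin (acos u) = Num.sqrt (1 - u ^+ 2) by rewrite sin_acos.
have S : r * Num.sqrt (1 - u ^+ 2) = `|b|.
  rewrite -[r]gtr0_norm // -sqrtr_sqr -sqrtrM ?sqr_ge0 // -[`|b|]sqrtr_sqr; congr Num.sqrt.
  rewrite (_ : b ^+ 2 = r ^+ 2 - a ^+ 2); last by rewrite -E; ring.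
  by rewrite /u; field; rewrite gt_eqF.
have rl : expR (ln r) = r by rewrite lnK.
have au : r * u = a by rewrite /u; field; rewrite gt_eqF.
have [b0|b0] := leP 0 b.
  exists (ln r +i* acos u); rewrite cexp.unlock /= rl ca sa.
  by apply/eqP; rewrite eq_complex /= !mul0r subr0 addr0 au S ger0_norm // !eqxx.
exists (ln r +i* (- acos u)); rewrite cexp.unlock /= rl cosN sinN ca sa.
by apply/eqP; rewrite eq_complex /= !mul0r subr0 addr0 au mulrN S ltr0_norm // opprK !eqxx.
Qed.

End Exponential.

(** * Cauchy's theorem on circles *)

Section Cauchy.
Variable R : realType.
Notation C := R[i].
Notation I01 := (rseg (0 : R) 1).
Implicit Types (f g : C -> C) (a z w : C) (r M : R).

Definition holo (D : set C) f := forall z, D z -> exists d, hasd setT f z d.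

Lemma hasdZr D f z d (c : C) : hasd D f z d -> hasd D (fun w => f w * c) z (d * c).
Proof.
by move=> hf; have := hasdM hf (hasd_const D c z); rewrite mulr0 addr0.
Qed.

Definition circ a r (t : C) : C := a + r%:C * cexp (tau R * t).
Definition circ' r (t : C) : C := r%:C * (cexp (tau R * t) * tau R).

Lemma hasd_circ a r t : hasd setT (circ a r) t (circ' r t).
Proof.
rewrite /circ' -[_ * (_ * _)]add0r; apply: hasdD; first exact: hasd_const.
apply: hasdZ; apply: (@hasd_comp _ _ setT (fun w => tau R * w)) => //; last exact: hasd_cexp.
by rewrite -[X in hasd _ _ _ X]mulr1; apply: hasdZ; exact: hasd_id.
Qed.

Lemma hasd_circ' r t : hasd setT (circ' r) t (r%:C * (cexp (tau R * t) * tau R * tau R)).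
Proof.
apply: hasdZ; rewrite -[X in hasd _ _ _ X]addr0 -[X in _ + X](mulr0 (cexp (tau R * t))).
apply: hasdM; last exact: hasd_const.
apply: (@hasd_comp _ _ setT (fun w => tau R * w)) => //; last exact: hasd_cexp.
by rewrite -[X in hasd _ _ _ X]mulr1; apply: hasdZ; exact: hasd_id.
Qed.

Lemma cabs_cexp_tau (t : R) : cabs (cexp (tau R * t%:C)) = 1.
Proof. by rewrite cabs_cexp Re_tauM expR0. Qed.

Lemma cabs_circ a r (t : R) : 0 <= r -> cabs (circ a r t%:C - a) = r.
Proof. by move=> r0; rewrite /circ addrAC subrr add0r cabsM cabs_cexp_tau mulr1 cabs_real ger0_norm. Qed.

Lemma cabs_circ' r (t : R) : 0 <= r -> cabs (circ' r t%:C) = r * (2 * pi).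
Proof. by move=> r0; rewrite /circ' !cabsM cabs_cexp_tau mul1r cabs_tau cabs_real ger0_norm. Qed.

Lemma circ01 a r : circ a r 0 = circ a r 1.
Proof. by rewrite /circ mulr0 mulr1 cexp0 cexp_tau. Qed.

Lemma ctn_holo D f z : holo setT f -> ctn D f z.
Proof. by move=> /(_ z I)[d /hasd_ctn]; apply: ctn_sub => w. Qed.

Lemma ctn_holo_at D (E : set C) f z : holo E f -> E z -> ctn D f z.
Proof. by move=> h /h[d /hasd_ctn]; apply: ctn_sub => w. Qed.

Lemma ctn01_circ a r f : 0 <= r -> holo (fun w => cabs (w - a) = r) f -> ctn01 (fun t => f (circ a r t)).
Proof.
move=> r0 hf t t01; apply: (@ctn_comp _ _ setT (circ a r)) => //.
  by apply: ctn_sub (hasd_ctn (hasd_circ _ _ _)) => w.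
by apply: (@ctn_holo_at _ _ f _ hf); exact: cabs_circ.
Qed.

Lemma ctn01_circ' r : ctn01 (circ' r).
Proof. by move=> t t01; apply: ctn_sub (hasd_ctn (hasd_circ' _ _)) => w. Qed.

Definition oint f a r : C := cint (fun t => f (circ a r t) * circ' r t).

Lemma ctn01_oint f a r : 0 <= r -> holo (fun w => cabs (w - a) = r) f ->
  ctn01 (fun t => f (circ a r t) * circ' r t).
Proof. by move=> r0 hf t t01; apply: ctnM; [exact: (ctn01_circ r0 hf)|exact: ctn01_circ']. Qed.

Lemma oint_bound f a r M : 0 <= r -> holo (fun w => cabs (w - a) = r) f ->
  (forall w, cabs (w - a) = r -> cabs (f w) <= M) -> cabs (oint f a r) <= 2 * pi * (M * r).
Proof.
move=> r0 hf hM; apply: cint_bound; first exact: ctn01_oint.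
move=> t t01; rewrite cabsM cabs_circ' // [leRHS]mulrC -mulrA ler_wpM2r //.
  by rewrite mulr_ge0 // mulr_ge0 // pi_ge0.
by apply: hM; exact: cabs_circ.
Qed.

Lemma ointD f g a r : 0 <= r -> holo (fun w => cabs (w - a) = r) f ->
  holo (fun w => cabs (w - a) = r) g -> oint (fun w => f w + g w) a r = oint f a r + oint g a r.
Proof.
move=> r0 hf hg; rewrite /oint -cintD; [|exact: ctn01_oint..].
apply: cint_ext => [t t01|]; first by rewrite mulrDl.
apply: (@ctn01_oint (fun w => f w + g w)) => // w rw.
by have [d1 h1] := hf _ rw; have [d2 h2] := hg _ rw; exists (d1 + d2); exact: hasdD.
Qed.

Lemma ointZ c f a r : 0 <= r -> holo (fun w => cabs (w - a) = r) f ->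
  oint (fun w => c * f w) a r = c * oint f a r.
Proof.
move=> r0 hf; rewrite /oint -cintZ; last exact: ctn01_oint.
apply: cint_ext => [t t01|]; first by rewrite mulrA.
apply: (@ctn01_oint (fun w => c * f w)) => // w rw.
by have [d1 h1] := hf _ rw; exists (c * d1); exact: hasdZ.
Qed.

Lemma oint_ext f g a r : 0 <= r -> holo (fun w => cabs (w - a) = r) f ->
  (forall w, cabs (w - a) = r -> f w = g w) -> oint f a r = oint g a r.
Proof.
move=> r0 hf fg; apply: cint_ext; last exact: ctn01_oint.
by move=> t t01; rewrite fg // cabs_circ.
Qed.

(** [hasd_inv] asks for nonvanishing on the whole reference set, so the derivative is taken relative
    to the punctured plane and then carried over to [setT] within distance [cabs z]. *)
Lemma hasd_invC z : z != 0 -> exists d, hasd setT (fun w : C => w^-1) z d.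
Proof.
move=> z0; exists (- 1 / z ^+ 2); apply: eps_hasd => // e e0.
have [p [p1 p2 p3]] := @hasd_inv _ (fun w => w != 0) id z 1 z0 (hasd_id _ _) (fun _ h => h).
have [s s0 hs] := @hasd_eps _ (fun w => w != 0) _ _ _ z0 (ex_intro _ p (And3 p1 p2 p3)) _ e0.
have m0 : 0 < cabs z by rewrite cabs_gt0.
exists (Num.min s (cabs z)); first by rewrite lt_min s0.
move=> w _; rewrite lt_min => /andP[w1 w2]; apply: hs => //.
by apply/eqP => w0; move: w2; rewrite w0 sub0r cabsN ltxx.
Qed.

(** The homotopy [H] translates the circle until its centre moves from [a] to [z]. It avoids 0
    because [cabs (z - a) < r], its sides [t = 0] and [t = 1] cancel, and at one end the integrand
    is the constant [tau R]. *)
Lemma oint_inv a r z : 0 < r -> cabs (z - a) < r -> oint (fun w => (w - z)^-1) a r = tau R.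
Proof.
move=> r0 zr; have r0' := ltW r0.
pose H (s t : C) : C := r%:C * cexp (tau R * t) - s * (z - a).
pose Hx (s t : C) : C := - (z - a).
pose Hy (s t : C) : C := circ' r t.
have ne (s t : R) : 0 <= s <= 1 -> H s%:C t%:C != 0.
  move=> /andP[s0 s1]; rewrite -cabs_gt0; apply: lt_le_trans (cabs_sub_ge _ _).
  rewrite !cabsM cabs_cexp_tau mulr1 !cabs_real !ger0_norm // subr_gt0.
  by apply: le_lt_trans zr; rewrite ler_piMl ?cabs_ge0.
have E : cint (fun t => (H t 0)^-1 * Hx t 0) + cint (fun t => (H 1 t)^-1 * Hy 1 t) =
  cint (fun t => (H t 1)^-1 * Hx t 1) + cint (fun t => (H 0 t)^-1 * Hy 0 t).
  apply: (@goursat R (fun w => w^-1) H Hx Hy (Num.max (cabs (z - a)) (r * (2 * pi)))) => [x y x01 y01|x y x01 y01]; last first.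
    by rewrite /Hx /Hy cabsN cabs_circ' // !le_max !lexx orbT; split.
  split.
  + rewrite /H /Hx -[X in hasd _ _ _ X]sub0r; apply: hasdB; first exact: hasd_const.
    by rewrite -[X in hasd _ _ _ X]mul1r; apply: hasdZr; exact: hasd_id.
  + rewrite /H /Hy -[circ' _ _]subr0; apply: hasdB; last exact: hasd_const.
    apply: (@hasd_ext _ _ (circ 0 r)) => [w _||]; rewrite /circ ?add0r //.
    by apply: hasd_sub (hasd_circ 0 _ _) => w.
  + exact: ctn_const.
  + exact: ctn01_circ'.
  + by apply: hasd_invC; exact: ne.
have E1 : cint (fun t => (H 0 t)^-1 * Hy 0 t) = tau R.
  rewrite (@cintE _ (fun t => tau R * t)) => [|t t01]; first by rewrite mulr1 mulr0 subr0.
  rewrite (_ : _ * _ = tau R * 1); first by apply: hasdZ; exact: hasd_id.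
  rewrite /H /Hy /circ' mul0r subr0; field.
  by rewrite cexp_neq0 -cabs_gt0 cabs_real normr_gt0 gt_eqF.
have E2 : cint (fun t => (H t 0)^-1 * Hx t 0) = cint (fun t => (H t 1)^-1 * Hx t 1).
  by rewrite /H /Hx mulr0 mulr1 cexp0 cexp_tau.
have E3 : oint (fun w => (w - z)^-1) a r = cint (fun t => (H 1 t)^-1 * Hy 1 t).
  rewrite /oint; congr cint; apply/funext => t; rewrite /H /Hy /circ mul1r.
  by congr (_^-1 * _); ring.
by rewrite E3; apply: (addrI (cint (fun t => (H t 0)^-1 * Hx t 0))); rewrite E E1 E2.
Qed.

Lemma disc_convex a r z w (s : R) : 0 <= s <= 1 -> cabs (z - a) <= r -> cabs (w - a) <= r ->
  cabs (z + s%:C * (w - z) - a) <= r.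
Proof.
move=> /andP[s0 s1] hz hw.
have -> : z + s%:C * (w - z) - a = (1 - s)%:C * (z - a) + s%:C * (w - a).
  by rewrite rmorphB rmorph1; ring.
apply: le_trans (cabsD _ _) _; rewrite !cabsM !cabs_real !ger0_norm ?subr_ge0 //.
have : (1 - s) * cabs (z - a) <= (1 - s) * r by rewrite ler_wpM2l // subr_ge0.
have : s * cabs (w - a) <= s * r by rewrite ler_wpM2l.
lra.
Qed.

(** The quotient is holomorphic off [z] and bounded near [z]. Contracting the circle towards [z] to
    the scale [e] keeps the integral while its bound is of order [e]; the removable singularity
    itself is never filled. *)
Lemma oint_quot f a r z : 0 < r -> cabs (z - a) < r -> holo (cdisc a r) f ->
  oint (fun w => (f w - f z) / (w - z)) a r = 0.
Proof.
move=> r0 zr hf; have r0' := ltW r0.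
pose g w := (f w - f z) / (w - z).
have [d hd] := hf z (ltW zr).
have [s s0 hs] := hasd_eps I hd ltr01.
have gb w : w != z -> cabs (w - z) < s -> cabs (g w) <= cabs d + 1.
  move=> wz ws; have wz0 : 0 < cabs (w - z) by rewrite cabs_gt0 subr_eq0.
  rewrite /g cabsM cabsV ler_pdivrMr //; have := hs _ I ws; rewrite mul1r.
  have -> : f w - f z = (f w - f z - (w - z) * d) + (w - z) * d by ring.
  have := cabsD (f w - f z - (w - z) * d) ((w - z) * d); rewrite cabsM.
  rewrite addrNK; nra.
have hg w : cabs (w - a) <= r -> w != z -> exists e, hasd setT g w e.
  move=> wa wz; have wz0 : w - z != 0 by rewrite subr_eq0.
  have [e he] := hf w wa; have [e2 he2] := hasd_invC wz0.
  exists ((e - 0) * (w - z)^-1 + (f w - f z) * (e2 * (1 - 0))).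
  apply: hasdM; first by apply: hasdB => //; exact: hasd_const.
  apply: (@hasd_comp _ _ setT (fun w => w - z) (fun w => w^-1)) => //.
  by apply: hasdB; [exact: hasd_id|exact: hasd_const].
have small (e : R) : 0 < e < 1 -> e * (2 * r) < s -> cabs (oint g a r) <= (cabs d + 1) * (e * (r * (2 * pi))).
  move=> /andP[e0 e1] es.
  pose si (u : C) : C := e%:C + (1 - e)%:C * u.
  pose H (u t : C) : C := z + si u * (circ a r t - z).
  pose Hx (u t : C) : C := (1 - e)%:C * (circ a r t - z).
  pose Hy (u t : C) : C := si u * circ' r t.
  have siE (u : R) : si u%:C = (e + (1 - e) * u)%:C by rewrite [RHS]rmorphD [X in _ = _ + X]rmorphM.
  have si01 (u : R) : 0 <= u <= 1 -> 0 < e + (1 - e) * u <= 1.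
    by move=> /andP[u0 u1]; apply/andP; split; nra.
  have cz (t : R) : 0 < cabs (circ a r t%:C - z) <= 2 * r.
    have c1 := @cabs_circ a r t r0'.
    have := cabs_tri (circ a r t%:C) a z; have := cabs_tri (circ a r t%:C) z a.
    by rewrite (cabsB a z) c1 => h1 h2; apply/andP; split; lra.
  have Hin (u t : R) : 0 <= u <= 1 -> cabs (H u%:C t%:C - a) <= r.
    move=> /si01/andP[u0 u1]; rewrite /H siE; apply: disc_convex; [by rewrite (ltW u0)|exact: ltW|].
    by rewrite cabs_circ.
  have Hne (u t : R) : 0 <= u <= 1 -> H u%:C t%:C != z.
    move=> /si01/andP[u0 u1]; rewrite -subr_eq0 /H addrAC subrr add0r -cabs_gt0 cabsM siE cabs_real.
    by rewrite mulr_gt0 ?normr_gt0 ?gt_eqF //; have /andP[] := cz t.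
  have E : cint (fun t => g (H t 0) * Hx t 0) + cint (fun t => g (H 1 t) * Hy 1 t) =
    cint (fun t => g (H t 1) * Hx t 1) + cint (fun t => g (H 0 t) * Hy 0 t).
    apply: (@goursat R g H Hx Hy (Num.max (2 * r) (r * (2 * pi)))) => [x y x01 y01|x y x01 y01]; last first.
      rewrite /Hx /Hy (cabsM (1 - e)%:C) (cabsM (si x%:C)) cabs_circ' // siE !cabs_real !le_max; have /andP[u0 u1] := si01 _ x01.
      have /andP[v0 v1] := cz y.
      rewrite (gtr0_norm u0) ger0_norm; last by lra.
      split; apply/orP; [left|right].
        apply: le_trans v1; rewrite ger_pMl //; lra.
      by rewrite ler_piMl // mulr_ge0 // mulr_ge0 // pi_ge0.
    split.
    - rewrite /H /Hx -[X in hasd _ _ _ X]add0r; apply: hasdD; first exact: hasd_const.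
      apply: hasdZr.
      rewrite /si -[X in hasd _ _ _ X]add0r; apply: hasdD; first exact: hasd_const.
      by rewrite -[X in hasd _ _ _ X]mulr1; apply: hasdZ; exact: hasd_id.
    - rewrite /H /Hy -[X in hasd _ _ _ X]add0r; apply: hasdD; first exact: hasd_const.
      apply: hasdZ; rewrite -[circ' _ _]subr0; apply: hasdB; last exact: hasd_const.
      by apply: hasd_sub (hasd_circ _ _ _) => w.
    - exact: ctn_const.
    - by apply: ctnM; [exact: ctn_const|exact: ctn01_circ'].
    - by apply: hg; [exact: Hin|exact: Hne].
  have E2 : cint (fun t => g (H t 0) * Hx t 0) = cint (fun t => g (H t 1) * Hx t 1).
    by rewrite /H /Hx circ01.
  have E3 : oint g a r = cint (fun t => g (H 1 t) * Hy 1 t).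
    rewrite /oint; congr cint; apply/funext => t; rewrite /H /Hy /si.
    have -> : e%:C + (1 - e)%:C * 1 = 1 by rewrite rmorphB rmorph1; ring.
    by rewrite !mul1r addrC subrK.
  have -> : oint g a r = cint (fun t => g (H 0 t) * Hy 0 t).
    by rewrite E3; apply: (addrI (cint (fun t => g (H t 0) * Hx t 0))); rewrite E E2.
  have O01 : (0 : R) <= (0 : R) <= (1 : R) by apply/andP; split; [exact: lexx|exact: ler01].
  apply: cint_bound => [t t01|t t01].
    apply: ctnM; last by apply: ctnM; [exact: ctn_const|exact: ctn01_circ'].
    apply: (@ctn_comp _ _ setT (H 0) g) => //; last first.
      by have [e' he'] := hg _ (Hin 0 t O01) (Hne 0 t O01); exact: hasd_ctn he'.
    apply: ctnD; first exact: ctn_const.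
    apply: ctnM; first exact: ctn_const.
    apply: ctnD; last exact: ctn_const.
    by apply: ctn_sub (hasd_ctn (hasd_circ _ _ _)) => w.
  have s0e : si 0 = e%:C by rewrite /si mulr0 addr0.
  rewrite cabsM /Hy s0e cabsM cabs_real (gtr0_norm e0) cabs_circ' //.
  rewrite ler_pM ?cabs_ge0 //; first by rewrite mulr_ge0 ?(ltW e0) // mulr_ge0 // mulr_ge0 // pi_ge0.
  apply: gb; first exact: (Hne 0 t O01).
  rewrite /H s0e addrAC subrr add0r cabsM cabs_real (gtr0_norm e0).
  by apply: le_lt_trans es; rewrite ler_pM2l //; have /andP[] := cz t.
apply/eqP; rewrite -cabs_eq0 eq_le cabs_ge0 andbT leNgt; apply/negP => bad.
set X := cabs _ in bad.
have d0 := cabs_ge0 d; have p0 : 0 < pi :> R := pi_gt0 R.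
pose K := (cabs d + 1) * (r * (2 * pi)).
have K0 : 0 < K by rewrite mulr_gt0 //; [lra|rewrite mulr_gt0 // mulr_gt0].
(* The three bounds keep [e] below 1, place the small curve where the quotient is bounded, and bring
   the integral down to [X / 2]. *)
pose e := Num.min (1 / 2) (Num.min (s / (4 * r)) (X / (2 * K))).
have e0 : 0 < e by rewrite !lt_min !divr_gt0 // mulr_gt0.
have e1 : e <= 1 / 2 by rewrite ge_min lexx.
have e2 : e <= s / (4 * r) by rewrite !ge_min lexx orbT.
have e3 : e <= X / (2 * K) by rewrite !ge_min lexx !orbT.
have := small e; rewrite -/X e0 /= => /(_ _ _)h.
have {h} : X <= (cabs d + 1) * (e * (r * (2 * pi))).
  apply: h; first by lra.
  move: e2; rewrite ler_pdivlMr; last by rewrite mulr_gt0.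
  by move: s0; clear; lra.
have -> : (cabs d + 1) * (e * (r * (2 * pi))) = e * K by rewrite /K; ring.
move: e3; rewrite ler_pdivlMr; last by rewrite mulr_gt0.
by move: bad; clear; lra.
Qed.

End Cauchy.

(** * Cauchy's formula and Taylor polynomials *)

Section Taylor.
Variable R : realType.
Notation C := R[i].
Implicit Types (f g : C -> C) (a z w : C) (r M : R).

Lemma holo_sub (D E : set C) f : D `<=` E -> holo E f -> holo D f.
Proof. by move=> DE h z /DE /h. Qed.

Lemma holoD (D : set C) f g : holo D f -> holo D g -> holo D (fun w => f w + g w).
Proof. by move=> hf hg w Dw; have [d h1] := hf _ Dw; have [e h2] := hg _ Dw; exists (d + e); exact: hasdD. Qed.

Lemma holoN (D : set C) f : holo D f -> holo D (fun w => - f w).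
Proof. by move=> hf w Dw; have [d h1] := hf _ Dw; exists (- d); exact: hasdN. Qed.

Lemma holoB (D : set C) f g : holo D f -> holo D g -> holo D (fun w => f w - g w).
Proof. by move=> hf hg; apply: (holoD hf); exact: holoN. Qed.

Lemma holoM (D : set C) f g : holo D f -> holo D g -> holo D (fun w => f w * g w).
Proof. by move=> hf hg w Dw; have [d h1] := hf _ Dw; have [e h2] := hg _ Dw; exists (d * g w + f w * e); exact: hasdM. Qed.

Lemma holo_const (D : set C) c : holo D (fun=> c).
Proof. by move=> w Dw; exists 0; exact: hasd_const. Qed.

Lemma holo_id (D : set C) : holo D id.
Proof. by move=> w Dw; exists 1; exact: hasd_id. Qed.

Lemma holoX (D : set C) f n : holo D f -> holo D (fun w => f w ^+ n).
Proof. by move=> hf w Dw; have [d h1] := hf _ Dw; exists (n%:R * f w ^+ n.-1 * d); exact: hasdX. Qed.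

Lemma holo_comp (D E : set C) f g : holo D f -> holo E g -> (forall w, D w -> E (f w)) ->
  holo D (fun w => g (f w)).
Proof.
move=> hf hg DE w Dw; have [d h1] := hf _ Dw; have [e h2] := hg _ (DE _ Dw).
by exists (e * d); apply: (@hasd_comp _ _ setT).
Qed.

Lemma holoV (D : set C) f : holo D f -> (forall w, D w -> f w != 0) -> holo D (fun w => (f w)^-1).
Proof. by move=> hf f0; apply: (holo_comp hf (E := fun w => w != 0)) => // w; exact: hasd_invC. Qed.

Lemma holo_div (D : set C) f g : holo D f -> holo D g -> (forall w, D w -> g w != 0) ->
  holo D (fun w => f w / g w).
Proof. by move=> hf hg g0; apply: holoM => //; exact: holoV. Qed.

Lemma holo_sum (D : set C) n (F : 'I_n -> C -> C) : (forall i, holo D (F i)) ->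
  holo D (fun w => \sum_(i < n) F i w).
Proof.
elim: n F => [|n IH] F hF.
  by rewrite (_ : (fun w => _) = fun=> 0); [exact: holo_const|apply/funext => w; rewrite big_ord0].
rewrite (_ : (fun w => _) = fun w => \sum_(i < n) F (widen_ord (leqnSn n) i) w + F ord_max w).
  by apply: holoD => //; apply: IH.
by apply/funext => w; rewrite big_ord_recr.
Qed.

Lemma oint_sum n (F : 'I_n -> C -> C) a r : 0 <= r ->
  (forall i, holo (fun w => cabs (w - a) = r) (F i)) ->
  oint (fun w => \sum_(i < n) F i w) a r = \sum_(i < n) oint (F i) a r.
Proof.
move=> r0; elim: n F => [|n IH] F hF.
  rewrite big_ord0 (_ : (fun w => _) = fun w => 0 * 0); last by apply/funext => w; rewrite big_ord0 mul0r.
  by rewrite (@ointZ _ 0 (fun=> 0)) ?mul0r //; exact: holo_const.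
rewrite big_ord_recr /= -IH // -ointD //; last exact: holo_sum.
by congr oint; apply/funext => w; rewrite big_ord_recr.
Qed.

Lemma cauchy_formula f a r z : 0 < r -> cabs (z - a) < r -> holo (cdisc a r) f ->
  oint (fun w => f w / (w - z)) a r = tau R * f z.
Proof.
move=> r0 zr hf; have r0' := ltW r0.
have sub : (fun w => cabs (w - a) = r) `<=` cdisc a r by move=> w; rewrite /cdisc /= => ->.
have ne w : cabs (w - a) = r -> w - z != 0.
  by move=> wr; rewrite subr_eq0; apply/eqP => wz; move: zr; rewrite -wz wr ltxx.
have hwz : holo (fun w => cabs (w - a) = r) (fun w => w - z).
  by apply: holoB; [exact: holo_id|exact: holo_const].
have hf' := holo_sub sub hf.
rewrite (@oint_ext _ _ (fun w => (f w - f z) / (w - z) + f z * (w - z)^-1)) //.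
- rewrite ointD // ?oint_quot // ?add0r ?ointZ // ?oint_inv // 1?mulrC //.
  + exact: holoV.
  + by apply: holo_div => //; apply: holoB => //; exact: holo_const.
  + by apply: holoM; [exact: holo_const|exact: holoV].
- exact: holo_div.
- by move=> w wr; rewrite -mulrDl subrK.
Qed.

Lemma geometric_expansion (u v : C) N : u != 0 -> u - v != 0 ->
  (u - v)^-1 = \sum_(n < N) v ^+ n / u ^+ n.+1 + v ^+ N / (u ^+ N * (u - v)).
Proof.
move=> u0 uv; elim: N => [|N IH]; first by rewrite big_ord0 add0r !expr0 !mul1r.
rewrite big_ord_recr /= IH -addrA; congr (_ + _); rewrite !exprS; field.
by rewrite uv u0 expf_neq0.
Qed.

Definition tcoef f a r n : C := oint (fun w => f w / (w - a) ^+ n.+1) a r / tau R.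

(** The Cauchy kernel is expanded as a finite geometric sum, so only finite sums are integrated. The
    explicit remainder replaces convergence of the series in everything that follows. *)
Lemma taylor f a r M : 0 < r -> holo (cdisc a r) f -> (forall w, cabs (w - a) = r -> cabs (f w) <= M) ->
  (forall n, cabs (tcoef f a r n) <= M / r ^+ n) /\
  forall N z, cabs (z - a) < r ->
    cabs (f z - \sum_(n < N) tcoef f a r n * (z - a) ^+ n) <=
    M * (cabs (z - a) / r) ^+ N / (1 - cabs (z - a) / r).
Proof.
move=> r0 hf hM; have r0' := ltW r0.
have sub : (fun w => cabs (w - a) = r) `<=` cdisc a r by move=> w; rewrite /cdisc /= => ->.
have hf' := holo_sub sub hf.
have p0 : 0 < 2 * pi :> R by rewrite mulr_gt0 // pi_gt0.
have hwz z : holo (fun w => cabs (w - a) = r) (fun w => w - z).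
  by apply: holoB; [exact: holo_id|exact: holo_const].
have M0 : 0 <= M.
  by apply: le_trans (hM (circ a r 0) _); rewrite ?cabs_ge0 //; exact: (cabs_circ a 0).
have na w : cabs (w - a) = r -> w - a != 0 by rewrite -cabs_gt0 => ->.
have hc n : holo (fun w => cabs (w - a) = r) (fun w => f w / (w - a) ^+ n).
  by apply: holo_div => //; [exact: holoX|move=> w /na h; rewrite expf_neq0].
split=> [n|N z zr].
  rewrite /tcoef cabsM cabsV cabs_tau ler_pdivrMr //.
  apply: le_trans (@oint_bound _ _ a r (M / r ^+ n.+1) r0' (hc _) _) _.
    move=> w wr; rewrite cabsM cabsV cabsX wr ler_wpM2r ?invr_ge0 ?exprn_ge0 //; exact: hM.
  by rewrite mulrC ler_wpM2r ?(ltW p0) // exprS le_eqVlt; apply/orP; left; apply/eqP; field; rewrite expf_neq0 gt_eqF.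
have ne w : cabs (w - a) = r -> w - z != 0.
  by move=> wr; rewrite subr_eq0; apply/eqP => wz; move: zr; rewrite -wz wr ltxx.
have := cauchy_formula r0 zr hf.
have hs1 : holo (fun w => cabs (w - a) = r) (fun w => \sum_(n < N) (z - a) ^+ n * (f w / (w - a) ^+ n.+1)).
  by apply: holo_sum => i; apply: holoM; [exact: holo_const|exact: hc].
have hs2 : holo (fun w => cabs (w - a) = r) (fun w => f w / (w - a) ^+ N / (w - z)).
  by apply: holo_div.
rewrite (@oint_ext _ _ (fun w => \sum_(n < N) (z - a) ^+ n * (f w / (w - a) ^+ n.+1) +
    (z - a) ^+ N * (f w / (w - a) ^+ N / (w - z)))) //; first last.
- move=> w wr; have := @geometric_expansion (w - a) (z - a) N (na _ wr).
  have -> : w - a - (z - a) = w - z by ring.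
  move=> /(_ (ne _ wr)) E; rewrite [in LHS]E mulrDr mulr_sumr; congr (_ + _).
    by apply: eq_bigr => i _; rewrite mulrCA.
  by rewrite invfM; ring.
- exact: holo_div.
rewrite ointD //; last by apply: holoM => //; exact: holo_const.
rewrite ointZ // oint_sum //; last by move=> i; apply: holoM; [exact: holo_const|exact: hc].
move=> E.
have -> : f z - \sum_(n < N) tcoef f a r n * (z - a) ^+ n =
   (z - a) ^+ N * oint (fun w => f w / (w - a) ^+ N / (w - z)) a r / tau R.
  have -> : f z = (tau R * f z) / tau R by field; exact: tau_neq0.
  rewrite -E mulrDl addrAC mulr_suml -sumrB big1 ?add0r // => i _.
  by rewrite ointZ // /tcoef; ring.
rewrite !cabsM cabsV cabs_tau cabsX ler_pdivrMr //.
have rz : 0 < r - cabs (z - a) by rewrite subr_gt0.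
have B := @oint_bound _ (fun w => f w / (w - a) ^+ N / (w - z)) a r (M / r ^+ N / (r - cabs (z - a))) r0' hs2.
apply: le_trans (ler_wpM2l _ (B _)) _; first by rewrite exprn_ge0 ?cabs_ge0.
  move=> w wr; rewrite !cabsM !cabsV cabsX wr; apply: ler_pM.
  - by rewrite mulr_ge0 ?cabs_ge0 // invr_ge0 exprn_ge0.
  - by rewrite invr_ge0 cabs_ge0.
  - by rewrite ler_wpM2r ?invr_ge0 ?exprn_ge0 //; exact: hM.
  - rewrite lef_pV2 ?posrE ?cabs_gt0 ?ne //.
    by have := cabs_tri w z a; rewrite wr; lra.
rewrite expr_div_n le_eqVlt; apply/orP; left; apply/eqP; field.
by rewrite !gt_eqF // ?exprn_gt0 // subr_gt0 ltr_pdivrMr // mul1r.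
Qed.

End Taylor.

(** * Sequences and local properties of holomorphic functions *)

Section Sequences.
Variable R : realType.
Notation C := R[i].

Definition subsq (s : nat -> nat) := forall k, (s k < s k.+1)%N.

Lemma subsq_lt s : subsq s -> forall m n, (m < n)%N -> (s m < s n)%N.
Proof.
move=> hs m n; elim: n => // n IH; rewrite ltnS leq_eqVlt => /orP[/eqP ->|/IH h]; first exact: hs.
exact: ltn_trans h (hs n).
Qed.

Lemma subsq_ge s : subsq s -> forall k, (k <= s k)%N.
Proof. by move=> hs; elim=> // k IH; apply: leq_ltn_trans IH (hs k). Qed.

Lemma subsq_comp s t : subsq s -> subsq t -> subsq (s \o t).
Proof. by move=> hs ht k; exact: subsq_lt hs _ _ (ht k). Qed.

Lemma subsq_shift N : subsq (fun k => N + k)%N.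
Proof. by move=> k; rewrite addnS. Qed.

Lemma subsq_extract (P : nat -> nat -> Prop) :
  (forall m N, exists2 k, (N <= k)%N & P m k) ->
  exists2 s, subsq s & forall m, P m (s m).
Proof.
move=> H; have [k0 _ Pk0] := H 0%N 0%N.
have st n x : P n x -> exists2 y, P n.+1 y & (x < y)%N.
  by move=> _; have [y xy Py] := H n.+1 x.+1; exists y.
have [u [_ hu]] := dep_choice Pk0 st.
by exists u => k; [exact: (hu k).2|exact: (hu k).1].
Qed.

Definition cvgc (x : nat -> C) (l : C) := forall e : R, 0 < e ->
  exists N, forall k, (N <= k)%N -> cabs (x k - l) < e.

Lemma cvgc_subsq x l s : subsq s -> cvgc x l -> cvgc (x \o s) l.
Proof.
move=> hs hx e /hx[N hN]; exists N => k Nk; apply: hN.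
exact: leq_trans Nk (subsq_ge hs k).
Qed.

Lemma cvgc_unique x l l' : cvgc x l -> cvgc x l' -> l = l'.
Proof.
move=> h h'; apply/eqP; rewrite -subr_eq0 -cabs_eq0 eq_le cabs_ge0 andbT leNgt; apply/negP => d0.
have e0 : 0 < cabs (l - l') / 2 by lra.
have [N hN] := h _ e0; have [N' hN'] := h' _ e0.
have := hN (maxn N N') (leq_maxl _ _); have := hN' (maxn N N') (leq_maxr _ _).
have := cabs_tri l (x (maxn N N')) l'; rewrite (cabsB l (x _)); lra.
Qed.

Lemma cvgc_le x l a (M : R) N : cvgc x l -> (forall k, (N <= k)%N -> cabs (x k - a) <= M) -> cabs (l - a) <= M.
Proof.
move=> hx hM; rewrite leNgt; apply/negP => bad.
have e0 : 0 < cabs (l - a) - M by rewrite subr_gt0.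
have [K hK] := hx _ e0; have := hK (maxn K N) (leq_maxl _ _); have := hM (maxn K N) (leq_maxr _ _).
have := cabs_tri l (x (maxn K N)) a; rewrite (cabsB l (x _)); lra.
Qed.

(** Bolzano-Weierstrass by bisection: the half kept is one that the sequence visits at arbitrarily
    late times. *)
Lemma cluster_real (x : nat -> R) (M : R) : (forall k, `|x k| <= M) ->
  exists p : R, forall e : R, 0 < e -> forall N, exists2 k, (N <= k)%N & `|x k - p| < e.
Proof.
move=> hM; have M0 : 0 <= M by apply: le_trans (hM 0%N).
pose L := 2 * M; have L0 : 0 <= L by rewrite /L; lra.
pose P n u := forall N, exists2 k, (N <= k)%N & u <= x k <= u + L / 2 ^+ n.
have P0 : P 0%N (- M).
  move=> N; exists N => //; have := hM N; rewrite ler_norml expr0 divr1 /L => /andP[h1 h2].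
  by apply/andP; split; lra.
have st n u : P n u -> exists2 v, P n.+1 v & u <= v <= u + L / 2 ^+ n.+1.
  have l0 : 0 <= L / 2 ^+ n.+1 by rewrite divr_ge0 // exprn_ge0.
  have E : L / 2 ^+ n = L / 2 ^+ n.+1 + L / 2 ^+ n.+1.
    by rewrite exprS; field; rewrite expf_neq0.
  rewrite /P E; set l := L / 2 ^+ n.+1 in l0 *; move=> Pu.
  have [h|h] := pselect (forall N, exists2 k, (N <= k)%N & u <= x k <= u + l).
    by exists u => //; rewrite lexx lerDl.
  exists (u + l); last by rewrite lerDl l0 lexx.
  move=> N; move/existsNP: h => [N0 hN0].
  have [k kN /andP[k1 k2]] := Pu (maxn N N0); exists k; first by apply: leq_trans kN; exact: leq_maxl.
  rewrite -addrA k2 andbT leNgt; apply/negP => kl; apply: hN0; exists k; last by rewrite k1 ltW.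
  by apply: leq_trans kN; exact: leq_maxr.
have [u [_ hu]] := dep_choice P0 st.
have [p hp] := halving_lim L0 (fun n => (hu n).2).
exists p => e e0 N.
have [n hn] : exists n, L / 2 ^+ n < e.
  have s1 : 0 < e / (L + 1) by rewrite divr_gt0 //; lra.
  have [n hn] := half_pow_small s1; exists n.
  apply: (@le_lt_trans _ _ ((L + 1) / 2 ^+ n)).
    by rewrite ler_wpM2r ?invr_ge0 ?exprn_ge0 //; lra.
  by rewrite mulrC -ltr_pdivlMr //; lra.
have [k Nk /andP[k1 k2]] := (hu n).1 N; exists k => //.
have /andP[p1 p2] := hp n; rewrite ltr_norml; apply/andP; split; lra.
Qed.

Lemma pow2_lt (k : nat) (e : R) : 0 < e -> exists N, forall k, (N <= k)%N -> (2 ^+ k)^-1 < e.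
Proof.
move=> e0; have [N hN] := half_pow_small e0; exists N => j Nj; apply: le_lt_trans hN.
by rewrite lef_pV2 ?posrE ?exprn_gt0 // ler_eXn2l // ltr1n.
Qed.

Lemma bounded_subsq (x : nat -> C) (M : R) : (forall k, cabs (x k) <= M) ->
  exists2 s, subsq s & exists l, cvgc (x \o s) l.
Proof.
move=> hM.
have pos m : 0 < (2 ^+ m)^-1 :> R by rewrite invr_gt0 exprn_gt0.
have [p hp] := @cluster_real (fun k => Re (x k)) M (fun k => le_trans (Re_le_cabs _) (hM k)).
have [s hs sp] := @subsq_extract (fun m k => `|Re (x k) - p| < (2 ^+ m)^-1)
  (fun m N => hp _ (pos m) N).
have [q hq] := @cluster_real (fun k => Im (x (s k))) M (fun k => le_trans (Im_le_cabs _) (hM _)).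
have [t ht tq] := @subsq_extract (fun m k => `|Im (x (s k)) - q| < (2 ^+ m)^-1)
  (fun m N => hq _ (pos m) N).
exists (s \o t); first exact: subsq_comp.
exists (p +i* q) => e e0; have e2 : 0 < e / 2 by lra.
have [N hN] := pow2_lt 0 e2; exists N => k Nk.
apply: le_lt_trans (cabs_le_ReIm _) _; rewrite Re_sub Im_sub /=.
have h1 := lt_trans (sp (t k)) (hN _ (leq_trans Nk (subsq_ge ht k))).
by have h2 := lt_trans (tq k) (hN _ Nk); lra.
Qed.

Lemma cdisc_subsq a (r : R) (x : nat -> C) : (forall k, cdisc a r (x k)) ->
  exists2 s, subsq s & exists2 l, cdisc a r l & cvgc (x \o s) l.
Proof.
move=> hx; have [|s hs [l hl]] := @bounded_subsq x (r + cabs a).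
  by move=> k; have := hx k; rewrite /cdisc /=; have := cabsD (x k - a) a; rewrite subrK; lra.
exists s => //; exists l => //; apply: (cvgc_le (N := 0) hl) => k _; exact: hx.
Qed.

Lemma ctn_cvgc (D : set C) f (x : nat -> C) l : ctn D f l -> (forall k, D (x k)) -> cvgc x l ->
  cvgc (f \o x) (f l).
Proof. by move=> hf Dx hx e /hf[s /hx[N hN] hs]; exists N => k /hN/(hs _ (Dx k)). Qed.

Lemma cdisc_bounded a (r : R) f : (forall z, cdisc a r z -> ctn (cdisc a r) f z) ->
  exists2 M, 0 < M & forall z, cdisc a r z -> cabs (f z) <= M.
Proof.
move=> cf; apply: contrapT => bad.
have /choice[x hx] : forall k : nat, exists z, cdisc a r z /\ k.+1%:R < cabs (f z).
  move=> k; apply: contrapT => h; apply: bad; exists k.+1%:R => // z dz.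
  by rewrite leNgt; apply/negP => h'; apply: h; exists z.
have [s hs [l dl hl]] := @cdisc_subsq a r x (fun k => (hx k).1).
have [N hN] := ctn_cvgc (cf _ dl) (fun k => (hx (s k)).1) hl ltr01.
pose k := maxn N (Num.truncn (cabs (f l) + 1)).
have := hN k (leq_maxl _ _); have [_] := hx (s k); rewrite /=.
have : cabs (f l) + 1 < (s k).+1%:R.
  apply: lt_le_trans (truncnS_gt _) _; rewrite ler_nat ltnS.
  by apply: leq_trans (subsq_ge hs k); exact: leq_maxr.
have := cabs_sub_ge (f (x (s k))) (f l); lra.
Qed.

Lemma cauchy_cvgc (x : nat -> C) :
  (forall e : R, 0 < e -> exists N, forall k l, (N <= k)%N -> (N <= l)%N -> cabs (x k - x l) < e) ->
  exists l, cvgc x l.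
Proof.
move=> hx; have [N1 hN1] := hx 1 ltr01.
have [|s hs [l hl]] := @bounded_subsq (fun k => x (N1 + k)%N) (cabs (x N1) + 1).
  move=> k; have := hN1 (N1 + k)%N N1 (leq_addr _ _) (leqnn _).
  have := cabsD (x (N1 + k)%N - x N1) (x N1); rewrite subrK; lra.
exists l => e e0; have e2 : 0 < e / 2 by lra.
have [N hN] := hx _ e2; have [K hK] := hl _ e2; exists N => k Nk.
have := hK (maxn K N) (leq_maxl _ _); rewrite /=; set j := (N1 + _)%N => h1.
have jN : (N <= j)%N.
  apply: leq_trans (leq_addl _ _); apply: leq_trans (subsq_ge hs _); exact: leq_maxr.
have := hN _ _ Nk jN; have := cabs_tri (x k) (x j) l; lra.
Qed.

Definition ucvg (D : set C) (g : nat -> C -> C) (h : C -> C) := forall e : R, 0 < e ->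
  exists N, forall k, (N <= k)%N -> forall w, D w -> cabs (g k w - h w) < e.

Definition ucvg_infty (D : set C) (g : nat -> C -> C) := forall M : R,
  exists N, forall k, (N <= k)%N -> forall w, D w -> M < cabs (g k w).

Lemma ucvg_pt D g h w : ucvg D g h -> D w -> cvgc (fun k => g k w) (h w).
Proof. by move=> hg Dw e /hg[N hN]; exists N => k /hN/(_ _ Dw). Qed.

Lemma ucvg_sub D E g h : D `<=` E -> ucvg E g h -> ucvg D g h.
Proof. by move=> DE hg e /hg[N hN]; exists N => k /hN H w /DE/H. Qed.

Lemma ucvg_infty_sub D E g : D `<=` E -> ucvg_infty E g -> ucvg_infty D g.
Proof. by move=> DE hg M; have [N hN] := hg M; exists N => k /hN H w /DE/H. Qed.

Lemma ucvg_ctn D g h z : ucvg D g h -> D z -> (forall k, ctn D (g k) z) -> ctn D h z.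
Proof.
move=> hg Dz cg e e0; have e3 : 0 < e / 3 by lra.
have [N hN] := hg _ e3; have [s s0 hs] := cg N _ e3; exists s => // w Dw ws.
have h1 := hN _ (leqnn N) _ Dw; have h2 := hN _ (leqnn N) _ Dz; have h3 := hs _ Dw ws.
have h4 := cabs_tri (h w) (g N w) (h z); have h5 := cabs_tri (g N w) (g N z) (h z).
by rewrite (cabsB (h w) (g N w)) in h4; lra.
Qed.

Lemma ucvg_cauchy D (g : nat -> C -> C) :
  (forall e : R, 0 < e -> exists N, forall k l, (N <= k)%N -> (N <= l)%N ->
     forall w, D w -> cabs (g k w - g l w) <= e) ->
  exists h, ucvg D g h.
Proof.
move=> hg.
have /choice[h hh] : forall w, exists l, D w -> cvgc (fun k => g k w) l.
  move=> w; have [Dw|nDw] := pselect (D w); last by exists 0.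
  have [|l hl] := @cauchy_cvgc (fun k => g k w); last by exists l.
  move=> e e0; have e2 : 0 < e / 2 by lra.
  have [N hN] := hg _ e2; exists N => k l Nk Nl; have := hN _ _ Nk Nl _ Dw; lra.
exists h => e e0; have e2 : 0 < e / 2 by lra.
have [N hN] := hg _ e2; exists N => k Nk w Dw.
rewrite cabsB; apply: (@le_lt_trans _ _ (e / 2)); last by lra.
apply: (cvgc_le (N := N) (hh _ Dw)) => l Nl; exact: hN.
Qed.

End Sequences.

(** * Maximum modulus, Cauchy estimates and Weierstrass' theorem *)

Section Holomorphic.
Variable R : realType.
Notation C := R[i].
Implicit Types (f g h : C -> C) (a z w : C) (r M : R).

Lemma hasd_uniq f z d e : hasd setT f z d -> hasd setT f z e -> d = e.
Proof.
move=> hd he; apply/eqP; rewrite -subr_eq0 -cabs_eq0 eq_le cabs_ge0 andbT leNgt; apply/negP => bad.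
have e0 : 0 < cabs (d - e) / 4 by lra.
have [s s0 hs] := hasd_eps (I : setT z) hd e0; have [t t0 ht] := hasd_eps (I : setT z) he e0.
pose x := Num.min s t / 2; have x0 : 0 < x by rewrite divr_gt0 // lt_min s0.
have xs : x < s by apply: (@lt_le_trans _ _ (Num.min s t)); rewrite ?ge_min ?lexx // /x ltr_pdivrMr // ltr_pMr ?lt_min ?s0 // ltr1n.
have xt : x < t by apply: (@lt_le_trans _ _ (Num.min s t)); rewrite ?ge_min ?lexx ?orbT // /x ltr_pdivrMr // ltr_pMr ?lt_min ?s0 // ltr1n.
have xx : cabs (z + x%:C - z) = x by rewrite addrAC subrr add0r cabs_real gtr0_norm.
have := hs (z + x%:C) I; have := ht (z + x%:C) I; rewrite xx => /(_ xt) h1 /(_ xs) h2.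
have E : cabs (x%:C * (d - e)) = x * cabs (d - e) by rewrite cabsM cabs_real gtr0_norm.
have := cabs_sub (f (z + x%:C) - f z - (z + x%:C - z) * e) (f (z + x%:C) - f z - (z + x%:C - z) * d).
have -> : f (z + x%:C) - f z - (z + x%:C - z) * e - (f (z + x%:C) - f z - (z + x%:C - z) * d) = x%:C * (d - e) by ring.
rewrite E => h3.
have : 0 < x * cabs (d - e) by rewrite mulr_gt0.
lra.
Qed.

Lemma bernoulli (y : R) n : 0 <= y -> 1 + n%:R * y <= (1 + y) ^+ n.
Proof.
move=> y0; elim: n => [|n IH]; first by rewrite mul0r addr0 expr0.
rewrite exprS -natr1; apply: le_trans (ler_wpM2l _ IH); last by lra.
have : 0 <= y * (n%:R * y) by rewrite !mulr_ge0.
lra.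
Qed.

Lemma exprn_unbounded (x K : R) : 1 < x -> exists n, K < x ^+ n.
Proof.
move=> x1; pose n := (Num.truncn (K / (x - 1))).+1; exists n.
have x0 : 0 < x - 1 by lra.
have E : 1 + (x - 1) = x by ring.
have := @bernoulli (x - 1) n (ltW x0); rewrite E; apply: lt_le_trans.
have : K / (x - 1) < n%:R by exact: truncnS_gt.
rewrite ltr_pdivrMr //; lra.
Qed.

Lemma taylor_half f a r M : 0 < r -> holo (cdisc a r) f -> (forall w, cabs (w - a) = r -> cabs (f w) <= M) ->
  forall N z, cabs (z - a) <= r / 2 ->
    cabs (f z - \sum_(n < N) tcoef f a r n * (z - a) ^+ n) <= 2 * M * (cabs (z - a) / r) ^+ N.
Proof.
move=> r0 hf hM N z zr.
have M0 : 0 <= M.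
  by apply: le_trans (hM (circ a r 0) _); rewrite ?cabs_ge0 //; exact: (cabs_circ a 0 (ltW r0)).
have q : cabs (z - a) / r <= 1 / 2 by rewrite ler_pdivrMr //; lra.
have q0 : 0 <= cabs (z - a) / r by rewrite divr_ge0 ?cabs_ge0 // ltW.
have [_ h] := taylor r0 hf hM; apply: le_trans (h N z _) _; first by lra.
set x := _ / r in q q0 *.
have X : 0 <= M * x ^+ N by rewrite mulr_ge0 // exprn_ge0.
rewrite ler_pdivrMr; last by lra.
have -> : 2 * M * x ^+ N = 2 * (M * x ^+ N) by ring.
nra.
Qed.

(** Landau's power trick: the Taylor remainder with no terms bounds [f] up to a constant factor;
    applied to [f ^+ n], the factor stays the same and is lost as [n] grows. *)
Lemma max_modulus f a r M z : 0 < r -> holo (cdisc a r) f ->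
  (forall w, cabs (w - a) = r -> cabs (f w) <= M) -> cabs (z - a) < r -> cabs (f z) <= M.
Proof.
move=> r0 hf hM zr.
have M0 : 0 <= M.
  by apply: le_trans (hM (circ a r 0) _); rewrite ?cabs_ge0 //; exact: (cabs_circ a 0 (ltW r0)).
have q0 : 0 < 1 - cabs (z - a) / r by rewrite subr_gt0 ltr_pdivrMr // mul1r.
have key n : cabs (f z) ^+ n * (1 - cabs (z - a) / r) <= M ^+ n.
  have hMn w : cabs (w - a) = r -> cabs (f w ^+ n) <= M ^+ n.
    by move=> wr; rewrite cabsX lerXn2r ?nnegrE ?cabs_ge0 //; exact: hM.
  have [_ h] := taylor r0 (holoX n hf) hMn; have := h 0%N z zr.
  by rewrite big_ord0 subr0 expr0 mulr1 cabsX ler_pdivlMr.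
rewrite leNgt; apply/negP => bad.
have [M00|Mpos] := leP M 0.
  have := key 1%N; rewrite !expr1 => k1; have : 0 < cabs (f z) * (1 - cabs (z - a) / r).
    by rewrite mulr_gt0 //; lra.
  lra.
have x1 : 1 < cabs (f z) / M by rewrite ltr_pdivlMr // mul1r.
have [n hn] := exprn_unbounded (1 - cabs (z - a) / r)^-1 x1.
have := key n; rewrite leNgt => /negP; apply.
move: hn; rewrite expr_div_n ltr_pdivlMr ?exprn_gt0 // mulrC ltr_pdivrMr //.
Qed.

(** Otherwise the reciprocal of [f] would violate the maximum principle. This takes the place of
    Rouche's theorem and the argument principle. *)
Lemma zero_exists f a r m : 0 < r -> holo (cdisc a r) f -> (forall w, cabs (w - a) = r -> m <= cabs (f w)) ->
  cabs (f a) < m -> exists2 z, cabs (z - a) < r & f z = 0.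
Proof.
move=> r0 hf hm fa; apply: contrapT => bad.
have m0 : 0 < m by apply: le_lt_trans fa; exact: cabs_ge0.
have ne w : cdisc a r w -> f w != 0.
  rewrite /cdisc /= le_eqVlt => /orP[/eqP wr|wr]; last by apply/eqP => f0; apply: bad; exists w.
  by rewrite -cabs_gt0; apply: lt_le_trans m0 _; exact: hm.
have aa : cabs (a - a) < r by rewrite subrr cabs0.
have fa0 : 0 < cabs (f a) by rewrite cabs_gt0; apply: ne; exact: ltW.
have := @max_modulus (fun w => (f w)^-1) a r m^-1 a r0 (holoV hf ne) _ aa.
rewrite cabsV lef_pV2 ?posrE // leNgt fa => /(_ _)/negP; apply => // w wr.
by rewrite cabsV lef_pV2 ?posrE ?hm // cabs_gt0; apply: ne; rewrite /cdisc /= wr.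
Qed.

Lemma cauchy_estimate f a r M : 0 < r -> holo (cdisc a r) f -> (forall w, cabs (w - a) = r -> cabs (f w) <= M) ->
  exists2 d, hasd setT f a d & cabs d <= M / r /\ forall z, cabs (z - a) <= r / 2 ->
    cabs (f z - f a) <= 2 * M * (cabs (z - a) / r) /\
    cabs (f z - f a - (z - a) * d) <= 2 * M * (cabs (z - a) / r) ^+ 2.
Proof.
move=> r0 hf hM; have [hc ht] := taylor r0 hf hM; have hh := taylor_half r0 hf hM.
have M0 : 0 <= M.
  by apply: le_trans (hM (circ a r 0) _); rewrite ?cabs_ge0 //; exact: (cabs_circ a 0 (ltW r0)).
have c0 : tcoef f a r 0 = f a.
  have := hh 1%N a; rewrite subrr cabs0 mul0r expr1 mulr0 big_ord1 expr0 mulr1 => h.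
  apply/eqP; rewrite eq_sym -subr_eq0 -cabs_eq0 eq_le cabs_ge0 andbT; apply: h; lra.
have b2 z : cabs (z - a) <= r / 2 -> cabs (f z - f a - (z - a) * tcoef f a r 1) <= 2 * M * (cabs (z - a) / r) ^+ 2.
  by move=> /(hh 2%N); rewrite !big_ord_recl big_ord0 /= c0 expr0 mulr1 addr0 opprD addrA [tcoef _ _ _ _ * _]mulrC.
exists (tcoef f a r 1); last first.
  split=> [|z zr]; first by have := hc 1%N; rewrite expr1.
  by split; [have := hh 1%N z zr; rewrite big_ord1 c0 expr0 mulr1 expr1|exact: b2].
apply: eps_hasd => // e e0.
pose s := Num.min (r / 2) (e * r ^+ 2 / (2 * M + 1)).
have s0 : 0 < s by rewrite lt_min !divr_gt0 ?mulr_gt0 ?exprn_gt0 //; lra.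
exists s => // w _; rewrite lt_min => /andP[w1 w2]; apply: le_trans (b2 _ (ltW w1)) _.
set x := cabs _ in w1 w2 *; have x0 : 0 <= x := cabs_ge0 _.
rewrite expr_div_n mulrA ler_pdivrMr ?exprn_gt0 //.
move: w2; rewrite ltr_pdivlMr; last by lra.
move=> w2; have : x * (x * (2 * M + 1)) <= x * (e * r ^+ 2) by rewrite ler_wpM2l // ltW.
have : 0 <= x * x by rewrite mulr_ge0.
rewrite [x ^+ 2]expr2; lra.
Qed.

(** The Cauchy estimates make the derivatives at [z] a Cauchy sequence and bound the second-order
    remainders uniformly, so that both pass to the limit. *)
Lemma weierstrass (g : nat -> C -> C) h a r : (forall k, holo (disc a r) (g k)) -> ucvg (disc a r) g h ->
  holo (disc a r) h.
Proof.
move=> hg hu z dz; have [s0 s00 hs0] := disc_inner dz.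
pose s := s0 / 2; have s1 : 0 < s by rewrite divr_gt0.
have sub : cdisc z s `<=` disc a r.
  by move=> w; rewrite /cdisc /= => ws; apply: hs0; rewrite /disc /=; apply: le_lt_trans ws _; rewrite /s; lra.
have [N hN] := hu _ ltr01.
(* Differences with a fixed [g N] are bounded by 2 at once; [g N] is added back at the end. *)
pose F k w := g (N + k)%N w - g N w.
have hF k : holo (cdisc z s) (F k) by apply: holo_sub sub _; apply: holoB.
have FB k w : cabs (w - z) = s -> cabs (F k w) <= 2.
  move=> ws; have Dw : disc a r w by apply: sub; rewrite /cdisc /= ws.
  have h1 := hN _ (leq_addr k N) _ Dw; have h2 := hN _ (leqnn N) _ Dw.
  have := cabs_tri (g (N + k)%N w) (h w) (g N w); rewrite (cabsB (h w) (g N w)) /F; lra.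
have /choice[d hd] : forall k, exists d, hasd setT (F k) z d /\ forall w, cabs (w - z) <= s / 2 ->
    cabs (F k w - F k z - (w - z) * d) <= 2 * 2 * (cabs (w - z) / s) ^+ 2.
  move=> k; have [d d1 [d2 d3]] := cauchy_estimate s1 (hF k) (FB k).
  by exists d; split => // w ws; have [] := d3 w ws.
have [|A hA] := @cauchy_cvgc R d.
  move=> e e0; have e2 : 0 < e * s / 4 by rewrite divr_gt0 // mulr_gt0.
  have [K hK] := hu _ e2; exists K => k l Kk Kl.
  have hD : holo (cdisc z s) (fun w => F k w - F l w) by apply: holoB.
  have hDB w : cabs (w - z) = s -> cabs (F k w - F l w) <= e * s / 2.
    move=> ws; have Dw : disc a r w by apply: sub; rewrite /cdisc /= ws.
    have -> : F k w - F l w = g (N + k)%N w - g (N + l)%N w by rewrite /F; ring.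
    have h1 := hK _ (leq_trans Kk (leq_addl N k)) _ Dw; have h2 := hK _ (leq_trans Kl (leq_addl N l)) _ Dw.
    have := cabs_tri (g (N + k)%N w) (h w) (g (N + l)%N w); rewrite (cabsB (h w) (g (N + l)%N w)); lra.
  have [d' d1 [d2 _]] := cauchy_estimate s1 hD hDB.
  rewrite -(hasd_uniq d1 (hasdB (hd k).1 (hd l).1)); apply: le_lt_trans d2 _.
  by rewrite ltr_pdivrMr //; have : 0 < e * s by [rewrite mulr_gt0]; lra.
pose H w := h w - g N w.
have HH w : cabs (w - z) <= s / 2 -> cabs (H w - H z - (w - z) * A) <= 4 * (cabs (w - z) / s) ^+ 2.
  move=> ws; have Dw : disc a r w by apply: sub; rewrite /cdisc /=; lra.
  have cF v : disc a r v -> cvgc (fun k => F k v) (H v).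
    move=> Dv e e0; have [K hK] := hu _ e0; exists K => k Kk.
    have -> : F k v - H v = g (N + k)%N v - h v by rewrite /F /H; ring.
    exact: hK (leq_trans Kk (leq_addl N k)) _ Dv.
  have c1 : cvgc (fun k => F k w - F k z - (w - z) * d k) (H w - H z - (w - z) * A).
    move=> e e0; have e3 : 0 < e / 3 by lra.
    have e4 : 0 < e / 3 / (s + 1) by rewrite divr_gt0 //; lra.
    have [K1 h1] := cF w Dw _ e3; have [K2 h2] := cF z dz _ e3; have [K3 h3] := hA _ e4.
    exists (maxn K1 (maxn K2 K3)) => k; rewrite !geq_max => /and3P[k1 k2 k3].
    have -> : F k w - F k z - (w - z) * d k - (H w - H z - (w - z) * A) =
      (F k w - H w) - (F k z - H z) - (w - z) * (d k - A) by ring.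
    apply: le_lt_trans (cabs_sub _ _) _; rewrite cabsM.
    have q1 := cabs_sub (F k w - H w) (F k z - H z).
    have q2 := h1 _ k1; have q3 := h2 _ k2; have := h3 _ k3.
    rewrite ltr_pdivlMr; last by lra.
    have : cabs (w - z) * cabs (d k - A) <= cabs (d k - A) * (s + 1).
      by rewrite mulrC ler_wpM2l ?cabs_ge0 //; lra.
    by move: q1 q2 q3; clear; lra.
  rewrite -[X in cabs X]subr0; apply: (cvgc_le (N := 0) c1) => k _; rewrite subr0.
  by have [_ /(_ w ws)] := hd k; rewrite -[2 * 2]natrM.
have [dN hdN] := hg N z dz.
exists (A + dN); apply: (@hasd_ext _ _ (fun w => H w + g N w)) => [w _||]; try by rewrite /H subrK.
apply: hasdD => //; apply: eps_hasd => // e e0.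
pose t := Num.min (s / 2) (e * s ^+ 2 / 4).
have t0 : 0 < t by rewrite lt_min !divr_gt0 ?mulr_gt0 ?exprn_gt0.
exists t => // w _; rewrite lt_min => /andP[w1 w2]; apply: le_trans (HH _ (ltW w1)) _.
set x := cabs _ in w1 w2 *; have x0 : 0 <= x := cabs_ge0 _.
rewrite expr_div_n mulrA ler_pdivrMr ?exprn_gt0 //.
have : x * x <= x * (e * s ^+ 2 / 4) by rewrite ler_wpM2l // ltW.
rewrite [x ^+ 2]expr2; lra.
Qed.

(** The first nonvanishing Taylor coefficient dominates on small circles. This is the identity
    theorem and the isolation of zeros in a single quantitative statement. *)
Lemma zero_dichotomy f a r : 0 < r -> holo (cdisc a r) f ->
  (forall z, cabs (z - a) < r -> f z = 0) \/
  exists2 s0, 0 < s0 <= r & forall s, 0 < s <= s0 ->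
    exists2 m, 0 < m & forall z, cabs (z - a) = s -> m <= cabs (f z).
Proof.
move=> r0 hf.
have [M M0 hM] : exists2 M, 0 < M & forall w, cdisc a r w -> cabs (f w) <= M.
  by apply: cdisc_bounded => z dz; exact: (@ctn_holo_at _ _ _ f z hf dz).
have hMc w : cabs (w - a) = r -> cabs (f w) <= M by move=> wr; apply: hM; rewrite /cdisc /= wr.
have [hc ht] := taylor r0 hf hMc; have hh := taylor_half r0 hf hMc.
have [all0|/existsNP[n0 hn0]] := pselect (forall n, tcoef f a r n = 0).
  left=> z zr; apply/eqP; rewrite -cabs_eq0 eq_le cabs_ge0 andbT leNgt; apply/negP => bad.
  set q := cabs (z - a) / r.
  have q1 : q < 1 by rewrite ltr_pdivrMr // mul1r.
  have q0 : 0 <= q by rewrite divr_ge0 ?cabs_ge0 // ltW.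
  have key N : cabs (f z) <= M * q ^+ N / (1 - q).
    have := ht N z zr; rewrite big1 ?subr0 // => i _; by rewrite all0 mul0r.
  have [q00|qpos] := leP q 0.
    have q_0 : q = 0 by apply: le_anti; rewrite q00 q0.
    by have := key 1%N; rewrite q_0 expr1 mulr0 mul0r; lra.
  have qV : 1 < q^-1 by rewrite invf_gt1.
  have [n hn] := exprn_unbounded (M / (1 - q) / cabs (f z)) qV.
  move: hn; rewrite ltr_pdivrMr // exprVn ltNge => /negP; apply.
  rewrite mulrC ler_pdivrMr ?exprn_gt0 //; have := key n; lra.
right; have hex : exists n, tcoef f a r n != 0 by exists n0; apply/eqP.
case: (ex_minnP hex) => m cm minm.
set c := tcoef f a r m in cm; have c0 : 0 < cabs c by rewrite cabs_gt0.
have fm z : cabs (z - a) <= r / 2 -> cabs (f z - c * (z - a) ^+ m) <= 2 * M * (cabs (z - a) / r) ^+ m.+1.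
  move=> /(hh m.+1); rewrite big_ord_recr /= big1 ?add0r // => i _.
  have [->|/minm] := eqVneq (tcoef f a r i) 0; first by rewrite mul0r.
  by rewrite leqNgt ltn_ord.
(* On a circle of radius [s <= s0] the remainder [2 * M * (s / r) ^+ m.+1] is at most half of the
   leading term [cabs c * s ^+ m]. *)
pose s0 := Num.min (r / 2) (cabs c * r ^+ m.+1 / (4 * M)).
have s00 : 0 < s0 by rewrite lt_min !divr_gt0 ?mulr_gt0 ?exprn_gt0.
exists s0.
  by rewrite s00 /=; apply: (@le_trans _ _ (r / 2)); [rewrite ge_min lexx|lra].
move=> s /andP[sp ss0]; exists (cabs c * s ^+ m / 2); first by rewrite divr_gt0 // mulr_gt0 // exprn_gt0.
move=> z zs; move: ss0; rewrite le_min => /andP[s1 s2].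
have := fm z; rewrite zs => /(_ s1) h1.
have := cabs_sub_ge (c * (z - a) ^+ m) (c * (z - a) ^+ m - f z); rewrite subKr cabsB cabsM cabsX zs => h2.
suff : 2 * M * (s / r) ^+ m.+1 <= cabs c * s ^+ m / 2 by lra.
rewrite expr_div_n mulrA ler_pdivrMr ?exprn_gt0 // exprS.
move: s2; rewrite ler_pdivlMr ?mulr_gt0 // => s2.
have sm : 0 < s ^+ m by rewrite exprn_gt0.
have := ler_wpM2l (ltW sm) s2.
by move=> s3; have -> : 2 * M * (s * s ^+ m) = (s ^+ m * (s * (4 * M))) / 2 by [field]; have -> : cabs c * s ^+ m / 2 * r ^+ m.+1 = s ^+ m * (cabs c * r ^+ m.+1) / 2 by [field]; lra.
Qed.

End Holomorphic.

(** * Hurwitz' theorem, open mappings, entire functions *)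

Section HolomorphicTheory.
Variable R : realType.
Notation C := R[i].
Implicit Types (f g h : C -> C) (a z w : C) (r s M : R).

Lemma holo_bounded f a r : holo (cdisc a r) f -> exists2 M, 0 < M & forall w, cdisc a r w -> cabs (f w) <= M.
Proof.
by move=> hf; apply: cdisc_bounded => z dz; exact: (@ctn_holo_at _ _ _ f z hf dz).
Qed.

Lemma circle_point a r : 0 <= r -> exists z, cabs (z - a) = r.
Proof. by move=> r0; exists (circ a r 0); exact: (cabs_circ a 0 r0). Qed.

(** The derivative is a locally uniform limit of difference quotients with real steps [x k], which
    are holomorphic; Weierstrass' theorem applies. *)
Lemma holo_deriv f f' a r : holo (disc a r) f -> (forall z, disc a r z -> hasd setT f z (f' z)) ->
  holo (disc a r) f'.
Proof.
move=> hf hf' z dz; have [s0 s00 hs0] := disc_inner dz.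
(* A disc of radius [s] about a point of [disc z s] then stays in [cdisc z (2 * s)], where [f] has
   one bound [M]. *)
pose s := s0 / 3; have s1 : 0 < s by rewrite divr_gt0.
have sub : cdisc z (2 * s) `<=` disc a r.
  by move=> w; rewrite /cdisc /= => ws; apply: hs0; rewrite /disc /=; apply: le_lt_trans ws _; rewrite /s; lra.
have [M M0 hM] := holo_bounded (holo_sub sub hf).
have sub2 w : disc z s w -> cdisc w s `<=` cdisc z (2 * s).
  by rewrite /disc /cdisc /= => wz v /= vw; have := cabs_tri v w z; lra.
have est w v : disc z s w -> cabs (v - w) <= s / 2 ->
    cabs (f v - f w - (v - w) * f' w) <= 2 * M * (cabs (v - w) / s) ^+ 2.
  move=> dw vw; have sw := sub2 _ dw.
  have [|d d1 [_ /(_ v vw)[_]]] := @cauchy_estimate _ f w s M s1 (holo_sub (subset_trans sw sub) hf).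
    by move=> u us; apply: hM; apply: sw; rewrite /cdisc /= us.
  by rewrite (hasd_uniq d1 (hf' w _)) //; apply: sub; apply: sw; rewrite /cdisc /= subrr cabs0 ltW.
pose x k : R := s / 2 / 2 ^+ k.
have x0 k : 0 < x k by rewrite !divr_gt0 // exprn_gt0.
have xs k : x k <= s / 2 by rewrite ler_pdivrMr ?exprn_gt0 // ler_pMr ?divr_gt0 // exprn_ege1 // ler1n.
pose g k w := (f (w + (x k)%:C) - f w) / (x k)%:C.
have xC k : (x k)%:C != 0 :> C by rewrite -cabs_gt0 cabs_real normr_gt0 gt_eqF.
have cx k w : cabs (w + (x k)%:C - w) = x k by rewrite addrAC subrr add0r cabs_real gtr0_norm.
have hg k : holo (disc z s) (g k).
  apply: holoM; last exact: holo_const; apply: holoB.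
    apply: (@holo_comp _ _ (disc a r) (fun w => w + (x k)%:C)) => //.
      by apply: holoD; [exact: holo_id|exact: holo_const].
    move=> w dw; apply: sub; apply: (sub2 _ dw); rewrite /cdisc /= cx; have := xs k; lra.
  by apply: holo_sub hf => w dw; apply: sub; apply: sub2 dw _ _; rewrite /cdisc /= subrr cabs0 ltW.
suff : holo (disc z s) f' by apply; apply: disc_center.
apply: (weierstrass hg) => e e0.
have e1 : 0 < e * s / (2 * M) by rewrite divr_gt0 ?mulr_gt0.
have [N hN] := pow2_lt 0 e1; exists N => k /hN kN w dw.
have := est w (w + (x k)%:C) dw; rewrite cx => /(_ (xs k)).
have -> : w + (x k)%:C - w = (x k)%:C by ring.
have -> : g k w - f' w = (f (w + (x k)%:C) - f w - (x k)%:C * f' w) / (x k)%:C.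
  by rewrite /g; have := xC k; set X := (x k)%:C => X0; field.
rewrite cabsM cabsV cabs_real (gtr0_norm (x0 k)) ltr_pdivrMr // => h; apply: le_lt_trans h _.
have -> : 2 * M * (x k / s) ^+ 2 = (M / s / 2 ^+ k) * x k.
  have p2 : 2 ^+ k != 0 :> R by rewrite expf_neq0.
  have s_neq0 : s != 0 by rewrite gt_eqF.
  by rewrite /x; field; rewrite p2 s_neq0.
rewrite ltr_pM2r //; move: kN; rewrite ltr_pdivlMr ?mulr_gt0 // => kN.
have -> : M / s / 2 ^+ k = ((2 ^+ k)^-1 * (2 * M)) / (2 * s).
  have p2 : 2 ^+ k != 0 :> R by rewrite expf_neq0.
  have s_neq0 : s != 0 by rewrite gt_eqF.
  by field; rewrite p2 s_neq0.
by rewrite ltr_pdivrMr ?mulr_gt0 //; nra.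
Qed.

(** On a small circle [h - h a] is at least [m] in modulus, so late [g k - h a] are at least [m / 2]
    there but smaller at the centre, and [zero_exists] gives a zero. *)
Lemma hurwitz (g : nat -> C -> C) h a r : (forall k, holo (disc a r) (g k)) -> ucvg (disc a r) g h ->
  (exists2 z, disc a r z & h z != h a) ->
  exists N, forall k, (N <= k)%N -> exists2 z, disc a r z & g k z = h a.
Proof.
move=> hg hu [z dz hz]; have hh := weierstrass hg hu.
pose r' := (cabs (z - a) + r) / 2; have zr : cabs (z - a) < r' by move: dz; rewrite /disc /= /r'; lra.
have r'r : r' < r by move: dz; rewrite /disc /= /r'; lra.
have r'0 : 0 < r' by apply: le_lt_trans zr; exact: cabs_ge0.
have sub : cdisc a r' `<=` disc a r := le_cdisc_disc r'r.
have hF : holo (cdisc a r') (fun w => h w - h a).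
  by apply: holoB; [exact: holo_sub hh|exact: holo_const].
have [/(_ z zr)/eqP|[s0 /andP[s00 s0r] hs0]] := zero_dichotomy r'0 hF.
  by rewrite subr_eq0 (negbTE hz).
have [|m m0 hm] := hs0 s0; first by rewrite s00 lexx.
have m2 : 0 < m / 2 by rewrite divr_gt0.
have [N hN] := hu _ m2; exists N => k /hN{}hN.
have sub2 : cdisc a s0 `<=` disc a r.
  by move=> w dw; apply: sub; exact: sub_cdisc dw.
have hG : holo (cdisc a s0) (fun w => g k w - h a).
  by apply: holoB; [exact: holo_sub (hg k)|exact: holo_const].
have [|//|w ws /eqP] := @zero_exists _ (fun w => g k w - h a) a s0 (m / 2) s00 hG.
- move=> w ws; have := hm _ ws; have := hN w (sub2 w _); rewrite /cdisc /= ws lexx => /(_ isT).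
  have := cabs_tri (h w) (g k w) (h a); rewrite (cabsB (h w) (g k w)); lra.
- by apply: hN; apply: disc_center; lra.
by rewrite subr_eq0 => /eqP E; exists w => //; apply: sub2; exact: ltW.
Qed.

(** If omitted values [b k] converged to [f a], the functions [f - b k + f a] would converge
    uniformly to [f] and never take the value [f a], against Hurwitz' theorem. *)
Lemma open_mapping f a r : holo (disc a r) f -> (exists2 z, disc a r z & f z != f a) ->
  exists2 e : R, 0 < e & forall b, cabs (b - f a) < e -> exists2 z, disc a r z & f z = b.
Proof.
move=> hf [z dz hz]; apply: contrapT => bad.
have /choice[b hb] : forall k, exists b, cabs (b - f a) < (2 ^+ k)^-1 /\ forall z, disc a r z -> f z <> b.
  move=> k; apply: contrapT => h; apply: bad; exists (2 ^+ k)^-1; first by rewrite invr_gt0 exprn_gt0.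
  move=> b hb; apply: contrapT => h'; apply: h; exists b; split => // w dw fw; apply: h'; by exists w.
have [|||N hN] := @hurwitz (fun k w => f w - b k + f a) f a r.
- by move=> k; apply: holoD; [apply: holoB => //; exact: holo_const|exact: holo_const].
- move=> e e0; have [N hN] := pow2_lt 0 e0; exists N => k /hN kN w _.
  have -> : f w - b k + f a - f w = - (b k - f a) by ring.
  by rewrite cabsN; apply: lt_trans kN; have [] := hb k.
- by exists z.
have [w dw /eqP] := hN N (leqnn N); rewrite -subr_eq0 addrK subr_eq0 => /eqP.
by have [_ h] := hb N; apply: h.
Qed.

(** The dichotomy is applied on one disc about [a] large enough to contain [z], which avoids a
    connectedness argument. *)
Lemma entire_zero f a s : holo setT f -> 0 < s -> (forall z, disc a s z -> f z = 0) -> forall z, f z = 0.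
Proof.
move=> hf s0 hz z; pose r := cabs (z - a) + 1.
have r0 : 0 < r by have := cabs_ge0 (z - a); rewrite /r; lra.
have [|[s1 /andP[s10 _] h]] := zero_dichotomy r0 (holo_sub (@subsetT _ _) hf : holo (cdisc a r) f).
  by apply; rewrite /r; lra.
have t0 : 0 < Num.min s1 (s / 2) by rewrite lt_min s10 divr_gt0.
have [|m m0 hm] := h (Num.min s1 (s / 2)); first by rewrite t0 ge_min lexx.
exfalso; have [w ws] := circle_point a (ltW t0); have := hm w ws; rewrite hz ?cabs0; first lra.
by rewrite /disc /= ws gt_min; apply/orP; right; lra.
Qed.

Lemma entire_nonconst f a s : holo setT f -> 0 < s -> ~ (forall z, f z = f a) ->
  exists2 z, disc a s z & f z != f a.
Proof.
move=> hf s0 hn; apply: contrapT => bad; apply: hn => z; apply/eqP; rewrite -subr_eq0; apply/eqP.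
move: z; apply: (@entire_zero (fun z => f z - f a) a s) => //.
  by apply: holoB => //; exact: holo_const.
by move=> z dz; apply/eqP; rewrite subr_eq0; apply: contrapT => h; apply: bad; exists z => //; apply/negP.
Qed.

Lemma holo_local f g (D : set C) z e : 0 < e -> (forall w, cabs (w - z) < e -> f w = g w) ->
  (exists d, hasd setT g z d) -> exists d, hasd setT f z d.
Proof.
move=> e0 fg [d hd]; exists d; apply: eps_hasd => // x x0.
have [s s0 hs] := hasd_eps (I : setT z) hd x0.
exists (Num.min s e); first by rewrite lt_min s0.
move=> w _; rewrite lt_min => /andP[ws we]; rewrite !fg ?subrr ?cabs0 //; exact: hs.
Qed.

(** At [a] the quotient takes the first Taylor coefficient of [f] as value and the second as
    derivative; away from [a] it is an honest quotient. *)
Lemma entire_div f a : holo setT f -> f a = 0 ->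
  exists2 g, holo setT g & forall z, f z = (z - a) * g z.
Proof.
move=> hf fa; have [M M0 hM] := holo_bounded (holo_sub (@subsetT _ _) hf : holo (cdisc a 1) f).
have hMc w : cabs (w - a) = 1 -> cabs (f w) <= M by move=> wr; apply: hM; rewrite /cdisc /= wr.
have hh := taylor_half ltr01 (holo_sub (@subsetT _ _) hf : holo (cdisc a 1) f) hMc.
set c := tcoef f a 1 in hh.
have c0 : c 0%N = 0.
  have := hh 1%N a; rewrite subrr cabs0 mul0r expr1 mulr0 big_ord1 expr0 mulr1 fa sub0r cabsN => h.
  apply/eqP; rewrite -cabs_eq0 eq_le cabs_ge0 andbT; apply: h; lra.
exists (fun z => if z == a then c 1%N else f z / (z - a)); last first.
  by move=> z; case: eqP => [->|/eqP za]; [rewrite fa subrr mul0r|field; rewrite subr_eq0].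
move=> z _; have [->|za] := eqVneq z a; last first.
  have za0 : 0 < cabs (z - a) by rewrite cabs_gt0 subr_eq0.
  apply: (@holo_local _ (fun z => f z / (z - a)) setT z _ za0).
    by move=> w wz; case: eqP => [wa|//]; move: wz; rewrite wa cabsB ltxx.
  apply: (@holo_div _ (fun z => z != a) f (fun z => z - a)) => //.
  - by apply: holo_sub hf.
  - by apply: holoB; [exact: holo_id|exact: holo_const].
  - by move=> w; rewrite subr_eq0.
exists (c 2%N); apply: eps_hasd => // e e0; rewrite eqxx.
pose s := Num.min (1 / 2) (e / (2 * M)).
have s0 : 0 < s by rewrite lt_min !divr_gt0 ?mulr_gt0.
exists s => // w _; rewrite lt_min => /andP[w1 w2].
case: eqP => [->|/eqP wa]; first by rewrite !subrr mul0r subrr cabs0 mulr0.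
have wa0 : 0 < cabs (w - a) by rewrite cabs_gt0 subr_eq0.
have := hh 3%N w (ltW w1); rewrite !big_ord_recl big_ord0 /= c0 mul0r add0r addr0 divr1 expr1 => h.
have wa1 : w - a != 0 by rewrite subr_eq0.
have -> : f w / (w - a) - c 1%N - (w - a) * c 2%N =
   (f w - (c 1%N * (w - a) + c 2%N * (w - a) ^+ 2)) / (w - a) by field.
rewrite cabsM cabsV ler_pdivrMr //; apply: le_trans h _.
set x := cabs (w - a) in w1 w2 wa0 *.
move: w2; rewrite ltr_pdivlMr ?mulr_gt0 // => w2.
have -> : 2 * M * x ^+ 3 = x * (2 * M) * (x * x) by ring.
have -> : e * x * x = e * (x * x) by ring.
by rewrite ler_wpM2r ?mulr_ge0 ?(ltW wa0) // ltW.
Qed.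

(** Dividing [f - f 0] by the variable lowers the order of growth by one; the base case is
    Liouville's theorem. *)
Lemma entire_poly_growth f k (A R0 : R) : holo setT f -> (forall z, R0 <= cabs z -> cabs (f z) <= A * cabs z ^+ k) ->
  exists p : {poly C}, forall z, f z = p.[z].
Proof.
elim: k f A R0 => [|k IH] f A R0 hf hA.
  exists (f 0)%:P => z; rewrite hornerC; apply/eqP; rewrite -subr_eq0 -cabs_eq0 eq_le cabs_ge0 andbT leNgt.
  apply/negP => bad; set d := cabs (f z - f 0) in bad.
  have zz := cabs_ge0 z.
  pose A' := Num.max A 0; have A'0 : 0 <= A' by rewrite le_max lexx orbT.
  pose r := Num.max (Num.max R0 (2 * cabs z)) (4 * A' * cabs z / d) + 1.
  have r1 : R0 < r by rewrite ltr_pwDr // !le_max lexx.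
  have r2 : 2 * cabs z < r by rewrite ltr_pwDr // !le_max lexx !orbT.
  have r3 : 4 * A' * cabs z / d < r by rewrite ltr_pwDr // !le_max lexx !orbT.
  have r0 : 0 < r by lra.
  have hB w : cabs (w - 0) = r -> cabs (f w) <= A'.
    by rewrite subr0 => wr; rewrite /A' le_max -[A]mulr1 -(expr0 (cabs w)) hA // wr ltW.
  have [e _ [_ /(_ z)]] := cauchy_estimate r0 (holo_sub (@subsetT _ _) hf : holo (cdisc 0 r) f) hB.
  rewrite subr0 => /(_ _)[|h _]; first by lra.
  move: h; rewrite -/d mulrA ler_pdivlMr //; move: r3; rewrite ltr_pdivrMr //.
  have : 0 <= A' * cabs z by rewrite mulr_ge0.
  by rewrite [d * r]mulrC; lra.
have hf0 : holo setT (fun z => f z - f 0) by apply: holoB => //; exact: holo_const.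
have [g hg Eg] := entire_div hf0 (subrr (f 0)).
have [|p hp] := IH g (A + cabs (f 0)) (Num.max R0 1) hg.
  move=> z; rewrite ge_max => /andP[zR z1].
  have z0 : 0 < cabs z by lra.
  rewrite -(ler_pM2l z0) -cabsM -[z in cabs (z * _)]subr0 -Eg.
  apply: le_trans (cabs_sub _ _) _; rewrite mulrCA -exprS mulrDl; apply: lerD; first exact: hA.
  by rewrite ler_peMr ?cabs_ge0 // exprn_ege1.
exists ((f 0)%:P + 'X * p) => z; rewrite hornerD hornerC hornerM hornerX -hp.
by have := Eg z; rewrite subr0 => <-; rewrite addrC subrK.
Qed.

End HolomorphicTheory.

(** * Entire functions and normal families *)

Section Casorati.
Variable R : realType.
Notation C := R[i].

Definition rootprod (s : seq C) z : C := \prod_(a <- s) (z - a).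

Lemma rootprod_le (s : seq C) (K : R) z : (forall a, a \in s -> cabs a <= K) ->
  cabs (rootprod s z) <= (cabs z + K) ^+ size s.
Proof.
rewrite /rootprod; elim: s => [|a s IH] hK; first by rewrite big_nil cabs1 expr0.
rewrite big_cons cabsM exprS; apply: ler_pM; rewrite ?cabs_ge0 //.
  by apply: le_trans (cabs_sub _ _) _; rewrite lerD2l hK // mem_head.
by apply: IH => b bs; apply: hK; rewrite in_cons bs orbT.
Qed.

Lemma rootprod_ge (s : seq C) (K : R) z : K <= cabs z -> (forall a, a \in s -> cabs a <= K) ->
  (cabs z - K) ^+ size s <= cabs (rootprod s z).
Proof.
rewrite /rootprod => Kz; elim: s => [|a s IH] hK; first by rewrite big_nil cabs1 expr0.
rewrite big_cons cabsM exprS; apply: ler_pM; rewrite ?exprn_ge0 ?subr_ge0 //.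
  by apply: le_trans (cabs_sub_ge _ _); rewrite lerD2l lerN2 hK // mem_head.
by apply: IH => b bs; apply: hK; rewrite in_cons bs orbT.
Qed.

(* Otherwise one could divide out the zeros of [f] one by one; if this never
   stops, the maximum modulus principle forces [f = 0], and if it stops, the
   reciprocal of the zero-free quotient is entire of polynomial growth. *)
Lemma transcendental_small (f : C -> C) (R1 : R) : holo setT f -> ~ (exists p : {poly C}, forall z, f z = p.[z]) ->
  exists2 w, R1 < cabs w & cabs (f w) < 1.
Proof.
move=> hf ntr; apply: contrapT => bad.
pose K := Num.max R1 0; have K0 : 0 <= K by rewrite le_max lexx orbT.
have big w : K < cabs w -> 1 <= cabs (f w).
  rewrite gt_max => /andP[Rw _]; rewrite leNgt; apply/negP => h; apply: bad; by exists w.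
have small w : f w = 0 -> cabs w <= K.
  by move=> fw; rewrite leNgt; apply/negP => /big; rewrite fw cabs0 ler10.
pose P k := exists s : seq C, [/\ size s = k, (forall a, a \in s -> cabs a <= K) &
  exists2 g, holo setT g & forall z, f z = rootprod s z * g z].
have P0 : P 0%N.
  exists [::]; split => //; exists f => // z; by rewrite /rootprod big_nil mul1r.
have [allP|/existsNP[n nPn]] := pselect (forall k, P k).
  apply: ntr; exists 0 => z; rewrite horner0; move: z; apply: (@entire_zero _ _ 0 1) => // z.
  rewrite /disc /= subr0 => z1; apply/eqP; rewrite -cabs_eq0 eq_le cabs_ge0 andbT leNgt; apply/negP => fz.
  (* On this circle every factor of [rootprod] is at least [K + 2], while at [z] it is at most
     [K + 1]; dividing out [k] zeros thus costs a factor [((K + 1) / (K + 2)) ^+ k], which tends to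
     0. *)
  pose r := 2 * K + 2; have r0 : 0 < r by rewrite /r; lra.
  have [M M0 hM] := holo_bounded (holo_sub (@subsetT _ _) hf : holo (cdisc 0 r) f).
  have x1 : 1 < (K + 2) / (K + 1) by rewrite ltr_pdivlMr; lra.
  have [k hk] := exprn_unbounded (M / cabs (f z)) x1.
  have [s [ss sK [g hg Eg]]] := allP k.
  have gM w : cabs (w - 0) = r -> cabs (g w) <= M / (K + 2) ^+ k.
    rewrite subr0 => wr; rewrite ler_pdivlMr ?exprn_gt0 //; last by lra.
    have := hM w; rewrite /cdisc /= subr0 wr lexx Eg cabsM mulrC => /(_ isT); apply: le_trans.
    rewrite ler_wpM2l ?cabs_ge0 //; apply: le_trans (rootprod_ge _ sK); last by rewrite wr /r; lra.
    by rewrite wr ss lerXn2r ?nnegrE /r; lra.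
  have gz : cabs (g z) <= M / (K + 2) ^+ k.
    by apply: (max_modulus r0 (holo_sub (@subsetT _ _) hg) gM); rewrite subr0 /r; lra.
  have pz : cabs (rootprod s z) <= (K + 1) ^+ k.
    by apply: le_trans (rootprod_le _ sK) _; rewrite ss lerXn2r ?nnegrE ?addr_ge0 ?cabs_ge0 //; lra.
  have fz_le : cabs (f z) <= (K + 1) ^+ k * (M / (K + 2) ^+ k).
    by rewrite Eg cabsM; apply: ler_pM; rewrite ?cabs_ge0.
  move: hk; rewrite expr_div_n ltr_pdivrMr // ltNge => /negP; apply.
  have p1 : 0 < (K + 1) ^+ k by rewrite exprn_gt0 //; lra.
  have p2 : 0 < (K + 2) ^+ k by rewrite exprn_gt0 //; lra.
  apply: le_trans (ler_wpM2l _ fz_le) _; first by rewrite divr_ge0 // ltW.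
  rewrite le_eqVlt; apply/orP; left; apply/eqP; field.
  by rewrite !gt_eqF.
have [k [s [ss sK [g hg Eg]]] nP] : exists2 k, P k & ~ P k.+1.
  elim: n nPn => [//|n IH] nP; have [Pn|/IH//] := pselect (P n); by exists n.
have g0 z : g z != 0.
  apply/eqP => gz; apply: nP; have [h hh Eh] := entire_div hg gz.
  exists (z :: s); split; first by rewrite /= ss.
    move=> a; rewrite in_cons => /orP[/eqP ->|/sK//]; apply: small; by rewrite Eg gz mulr0.
  by exists h => // w; rewrite /rootprod big_cons Eg Eh /rootprod; ring.
have hV : holo setT (fun z => (g z)^-1) by apply: holoV.
have [p hp] : exists p : {poly C}, forall z, (g z)^-1 = p.[z].
  apply: (@entire_poly_growth _ _ k (2 ^+ k) (K + 1) hV) => z Kz.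
  have zK : K < cabs z by lra.
  have pz := rootprod_le z sK; have bz := big z zK.
  rewrite cabsV -exprMn -[leLHS]mul1r ler_pdivrMr ?cabs_gt0 //.
  apply: le_trans bz _; rewrite Eg cabsM ler_wpM2r ?cabs_ge0 //; apply: le_trans pz _.
  by rewrite ss lerXn2r ?nnegrE ?mulr_ge0 ?addr_ge0 ?cabs_ge0 //; lra.
(* A reciprocal has no zeros, so [p] has no root and is constant. *)
have sp : size p == 1%N.
  apply/negPn/negP => /closed_rootP[x]; rewrite /root -hp invr_eq0; exact/negP.
have [c c0 pc] : exists2 c, c != 0 & p = c%:P by apply/size_poly1P.
apply: ntr; exists (c^-1%:P * \prod_(a <- s) ('X - a%:P)) => z.
rewrite hornerM hornerC horner_prod Eg mulrC; congr (_ * _).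
  by apply: invr_inj; rewrite invrK hp pc hornerC.
by rewrite /rootprod; apply: eq_bigr => a _; rewrite hornerXsubC.
Qed.

End Casorati.

(** * Montel's theorem for bounded families *)

Section Montel.
Variable R : realType.
Notation C := R[i].
Implicit Types (f g h : C -> C) (a z w : C) (r s M : R).

Lemma diagonal (c : nat -> nat -> C) (B : nat -> R) : (forall k n, cabs (c k n) <= B n) ->
  exists2 s, subsq s & forall n, exists l, cvgc (fun k => c (s k) n) l.
Proof.
move=> hB.
pose P n (t : nat -> nat) := subsq t /\ forall m, (m < n)%N -> exists l, cvgc (fun k => c (t k) m) l.
pose Q (n : nat) (t t' : nat -> nat) := exists2 u, subsq u & t' = t \o u.
have [|n t [ht Pt]|T [_ hT]] := @dep_choice (nat -> nat) P Q id.
- by split.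
- have [u hu [l hl]] := bounded_subsq (fun k => hB (t k) n).
  exists (t \o u); last by exists u.
  split; first exact: subsq_comp.
  move=> m; rewrite ltnS leq_eqVlt => /orP[/eqP ->|/Pt[l' hl']]; first by exists l.
  by exists l'; apply: (cvgc_subsq hu hl').
have sT n : subsq (T n) by have [[]] := hT n.
exists (fun k => T k k).
  move=> k; have [_ [u hu ->]] := hT k; apply: (subsq_lt (sT k)).
  by apply: leq_trans (subsq_ge hu k.+1).
move=> n; have [[_ /(_ n (ltnSn n))[l hl]] _] := hT n.+1; exists l => e /hl[N hN].
(* Each later sequence refines [T n.+1], so a late diagonal entry is an entry of [T n.+1] at an
   index that is at least as large. *)
have key m : exists2 u, subsq u & T (n.+1 + m)%N = T n.+1 \o u.
  elim: m => [|m [u hu Eu]]; first by exists id => //; rewrite addn0.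
  have [_ [v hv]] := hT (n.+1 + m)%N; rewrite addnS => ->; rewrite Eu.
  by exists (u \o v) => //; exact: subsq_comp.
exists (maxn N n.+1) => k; rewrite geq_max => /andP[Nk nk].
have [u hu E] := key (k - n.+1)%N; rewrite subnKC // in E; rewrite E /=.
by apply: hN; apply: leq_trans Nk (subsq_ge hu k).
Qed.

(** Each Taylor coefficient is bounded along the family, so a diagonal subsequence makes all of them
    converge; on the half disc the tails are uniformly small. No equicontinuity is involved. *)
Lemma montel_bounded (g : nat -> C -> C) a r M : 0 < r -> (forall k, holo (cdisc a r) (g k)) ->
  (forall k w, cdisc a r w -> cabs (g k w) <= M) ->
  exists2 s, subsq s & exists h, ucvg (cdisc a (r / 2)) (g \o s) h.
Proof.
move=> r0 hg hM.
have M0 : 0 <= M by apply: le_trans (hM 0%N a _); rewrite ?cabs_ge0 // /cdisc /= subrr cabs0 ltW.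
have hMc k w : cabs (w - a) = r -> cabs (g k w) <= M by move=> wr; apply: hM; rewrite /cdisc /= wr.
pose c k n := tcoef (g k) a r n.
have [s hs cs] := @diagonal c (fun n => M / r ^+ n) (fun k n => (taylor r0 (hg k) (hMc k)).1 n).
exists s => //; apply: ucvg_cauchy => e e0.
have eM : 0 < e / (8 * (M + 1)) by rewrite divr_gt0 // mulr_gt0 //; lra.
have [n hn] := half_pow_small eM.
have [N hN] : exists N, forall k l, (N <= k)%N -> (N <= l)%N ->
    forall w, cdisc a (r / 2) w -> cabs (\sum_(i < n) c (s k) i * (w - a) ^+ i - \sum_(i < n) c (s l) i * (w - a) ^+ i) <= e / 2.
  have : 0 < e / 2 by lra.
  elim: n {hn} (e / 2) => [|n IH] d d0.
    by exists 0%N => k l _ _ w _; rewrite !big_ord0 subrr cabs0 ltW.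
  have d2 : 0 < d / 2 by lra.
  have [N1 h1] := IH _ d2; have [l hl] := cs n.
  have d3 : 0 < d / 4 / r ^+ n by rewrite !divr_gt0 // exprn_gt0.
  have [N2 h2] := hl _ d3; exists (maxn N1 N2) => k1 k2; rewrite !geq_max => /andP[k11 k12] /andP[k21 k22] w dw.
  rewrite !big_ord_recr /= opprD addrACA -mulrBl; apply: le_trans (cabsD _ _) _.
  have q1 := h1 _ _ k11 k21 _ dw.
  have q2 : cabs (c (s k1) n - c (s k2) n) <= d / 2 / r ^+ n.
    have := h2 _ k12; have := h2 _ k22; have := cabs_tri (c (s k1) n) l (c (s k2) n).
    rewrite (cabsB l (c (s k2) n)); have -> : d / 2 / r ^+ n = d / 4 / r ^+ n + d / 4 / r ^+ n.
      by field; rewrite expf_neq0 // gt_eqF.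
    lra.
  have q3 : cabs ((c (s k1) n - c (s k2) n) * (w - a) ^+ n) <= d / 2.
    rewrite cabsM cabsX; have -> : d / 2 = d / 2 / r ^+ n * r ^+ n by field; rewrite expf_neq0 // gt_eqF.
    apply: ler_pM => //; rewrite ?cabs_ge0 ?exprn_ge0 ?cabs_ge0 // lerXn2r ?nnegrE ?cabs_ge0 ?(ltW r0) //.
    by move: dw; rewrite /cdisc /=; lra.
  lra.
exists N => k l Nk Nl w dw.
have err j : cabs (g j w - \sum_(i < n) c j i * (w - a) ^+ i) <= e / 4.
  apply: le_trans (taylor_half r0 (hg j) (hMc j) n dw) _.
  have q : cabs (w - a) / r <= 1 / 2 by move: dw; rewrite /cdisc /= ler_pdivrMr //; lra.
  have q' : (cabs (w - a) / r) ^+ n <= (2 ^+ n)^-1.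
    have -> : (2 ^+ n)^-1 = (1 / 2) ^+ n :> R by rewrite div1r exprVn.
    by rewrite lerXn2r ?nnegrE ?divr_ge0 ?cabs_ge0 // ltW.
  have M1 : 0 < M + 1 by lra.
  move: hn; rewrite ltr_pdivlMr ?mulr_gt0 // => hn.
  have : 2 * M * (cabs (w - a) / r) ^+ n <= 2 * (M + 1) * (2 ^+ n)^-1.
    by apply: ler_pM => //; rewrite ?mulr_ge0 ?exprn_ge0 ?divr_ge0 ?cabs_ge0 ?(ltW r0) //; lra.
  lra.
have e1 := err (s k); have e2 := err (s l); have e3 := hN k l Nk Nl w dw; rewrite /=.
set A := \sum_(i < n) _ in e1 e3; set B := \sum_(i < n) _ in e2 e3.
have -> : g (s k) w - g (s l) w = (g (s k) w - A) + (A - B) - (g (s l) w - B) by ring.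
have := cabs_sub (g (s k) w - A + (A - B)) (g (s l) w - B); have := cabsD (g (s k) w - A) (A - B).
lra.
Qed.

End Montel.

(** * Primitives, logarithms and square roots on discs *)

Section Logarithm.
Variable R : realType.
Notation C := R[i].
Implicit Types (f g h : C -> C) (a z w : C) (r s M : R).

Lemma cdisc_convex a r z w s : 0 <= s <= 1 -> cabs (z - a) < r -> cabs (w - a) < r ->
  cabs (z + s%:C * (w - z) - a) < r.
Proof.
move=> s01 hz hw; set m := Num.max (cabs (z - a)) (cabs (w - a)).
apply: (@le_lt_trans _ _ m); last by rewrite gt_max hz hw.
by apply: disc_convex => //; rewrite le_max lexx ?orbT.
Qed.

(** Integrals along radii give the primitive. Their difference is an integral over the segment from
    [z] to [w] by [goursat] on the triangle with vertices [a], [z], [w], parametrised by a square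
    with one side collapsed to [a]. *)
Lemma primitive f a r : holo (disc a r) f -> exists F, forall z, disc a r z -> hasd setT F z (f z).
Proof.
move=> hf.
pose F z := cint (fun t => f (a + t * (z - a)) * (z - a)).
have seg z w t : disc a r z -> disc a r w -> 0 <= t <= 1 -> disc a r (z + t%:C * (w - z)).
  by move=> dz dw t01; apply: cdisc_convex.
have cseg z w : disc a r z -> disc a r w -> ctn01 (fun t => f (z + t * (w - z)) * (w - z)).
  move=> dz dw t t01; apply: ctnM; last exact: ctn_const.
  apply: (@ctn_comp _ _ setT (fun t => z + t * (w - z))) => //.
    apply: ctnD; first exact: ctn_const; apply: ctnM; [exact: ctn_id|exact: ctn_const].
  by apply: (@ctn_holo_at _ _ _ f _ hf); exact: seg.
have key z w : disc a r z -> disc a r w -> F w - F z = cint (fun t => f (z + t * (w - z)) * (w - z)).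
  move=> dz dw; have r0 : 0 < r by move: dz; rewrite /disc /=; apply: le_lt_trans; exact: cabs_ge0.
  have da : disc a r a by exact: disc_center.
  pose H (s t : C) : C := a + s * (z + t * (w - z) - a).
  pose Hx (s t : C) : C := z + t * (w - z) - a.
  pose Hy (s t : C) : C := s * (w - z).
  have E : cint (fun t => f (H t 0) * Hx t 0) + cint (fun t => f (H 1 t) * Hy 1 t) =
    cint (fun t => f (H t 1) * Hx t 1) + cint (fun t => f (H 0 t) * Hy 0 t).
    apply: (@goursat _ f H Hx Hy (2 * r)) => x y x01 y01.
      split.
      - rewrite /H /Hx -[X in hasd _ _ _ X]add0r; apply: hasdD; first exact: hasd_const.
        by rewrite -[X in hasd _ _ _ X]mul1r; apply: hasdZr; exact: hasd_id.
      - rewrite /H /Hy -[X in hasd _ _ _ X]add0r; apply: hasdD; first exact: hasd_const.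
        apply: hasdZ; rewrite -[w - z in X in hasd _ _ _ X]subr0; apply: hasdB; last exact: hasd_const.
        rewrite -[X in hasd _ _ _ X]add0r; apply: hasdD; first exact: hasd_const.
        by rewrite -[X in hasd _ _ _ X]mul1r; apply: hasdZr; exact: hasd_id.
      - exact: ctn_const.
      - exact: ctn_const.
      - by apply: hf; rewrite /H; apply: (seg) => //; exact: seg.
    have h1 := seg z w y dz dw y01; rewrite /disc /= in dz dw h1.
    split; first by rewrite /Hx; lra.
    have /andP[x0 x1] := x01.
    rewrite /Hy cabsM cabs_real ger0_norm //; have := cabs_tri w a z; rewrite (cabsB a z) => h2.
    have : x * cabs (w - z) <= 1 * cabs (w - z) by rewrite ler_wpM2r ?cabs_ge0.
    lra.
  have E0 : cint (fun t => f (H 0 t) * Hy 0 t) = 0.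
    rewrite (@cintE _ (fun=> 0)) ?subr0 // => t t01; rewrite /Hy mul0r mulr0; exact: hasd_const.
  have E1 : F z = cint (fun t => f (H t 0) * Hx t 0) by rewrite /F /H /Hx mul0r addr0.
  have E2 : F w = cint (fun t => f (H t 1) * Hx t 1) by rewrite /F /H /Hx (_ : z + 1 * (w - z) = w) //; ring.
  have E3 : cint (fun t => f (z + t * (w - z)) * (w - z)) = cint (fun t => f (H 1 t) * Hy 1 t).
    by rewrite /H /Hy; congr cint; apply/funext => t; rewrite !mul1r [a + _]addrC subrK.
  by rewrite E3 E1 E2; apply/eqP; rewrite subr_eq addrC E E0 addr0.
exists F => z dz; apply: eps_hasd => // e e0.
have [s0 s00 hs0] := disc_inner dz.
have [d /hasd_ctn /(_ _ e0)[s s1 hs]] := hf _ dz.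
exists (Num.min s s0); first by rewrite lt_min s1.
move=> w _; rewrite lt_min => /andP[w1 w2]; have dw := hs0 _ w2.
have -> : F w - F z - (w - z) * f z = cint (fun t => (f (z + t * (w - z)) - f z) * (w - z)).
  rewrite key // (_ : (w - z) * f z = cint (fun t => (f z) * (w - z))).
    rewrite -[- cint _]mulN1r -cintZ; last by move=> t _; exact: ctn_const.
    rewrite -cintD; [|exact: cseg|by move=> t _; exact: ctn_const].
    by congr cint; apply/funext => t; ring.
  rewrite (@cintE _ (fun t => t * (f z * (w - z)))); first by ring.
  by move=> t _; rewrite -[X in hasd _ _ _ X]mul1r; apply: hasdZr; exact: hasd_id.
apply: cint_bound.
  move=> t t01; apply: ctnM; last exact: ctn_const; apply: ctnD; last exact: ctn_const.
  apply: (@ctn_comp _ _ setT (fun t => z + t * (w - z))) => //.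
    apply: ctnD; first exact: ctn_const; apply: ctnM; [exact: ctn_id|exact: ctn_const].
  by apply: (@ctn_holo_at _ _ _ f _ hf); exact: seg.
move=> t t01; rewrite cabsM ler_wpM2r ?cabs_ge0 // ltW //; apply: hs => //.
have -> : z + t%:C * (w - z) - z = t%:C * (w - z) by ring.
have /andP[t0 t1] := t01; rewrite cabsM cabs_real ger0_norm //; apply: le_lt_trans w1.
by rewrite ler_piMl ?cabs_ge0.
Qed.

Lemma deriv0_const f a r z : (forall w, disc a r w -> hasd setT f w 0) -> disc a r z -> f z = f a.
Proof.
move=> hf dz; have r0 : 0 < r by move: dz; rewrite /disc /=; apply: le_lt_trans; exact: cabs_ge0.
have := @hasd0_const R (fun t => f (a + t * (z - a))) 0 1 ler01.
rewrite mul1r mul0r addr0 [a + _]addrC subrK; apply => t t01.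
rewrite -(mul0r (1 * (z - a))); apply: (@hasd_comp _ _ setT (fun t => a + t * (z - a)) f) => //.
  rewrite -[X in hasd _ _ _ X]add0r; apply: hasdD; first exact: hasd_const.
  by apply: hasdZr; exact: hasd_id.
by apply: hf; apply: cdisc_convex => //; exact: disc_center.
Qed.

Lemma holo_log f a r : 0 < r -> holo (disc a r) f -> (forall z, disc a r z -> f z != 0) ->
  exists2 L, holo (disc a r) L & forall z, disc a r z -> cexp (L z) = f z.
Proof.
move=> r0 hf f0.
have /choice[f' hf'] : forall z, exists d, disc a r z -> hasd setT f z d.
  by move=> z; have [/hf[d hd]|nd] := pselect (disc a r z); [exists d|exists 0].
have hd := holo_deriv hf hf'.
have [F hF] := primitive (holo_div hd hf f0).
have [c hc] := cexp_surj (f0 a (disc_center a r0)).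
exists (fun z => F z - F a + c).
  move=> z dz; exists (f' z / f z - 0 + 0); apply: hasdD; last exact: hasd_const.
  by apply: hasdB; [exact: hF|exact: hasd_const].
move=> z dz.
have := @deriv0_const (fun w => f w * cexp (- (F w - F a))) a r z _ dz.
rewrite subrr oppr0 cexp0 mulr1 => h.
rewrite cexpD hc -h.
  by rewrite mulrCA cexpN mulfV ?cexp_neq0 // mulr1.
move=> w dw; have fw := f0 _ dw.
have -> : 0 = f' w * cexp (- (F w - F a)) + f w * (cexp (- (F w - F a)) * (- (f' w / f w - 0))) by field.
apply: hasdM; first exact: hf'.
apply: (@hasd_comp _ _ setT (fun w => - (F w - F a))) => //; last exact: hasd_cexp.
by apply: hasdN; apply: hasdB; [exact: hF|exact: hasd_const].
Qed.

Lemma holo_cexp (D : set C) f : holo D f -> holo D (fun z => cexp (f z)).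
Proof.
move=> hf; apply: (@holo_comp _ _ setT f (@cexp R)) => // z _.
by exists (cexp z); exact: hasd_cexp.
Qed.

Lemma holo_sqrt f a r : 0 < r -> holo (disc a r) f -> (forall z, disc a r z -> f z != 0) ->
  exists2 u, holo (disc a r) u & forall z, disc a r z -> u z ^+ 2 = f z.
Proof.
move=> r0 hf f0; have [L hL EL] := holo_log r0 hf f0.
exists (fun z => cexp (L z / 2)).
  by apply: holo_cexp; apply: holoM => //; exact: holo_const.
by move=> z dz; rewrite expr2 -cexpD -EL //; congr cexp; field.
Qed.

End Logarithm.

(** * The theorems of Bloch, Schottky, Montel and Picard *)

Section Bloch.
Variable R : realType.
Notation C := R[i].
Implicit Types (f g h : C -> C) (a z w : C) (r s M : R).

Lemma holo_lipschitz f f' b t M : 0 <= M -> (forall w, cabs (w - b) <= t -> hasd setT f w (f' w) /\ cabs (f' w) <= M) ->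
  forall w, cabs (w - b) <= t -> cabs (f w - f b) <= M * cabs (w - b).
Proof.
move=> M0 hf w wt.
have := @mean_value R (fun u => f (b + u * (w - b))) 0 1 (M * cabs (w - b)) ler01.
rewrite subr0 mulr1 mul1r mul0r addr0 [b + _]addrC subrK; apply; first by rewrite mulr_ge0 ?cabs_ge0.
move=> u u01; have [|h1 h2] := hf (b + u%:C * (w - b)).
  by apply: disc_convex => //; rewrite subrr cabs0; apply: le_trans wt; exact: cabs_ge0.
exists (f' (b + u%:C * (w - b)) * (w - b)); last by rewrite cabsM ler_wpM2r ?cabs_ge0.
apply: (@hasd_comp _ _ setT (fun u => b + u * (w - b)) f) => //.
rewrite -[X in hasd _ _ _ X]add0r; apply: hasdD; first exact: hasd_const.
by rewrite -[X in hasd _ _ _ X]mul1r; apply: hasdZr; exact: hasd_id.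
Qed.

(* At a point maximising [cabs (g' z) * (r / 2 - cabs (z - a))] the derivative is
   comparable to its supremum over a disc of matching size. *)
Lemma bloch g a r K d : 0 < r -> 0 < K -> holo (disc a r) g ->
  (forall c, exists2 v, cabs (v - c) < K & forall z, disc a r z -> g z != v) ->
  hasd setT g a d -> cabs d * r <= 512 * K.
Proof.
move=> r0 K0 hg hK hd; have [//|bad] := leP (cabs d * r) (512 * K); exfalso.
have /choice[g' hg'] : forall z, exists d, disc a r z -> hasd setT g z d.
  by move=> z; have [/hg[e he]|nd] := pselect (disc a r z); [exists e|exists 0].
have hg'h := holo_deriv hg hg'.
(* On the closed half disc the derivative is bounded, so the supremum is finite. *)
pose p := r / 2; have p0 : 0 < p by rewrite divr_gt0.
have sub : cdisc a p `<=` disc a r by apply: le_cdisc_disc; rewrite /p; lra.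
have [M M0 hM] := holo_bounded (holo_sub sub hg'h).
pose mu z := cabs (g' z) * (p - cabs (z - a)).
pose E := [set x | exists2 z, cdisc a p z & x = mu z].
have mu_le z : cdisc a p z -> mu z <= M * p.
  move=> dz; apply: ler_pM; rewrite ?cabs_ge0 ?subr_ge0 //; first exact: hM.
  by have := cabs_ge0 (z - a); lra.
have da : cdisc a p a by rewrite /cdisc /= subrr cabs0 ltW.
have Eub : has_ubound E by exists (M * p) => _ [z dz ->]; exact: mu_le.
have E0 : E (mu a) by exists a.
have dE : d = g' a by apply: hasd_uniq hd _; apply: hg'; exact: disc_center.
have mua : mu a = cabs d * p by rewrite /mu subrr cabs0 subr0 dE.
have S0 : 0 < sup E.
  apply: lt_le_trans (ub_le_sup Eub E0); rewrite mua /p mulrA divr_gt0 //.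
  by apply: lt_trans bad; apply: (mulr_gt0 _ K0); rewrite ltr0n.
have muS z : cdisc a p z -> mu z <= sup E by move=> dz; apply: ub_le_sup => //; exists z.
have [b db bS] : exists2 b, cdisc a p b & sup E / 2 < mu b.
  apply: contrapT => h; have : sup E <= sup E / 2.
    apply: ge_sup; first by exists (mu a).
    by move=> _ [z dz ->]; rewrite leNgt; apply/negP => h'; apply: h; exists z.
  by lra.
have Sd : cabs d * p <= sup E by rewrite -mua; exact: muS.
have mb0 : 0 < mu b by lra.
have [m0 pb0] : 0 < cabs (g' b) /\ 0 < p - cabs (b - a).
  have h1 := cabs_ge0 (g' b); have h2 : 0 <= p - cabs (b - a) by rewrite subr_ge0.
  split; rewrite lt_neqAle ?h1 ?h2 andbT eq_sym; apply/eqP => h; move: mb0; rewrite /mu h ?mul0r ?mulr0 ltxx //.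
set m := cabs (g' b) in m0.
(* Within [t] of [b] the weight is still at least [t]; as [mu] is at most
   [sup E < 2 * mu b = 4 * (m * t)], the derivative is at most [4 * m] there. *)
pose t := (p - cabs (b - a)) / 2; have t0 : 0 < t by rewrite divr_gt0.
have mt : mu b = 2 * (m * t) by rewrite /mu -/m /t; field.
have subb w : cabs (w - b) <= t -> cabs (w - a) <= p - t.
  by have := cabs_tri w b a; rewrite /t; lra.
have der w : cabs (w - b) <= t -> hasd setT g w (g' w) /\ cabs (g' w) <= 4 * m.
  move=> wt; have wa := subb _ wt; have dw : cdisc a p w by rewrite /cdisc /=; lra.
  split; first by apply: hg'; exact: sub.
  rewrite -(ler_pM2r t0); apply: le_trans (_ : mu w <= _).
    by rewrite /mu ler_wpM2l ?cabs_ge0 //; lra.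
  by apply: le_trans (muS _ dw) _; lra.
have m4 : 0 <= 4 * m by rewrite mulr_ge0 // ltW.
have lip := holo_lipschitz m4 der.
have hgb : holo (cdisc b t) (fun w => g w - g b).
  apply: holoB; last exact: holo_const.
  by move=> w /der[h _]; exists (g' w).
have [|e he [_ hb]] := @cauchy_estimate R _ b t (4 * m * t) t0 hgb.
  by move=> w wt; apply: le_trans (lip w _) _; rewrite wt.
have eE : e = g' b.
  have h1 : hasd setT (fun w => g w - g b) b (g' b - 0).
    have [|hb' _] := der b; first by rewrite subrr cabs0 ltW.
    by apply: hasdB; [exact: hb'|exact: hasd_const].
  by rewrite (hasd_uniq he h1) subr0.
(* At this radius the linear term is [m * t / 16] and the quadratic remainder at most [m * t / 32],
   which leaves [m * t / 32] on the circle. *)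
pose s := t / 16; have s0 : 0 < s by rewrite divr_gt0.
have circle w : cabs (w - b) = s -> m * t / 32 <= cabs (g w - g b).
  move=> ws; have [|_] := hb w; first by rewrite ws /s; lra.
  rewrite ws subrr subr0 eE => h1.
  have h2 : cabs ((w - b) * g' b) = s * m by rewrite cabsM ws.
  have := cabs_sub_ge ((w - b) * g' b) ((w - b) * g' b - (g w - g b)).
  rewrite subKr [cabs (_ * _ - _)]cabsB h2 => h3.
  have E1 : 2 * (4 * m * t) * (s / t) ^+ 2 = m * t / 32 by rewrite /s; field; rewrite gt_eqF.
  have E2 : s * m = m * t / 16 by rewrite /s; ring.
  by rewrite E1 in h1; lra.
have [v vK vo] := hK (g b).
(* From [cabs d * r = 2 * (cabs d * p) <= 2 * sup E < 4 * mu b = 8 * (m * t)]; hence the constant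
   512, which is 8 times 64. *)
have Kmt : K < m * t / 64.
  have : cabs d * r = 2 * (cabs d * p) by rewrite /p; field.
  lra.
have hv : holo (cdisc b s) (fun w => g w - v).
  apply: holoB; last exact: holo_const.
  by move=> w ws; exists (g' w); have [|//] := der w; apply: le_trans ws _; rewrite /s; lra.
have [||z zs /eqP] := @zero_exists _ (fun w => g w - v) b s (m * t / 64) s0 hv.
- move=> w /circle; have := cabs_tri (g w) v (g b); lra.
- by move: vK; rewrite cabsB => vK; apply: lt_trans vK Kmt.
rewrite subr_eq0; apply/negP; apply: vo; apply: sub; apply: le_trans (subb _ _) _; rewrite /s in zs; lra.
Qed.

End Bloch.

Section Schottky.
Variable R : realType.
Notation C := R[i].
Implicit Types (f g h : C -> C) (a z w : C) (r s M : R).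

Lemma cexp_real (x : R) : cexp x%:C = (expR x)%:C.
Proof. by rewrite cexp.unlock /= cos0 sin0 -[1 +i* 0]/(1 : C) mulr1. Qed.

Lemma cexp_tau_int (k : int) : cexp (tau R * k%:~R) = 1.
Proof.
have nat_case n : cexp (tau R * n%:R) = 1.
  elim: n => [|n IH]; first by rewrite mulr0 cexp0.
  by rewrite -natr1 mulrDr cexpD IH mulr1 cexp_tau mulr1.
case: k => n; first exact: nat_case.
by rewrite NegzE mulrNz mulrN cexpN nat_case invr1.
Qed.

(* The equation says [cosh (2 v) = 2 n + 1], that is, [cosh v ^+ 2 = n + 1]. *)
Lemma cosh_net (c : C) : exists2 v, cabs (v - c) < 3 + pi &
  exists n : nat, cexp (v + v) + cexp (- (v + v)) = (4 * n + 2)%:R.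
Proof.
case: c => c1 c2; pose a1 := `|c1|; have a10 : 0 <= a1 by exact: normr_ge0.
pose E := expR (2 * a1); have E0 : 0 < E by exact: expR_gt0.
have E1 : 1 <= E by apply: le_trans (expR_ge1Dx _); rewrite lerDl mulr_ge0.
have EV : E^-1 <= 1 by rewrite invf_le1.
have EV0 : 0 < E^-1 by rewrite invr_gt0.
(* [y] is the hyperbolic cosine of [2 * a1], and [q] the largest odd integer not above it. Then
   [ln x] is the inverse hyperbolic cosine of [q], and differs from [2 * a1] by at most 5. *)
pose y := (E + E^-1) / 2.
have y1 : 1 <= y.
  rewrite /y ler_pdivlMr // mul1r -subr_ge0.
  have -> : E + E^-1 - 2 = (E - 1) ^+ 2 * E^-1 by field; rewrite gt_eqF.
  by rewrite mulr_ge0 ?sqr_ge0 // ltW.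
pose n := Num.truncn ((y - 1) / 2).
have y0 : 0 <= (y - 1) / 2 by rewrite divr_ge0 // subr_ge0.
have n1 : n%:R <= (y - 1) / 2 by rewrite truncn_le.
have n2 : (y - 1) / 2 < n%:R + 1 by rewrite natr1; exact: truncnS_gt.
pose q : R := 2 * n%:R + 1; have nn : 0 <= n%:R :> R by rewrite ler0n.
have q1 : 1 <= q by rewrite /q; lra.
have qy : q <= y by rewrite /q; lra.
have yq : y < q + 2 by rewrite /q; lra.
have D0 : 0 <= q ^+ 2 - 1 by rewrite subr_ge0 exprn_ege1.
pose x := q + Num.sqrt (q ^+ 2 - 1).
have xq : q <= x by rewrite /x lerDl.
have x0 : 0 < x by lra.
have sqE : Num.sqrt (q ^+ 2 - 1) ^+ 2 = q ^+ 2 - 1 by rewrite sqr_sqrtr.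
have xV : x + x^-1 = 2 * q.
  have h : x ^+ 2 + 1 = 2 * q * x by rewrite /x sqrrD sqE; ring.
  have x_neq0 : x != 0 by rewrite gt_eqF.
  by apply: (mulIf x_neq0); rewrite -h; field.
have x2q : x <= 2 * q by rewrite -xV lerDl invr_ge0 ltW.
have hi : ln x <= 2 * a1 + 1.
  rewrite -ler_expR lnK ?posrE // expRD.
  have e1 : 2 <= expR 1 :> R by have := expR_ge1Dx (1 : R).
  apply: (@le_trans _ _ (2 * E)).
    have : 2 * q <= 2 * y by rewrite ler_pM2l.
    by rewrite /y; lra.
  by rewrite mulrC ler_pM2l.
have lo : 2 * a1 <= ln x + 5.
  rewrite -ler_expR expRD lnK ?posrE //.
  have e5 : 6 <= expR 5 :> R by have := expR_ge1Dx (5 : R); lra.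
  apply: (@le_trans _ _ (x * 6)); last by rewrite ler_pM2l.
  by rewrite -/E; move: yq; rewrite /y; lra.
have close : `|ln x / 2 - a1| <= 5 / 2 by rewrite ler_norml; apply/andP; split; lra.
pose sg : R := if 0 <= c1 then 1 else -1.
have sgE : sg * a1 = c1.
  by rewrite /sg /a1; case: (leP 0 c1) => h; [rewrite mul1r ger0_norm|rewrite ltr0_norm // mulrN mulN1r opprK].
have sg1 : `|sg| = 1 by rewrite /sg; case: ifP => _; rewrite ?normrN normr1.
(* Adding a multiple of [pi * 'i] to [v] leaves [cexp (v + v)] unchanged, so the imaginary part can
   be brought within [pi] of [c2]. *)
pose k := Num.floor (c2 / pi).
have p0 : 0 < pi :> R := pi_gt0 R.
have /andP[k1 k2] : 0 <= c2 - pi * k%:~R < pi.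
  have := floor_itv (c2 / pi); rewrite -/k ler_pdivlMr // ltr_pdivrMr // intrD mulrDl mul1r => /andP[h1 h2].
  by rewrite [pi * _]mulrC subr_ge0 h1 ltrBlDl.
exists ((sg * (ln x / 2)) +i* (pi * k%:~R)).
  apply: le_lt_trans (cabs_le_ReIm _) _ => /=.
  have -> : sg * (ln x / 2) - c1 = sg * (ln x / 2 - a1) by rewrite -{1}sgE; ring.
  have q2 : `|pi * k%:~R - c2| < pi by rewrite ltr_norml; apply/andP; split; lra.
  by rewrite normrM sg1 mul1r; lra.
exists n.
have -> : ((sg * (ln x / 2)) +i* (pi * k%:~R)) + ((sg * (ln x / 2)) +i* (pi * k%:~R)) =
    (sg * ln x)%:C + tau R * k%:~R.
  rewrite -(rmorph_int (real_complex R)) /tau; apply/eqP; rewrite eq_complex /=.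
  by apply/andP; split; apply/eqP; field.
rewrite cexpN cexpD cexp_tau_int mulr1 cexp_real.
have -> : (4 * n + 2)%:R = (x + x^-1)%:C :> C.
  rewrite xV /q natrD natrM -!(rmorph_nat (real_complex R)) -rmorphM -rmorphD; congr (_%:C); ring.
have lx : expR (ln x) = x by rewrite lnK.
rewrite -fmorphV -rmorphD; congr (_%:C); rewrite /sg; case: ifP => _.
  by rewrite mul1r lx.
by rewrite mulN1r expRN lx invrK addrC.
Qed.

(* With [f = exp (2 pi i F)], [F] omits the integers; writing [F = u ^+ 2],
   [F - 1 = v ^+ 2] and [u - v = exp G], so that [F = cosh G ^+ 2], the function
   [G] omits the net of [cosh_net] and has bounded derivative by [bloch]. *)
Lemma schottky : exists2 K : R, 1 <= K & forall f a r, 0 < r -> holo (disc a r) f ->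
  (forall z, disc a r z -> f z != 0 /\ f z != 1) -> 1 / 2 <= cabs (f a) <= 2 ->
  forall z, disc a (r / 2) z -> cabs (f z) <= K.
Proof.
have p0 : 0 < pi :> R := pi_gt0 R.
(* The net of [cosh_net] has mesh [3 + pi]; [bloch] on discs of radius [r / 2] then bounds the
   derivative of [G] below by [B / r]. *)
pose B : R := 1024 * (3 + pi).
have B0 : 0 <= B by rewrite mulr_ge0 ?ler0n //; lra.
exists (expR ((2 * pi) * (16 * expR (2 * B)))).
  apply: le_trans (expR_ge1Dx _); rewrite lerDl !mulr_ge0 ?ltW ?expR_gt0 //.
move=> f a r r0 hf f01 /andP[fa1 fa2].
have da : disc a r a := disc_center a r0.
have [L hL EL] := holo_log r0 hf (fun z dz => (f01 z dz).1).
(* This picks the branch of the logarithm with [0 <= Re (F a) <= 1]. The two-sided bound on [f a]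
   controls [Im (F a)], so [F a] has an absolute bound. *)
pose N := Num.floor (Re (L a / tau R)).
pose F z := L z / tau R - N%:~R.
have hF : holo (disc a r) F.
  by apply: holoB; [apply: holoM => //|]; exact: holo_const.
have EF z : disc a r z -> cexp (tau R * F z) = f z.
  move=> dz; rewrite /F mulrBr cexpD cexpN cexp_tau_int invr1 mulr1 -EL //.
  by congr cexp; field; exact: tau_neq0.
have Fint z (m : int) : disc a r z -> F z != m%:~R.
  move=> dz; apply/eqP => h; have [_ /eqP] := f01 z dz; apply.
  by rewrite -EF // h cexp_tau_int.
have absf z : disc a r z -> cabs (f z) = expR (- (2 * pi * Im (F z))).
  by move=> dz; rewrite -EF // cabs_cexp /tau; congr expR; case: (F z) => x y /=; ring.
have Re01 : 0 <= Re (F a) <= 1.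
  have := floor_itv (Re (L a / tau R)); rewrite -/N intrD /F Re_sub -(rmorph_int (real_complex R)) /= => /andP[h1 h2].
  by rewrite subr_ge0 h1 lerBlDl ltW.
have Im1 : `|2 * pi * Im (F a)| <= 1.
  have h1 := expR_ge1Dx (- (2 * pi * Im (F a))); have h2 := expR_ge1Dx (2 * pi * Im (F a)).
  have h3 : expR (2 * pi * Im (F a)) <= 2.
    rewrite -[2 * pi * _]opprK expRN -(absf a da) -[leRHS]invrK lef_pV2 ?posrE //; lra.
  by rewrite -(absf a da) in h1; rewrite ler_norml; apply/andP; split; lra.
have pi2 := pi_ge2 R.
have Im2 : `|Im (F a)| <= 1.
  move: Im1; rewrite normrM [ `|2 * pi| ]gtr0_norm ?mulr_gt0 // => h.
  apply: le_trans h; rewrite ler_peMl //; lra.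
have Fa : cabs (F a) <= 2.
  apply: le_trans (cabs_le_ReIm _) _; have /andP[h1 h2] := Re01; rewrite (ger0_norm h1); lra.
have [u hu Eu] := holo_sqrt r0 hF (fun z dz => Fint z 0 dz).
have hF1 : holo (disc a r) (fun z => F z - 1) by apply: holoB => //; exact: holo_const.
have F1 z : disc a r z -> F z - 1 != 0 by move=> dz; rewrite subr_eq0; exact: (Fint z 1 dz).
have [v hv Ev] := holo_sqrt r0 hF1 F1.
pose W z := u z - v z.
have hW : holo (disc a r) W by exact: holoB.
have WV z : disc a r z -> W z * (u z + v z) = 1.
  move=> dz; have := Eu z dz; have := Ev z dz; rewrite /W => e1 e2.
  have -> : (u z - v z) * (u z + v z) = u z ^+ 2 - v z ^+ 2 by ring.
  by rewrite e1 e2; ring.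
have W0 z : disc a r z -> W z != 0.
  by move=> /WV h; apply/eqP => w0; move: h; rewrite w0 mul0r => /esym/eqP; rewrite oner_eq0.
have [G hG EG] := holo_log r0 hW W0.
have WVE z : disc a r z -> (W z)^-1 = u z + v z.
  by move=> dz; apply: (mulfI (W0 z dz)); rewrite mulfV ?W0 // WV.
have omit c : exists2 x, cabs (x - c) < 3 + pi & forall z, disc a r z -> G z != x.
  have [x xc [n hn]] := cosh_net c; exists x => // z dz; apply/eqP => Gx.
  (* At a point of the net [F = u ^+ 2] would equal [(4 * n + 2 + 2) / 4], which is the excluded
     integer [n + 1]. *)
  have /eqP := Fint z n.+1 dz; apply; rewrite -(Eu z dz).
  have -> : u z = (W z + (W z)^-1) / 2 by rewrite WVE // /W; field.
  have e1 : cexp (x + x) = W z ^+ 2 by rewrite cexpD -Gx EG.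
  move: hn; rewrite cexpN e1 => hn.
  have -> : ((W z + (W z)^-1) / 2) ^+ 2 = (W z ^+ 2 + (W z ^+ 2)^-1 + 2) / 4 by field; exact: W0.
  by rewrite hn -natr1 natrD natrM; field.
have q0 : 0 < 3 + pi :> R by lra.
have r2 : 0 < r / 2 by rewrite divr_gt0.
have /choice[G' hG'] : forall z, exists d, disc a r z -> hasd setT G z d.
  by move=> z; have [/hG[e he]|nd] := pselect (disc a r z); [exists e|exists 0].
have sub z : cabs (z - a) <= r / 2 -> disc z (r / 2) `<=` disc a r.
  by move=> za w; rewrite /disc /=; have := cabs_tri w z a; lra.
have G'b z : cabs (z - a) <= r / 2 -> hasd setT G z (G' z) /\ cabs (G' z) <= B / r.
  move=> za; have dz : disc a r z by rewrite /disc /=; lra.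
  split; first exact: hG'.
  have := bloch r2 q0 (holo_sub (sub z za) hG) _ (hG' z dz).
  rewrite ler_pdivlMr // => h.
  have : cabs (G' z) * (r / 2) <= 512 * (3 + pi).
    by apply: h => c; have [x x1 x2] := omit c; exists x => // w /(sub z za)/x2.
  by rewrite /B; lra.
have Br0 : 0 <= B / r by rewrite divr_ge0 // ltW.
have Gosc z : cabs (z - a) <= r / 2 -> cabs (G z - G a) <= B.
  move=> za; apply: le_trans (holo_lipschitz Br0 G'b za) _.
  rewrite mulrAC ler_pdivrMr // ler_wpM2l //; lra.
have sq_le x (M : R) : 0 <= M -> cabs (x ^+ 2) <= M ^+ 2 -> cabs x <= M.
  by move=> M0; rewrite cabsX ler_sqr ?nnegrE ?cabs_ge0.
have ua : cabs (u a) <= 2 by apply: sq_le => //; rewrite Eu //; lra.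
have va : cabs (v a) <= 2.
  apply: sq_le => //; rewrite Ev //; have := cabs_sub (F a) 1; rewrite cabs1; lra.
have Wa : cabs (W a) <= 4 by rewrite /W; have := cabs_sub (u a) (v a); lra.
have WVa : cabs (W a)^-1 <= 4 by rewrite WVE //; have := cabsD (u a) (v a); lra.
move=> z; rewrite /disc /= => za.
have dz : disc a r z by rewrite /disc /=; lra.
have ReG : `|Re (G z) - Re (G a)| <= B.
  by rewrite -Re_sub; apply: le_trans (Re_le_cabs _) _; apply: Gosc; lra.
move: ReG; rewrite ler_norml => /andP[g1 g2].
have Wz : cabs (W z) <= 4 * expR B.
  rewrite -EG // cabs_cexp; apply: (@le_trans _ _ (expR (Re (G a)) * expR B)).
    by rewrite -expRD ler_expR; lra.
  by rewrite ler_pM2r ?expR_gt0 // -cabs_cexp EG.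
have WVz : cabs (W z)^-1 <= 4 * expR B.
  rewrite -EG // -cexpN cabs_cexp; apply: (@le_trans _ _ (expR (Re (- G a)) * expR B)).
    by rewrite -expRD ler_expR; case: (G z) g1 g2 => ? ?; case: (G a) => ? ? /=; lra.
  by rewrite ler_pM2r ?expR_gt0 // -cabs_cexp cexpN EG.
have uz : cabs (u z) <= 4 * expR B.
  have -> : u z = (W z + (W z)^-1) / 2 by rewrite WVE // /W; field.
  rewrite cabsM cabsV cabs_nat ler_pdivrMr //; have := cabsD (W z) (W z)^-1; lra.
have Fz : cabs (F z) <= 16 * expR (2 * B).
  rewrite -Eu // cabsX; have -> : 16 * expR (2 * B) = (4 * expR B) ^+ 2.
    have -> : expR (2 * B) = expR B * expR B by rewrite -expRD; congr expR; ring.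
    by ring.
  by rewrite ler_sqr ?nnegrE ?cabs_ge0 ?mulr_ge0 ?expR_ge0.
have pp : 0 <= 2 * pi :> R by rewrite mulr_ge0 // ltW.
rewrite absf // ler_expR -mulrN; apply: (ler_wpM2l pp).
apply: le_trans Fz; apply: le_trans (Im_le_cabs _); apply: le_trans (ler_norm _) _.
by rewrite normrN.
Qed.

End Schottky.

(** * Omitted values: Montel's and Picard's theorems *)

Section BigMontel.
Variable R : realType.
Notation C := R[i].
Implicit Types (f g h : C -> C) (a z w : C) (r s M : R).

(** When [f a] is near 0, [1 - f] omits the same two values and is neither small nor large at
    [a]. *)
Lemma schottky_le1 : exists2 K : R, 1 <= K & forall f a r, 0 < r -> holo (disc a r) f ->
  (forall z, disc a r z -> f z != 0 /\ f z != 1) -> cabs (f a) <= 1 ->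
  forall z, disc a (r / 2) z -> cabs (f z) <= K.
Proof.
have [K K1 hK] := schottky R; exists (K + 1); first by lra.
move=> f a r r0 hf f01 fa z dz; have [fa2|fa2] := leP (1 / 2) (cabs (f a)).
  by apply: (@le_trans _ _ K); [apply: (hK f a r) => //; rewrite fa2 /=|]; lra.
have hg : holo (disc a r) (fun z => 1 - f z) by apply: holoB => //; exact: holo_const.
have g01 w : disc a r w -> 1 - f w != 0 /\ 1 - f w != 1.
  move=> /f01[w0 w1]; split; first by rewrite subr_eq0 eq_sym.
  by rewrite -subr_eq0 addrAC subrr add0r oppr_eq0.
have ga : 1 / 2 <= cabs (1 - f a) <= 2.
  have h1 := cabs_sub 1 (f a); have h2 := cabs_sub_ge 1 (f a); rewrite cabs1 in h1 h2.
  by apply/andP; split; lra.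
have := hK _ a r r0 hg g01 ga z dz.
have -> : f z = 1 - (1 - f z) by ring.
have := cabs_sub 1 (1 - f z); rewrite cabs1.
have -> : 1 - (1 - (1 - f z)) = 1 - f z by ring.
lra.
Qed.

Lemma ucvg_inv (D : set C) (g : nat -> C -> C) h M : (forall w, D w -> h w != 0) ->
  (forall w, D w -> cabs (h w)^-1 <= M) -> (forall k w, D w -> g k w != 0) ->
  ucvg D (fun k w => (g k w)^-1) h -> ucvg D g (fun w => (h w)^-1).
Proof.
move=> h0 hM g0 hu e e0.
pose M' := Num.max M 1; have M1 : 1 <= M' by rewrite le_max lexx orbT.
have M0 : 0 < M' by lra.
have e1 : 0 < Num.min (1 / (2 * M')) (e / (2 * (M' * M'))).
  by rewrite lt_min !divr_gt0 ?mulr_gt0.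
have [N hN] := hu _ e1; exists N => k /hN kN w Dw.
have := kN w Dw; rewrite lt_min => /andP[k1 k2].
have hw := h0 _ Dw; have gw := g0 k _ Dw.
have hw0 : 0 < cabs (h w) by rewrite cabs_gt0.
have hv : cabs (h w)^-1 <= M' by apply: le_trans (hM _ Dw) _; rewrite le_max lexx.
have hM2 : 1 / M' <= cabs (h w) by rewrite ler_pdivrMr // mulrC -ler_pdivrMr // div1r -cabsV.
have gv : 1 / (2 * M') <= cabs (g k w)^-1.
  have := cabs_sub_ge (h w) (h w - (g k w)^-1); rewrite subKr [cabs (_ - _)]cabsB.
  have : 1 / M' = 1 / (2 * M') + 1 / (2 * M') by field; rewrite gt_eqF.
  lra.
have gM : cabs (g k w) <= 2 * M'.
  by rewrite -[leLHS]invrK -cabsV -[leRHS]invrK lef_pV2 ?posrE ?invr_gt0 ?mulr_gt0 ?cabs_gt0 ?invr_eq0 // -div1r.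
have -> : g k w - (h w)^-1 = - ((g k w)^-1 - h w) * (g k w * (h w)^-1) by field; rewrite hw gw.
rewrite cabsM cabsN cabsM.
have q : cabs (g k w) * cabs (h w)^-1 <= 2 * (M' * M').
  by rewrite mulrA; apply: ler_pM; rewrite ?cabs_ge0.
apply: (@le_lt_trans _ _ (cabs ((g k w)^-1 - h w) * (2 * (M' * M')))).
  by rewrite ler_wpM2l ?cabs_ge0.
by rewrite -ltr_pdivlMr // mulr_gt0 // mulr_gt0.
Qed.

Lemma frequently_or (P Q : nat -> Prop) : (forall k, P k \/ Q k) ->
  exists2 s, subsq s & (forall k, P (s k)) \/ (forall k, Q (s k)).
Proof.
move=> PQ; have [h|/existsNP[N hN]] := pselect (forall N, exists2 k, (N <= k)%N & P k).
  have [s hs sP] := @subsq_extract (fun _ k => P k) (fun _ N => h N).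
  by exists s => //; left.
exists (fun k => N + k)%N; first exact: subsq_shift.
right=> k; have [Pk|//] := PQ (N + k)%N; exfalso; apply: hN.
by exists (N + k)%N => //; exact: leq_addr.
Qed.

(** Schottky's bound applies to infinitely many [g k] or, where these are large at [a], to their
    reciprocals. The radius [r / 64] makes room for the successive shrinkings. *)
Lemma montel01 (g : nat -> C -> C) a r : 0 < r -> (forall k, holo (disc a r) (g k)) ->
  (forall k z, disc a r z -> g k z != 0 /\ g k z != 1) ->
  exists2 s, subsq s & (exists h, ucvg (disc a (r / 64)) (g \o s) h) \/ ucvg_infty (disc a (r / 64)) (g \o s).
Proof.
move=> r0 hg g01; have [K K1 hK] := schottky_le1.
have r4 : 0 < r / 4 by rewrite divr_gt0.
have sub4 : cdisc a (r / 4) `<=` disc a (r / 2) by apply: le_cdisc_disc; lra.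
have sub2 : disc a (r / 2) `<=` disc a r by apply: sub_disc; lra.
have sub44 := subset_trans sub4 sub2.
have sub8 : disc a (r / 64) `<=` cdisc a (r / 4 / 2) by move=> w; rewrite /disc /cdisc /=; lra.
have cases k : cabs (g k a) <= 1 \/ cabs (g k a)^-1 <= 1.
  have [h|h] := leP (cabs (g k a)) 1; [by left|right].
  by rewrite cabsV invf_le1 ?(lt_trans ltr01 h) // ltW.
have [s hs [sP|sQ]] := frequently_or cases.
- have [|t ht [h hh]] := @montel_bounded R (g \o s) a (r / 4) K r4 (fun k => holo_sub sub44 (hg (s k))).
    by move=> k w /sub4 dw; exact: (hK _ a r r0 (hg (s k)) (g01 (s k)) (sP k) w dw).
  exists (s \o t); first exact: subsq_comp.
  by left; exists h; apply: ucvg_sub hh.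
- have g0 k w : disc a r w -> g k w != 0 by move=> /(g01 k)[].
  have hgV k : holo (disc a r) (fun w => (g k w)^-1) by apply: holoV => // w; exact: g0.
  have sQ' k : cabs ((g (s k) a)^-1) <= 1 by exact: sQ.
  have [|t ht [h hh]] := @montel_bounded R (fun k w => (g (s k) w)^-1) a (r / 4) K r4 (fun k => holo_sub sub44 (hgV (s k))).
    move=> k w /sub4 dw; have gV z : disc a r z -> (g (s k) z)^-1 != 0 /\ (g (s k) z)^-1 != 1.
      by move=> dz; have [z0 z1] := g01 (s k) z dz; rewrite invr_eq0 invr_eq1.
    exact: (hK _ a r r0 (hgV (s k)) gV (sQ' k) w dw).
  have st := subsq_comp hs ht.
  exists (s \o t) => //.
  have ucv : ucvg (disc a (r / 8)) (fun k w => (g ((s \o t) k) w)^-1) h.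
    by apply: ucvg_sub hh => w; rewrite /disc /cdisc /=; lra.
  have hgs k : holo (disc a (r / 8)) (fun w => (g ((s \o t) k) w)^-1).
    by apply: holo_sub (hgV _); apply: sub_disc; lra.
  have hh8 := weierstrass hgs ucv.
  (* A limit of zero-free functions has no zero or vanishes identically. [disc a (r / 32)] lies in
     [disc z (r / 16)] for each of its points [z], so one use of Hurwitz' theorem covers it. *)
  have [hz|hnz] := pselect (forall w, disc a (r / 32) w -> h w = 0).
    right=> M; pose M' := Num.max M 1.
    have M0 : 0 < M' by rewrite lt_max ltr01 orbT.
    have e0 : 0 < M'^-1 by rewrite invr_gt0.
    have [N hN] := ucv _ e0; exists N => k /hN kN w dw.
    have dw8 : disc a (r / 8) w by apply: sub_disc dw; lra.
    have := kN w dw8; rewrite hz ?subr0; last by apply: sub_disc dw; lra.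
    rewrite cabsV ltf_pV2 ?posrE ?cabs_gt0 //; first by apply: le_lt_trans; rewrite le_max lexx.
    by apply: g0; apply: sub_disc dw; lra.
  left; exists (fun w => (h w)^-1).
  have h0 z : disc a (r / 32) z -> h z != 0.
    move=> dz; apply/eqP => hz0; apply: hnz.
    have subz : disc z (r / 16) `<=` disc a (r / 8).
      by move=> w; move: dz; rewrite /disc /=; have := cabs_tri w z a; lra.
    have const w : disc z (r / 16) w -> h w = h z.
      move=> dw; apply: contrapT => hw.
      have [|N hN] := hurwitz (fun k => holo_sub subz (hgs k)) (ucvg_sub subz ucv).
        by exists w => //; apply/eqP.
      have [x dx] := hN N (leqnn N); rewrite hz0 => /eqP; rewrite invr_eq0; apply/negP; apply: g0.
      by apply: sub_disc (subz _ dx); lra.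
    move=> w dw; rewrite const // /disc /=; move: dz dw; rewrite /disc /= => dz dw.
    by have := cabs_tri w a z; rewrite (cabsB a z); lra.
  have sub64 : cdisc a (r / 64) `<=` disc a (r / 32) by apply: le_cdisc_disc; lra.
  have sub32 : disc a (r / 32) `<=` disc a (r / 8) by apply: sub_disc; lra.
  have [M M0 hM] := holo_bounded (holo_sub sub64 (holoV (holo_sub sub32 hh8) h0)).
  have d64 := @disc_cdisc R a (r / 64).
  apply: (@ucvg_inv _ _ _ M).
  + by move=> w /d64/sub64/h0.
  + by move=> w /d64/hM.
  + by move=> k w dw; apply: g0; apply: sub_disc dw; lra.
  + by apply: ucvg_sub ucv; apply: sub_disc; lra.
Qed.

Lemma montel (g : nat -> C -> C) u v a r : u != v -> 0 < r -> (forall k, holo (disc a r) (g k)) ->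
  (forall k z, disc a r z -> g k z != u /\ g k z != v) ->
  exists2 s, subsq s & (exists h, ucvg (disc a (r / 64)) (g \o s) h) \/ ucvg_infty (disc a (r / 64)) (g \o s).
Proof.
move=> uv r0 hg guv; have vu : v - u != 0 by rewrite subr_eq0 eq_sym.
have vu0 : 0 < cabs (v - u) by rewrite cabs_gt0.
pose G k z := (g k z - u) / (v - u).
have GE k z : g k z = G k z * (v - u) + u by rewrite /G; field.
have [|k z dz|s hs hG] := @montel01 G a r r0.
- by move=> k; apply: holoM; [apply: holoB => //|]; exact: holo_const.
- have [z1 z2] := guv k z dz; split; first by rewrite mulf_neq0 ?invr_eq0 // subr_eq0.
  apply/eqP => G1; move: z2; rewrite GE G1 mul1r subrK eqxx //.
exists s => //; case: hG => [[h hh]|hi]; [left|right].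
  exists (fun z => h z * (v - u) + u) => e e0.
  have e1 : 0 < e / cabs (v - u) by rewrite divr_gt0.
  have [N hN] := hh _ e1; exists N => k /hN kN w dw.
  rewrite /= GE; have -> : G (s k) w * (v - u) + u - (h w * (v - u) + u) = (G (s k) w - h w) * (v - u) by ring.
  by rewrite cabsM -ltr_pdivlMr //; exact: kN.
move=> M; have [N hN] := hi ((M + cabs u) / cabs (v - u)); exists N => k /hN kN w dw.
have := kN w dw; rewrite ltr_pdivrMr // -cabsM /= => h.
have := cabs_sub_ge (G (s k) w * (v - u)) (- u); rewrite opprK cabsN -GE; lra.
Qed.

(** Schottky's constant does not depend on the radius, so [f], normalised to omit 0 and 1 and
    inverted if large at 0, is bounded; growth of order 0 makes it constant. *)
Lemma picard f u v : u != v -> holo setT f -> (forall z, f z != u /\ f z != v) -> forall z, f z = f 0.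
Proof.
move=> uv hf fuv; have vu : v - u != 0 by rewrite subr_eq0 eq_sym.
have core g : holo setT g -> (forall z, g z != 0 /\ g z != 1) -> cabs (g 0) <= 1 -> forall z, g z = g 0.
  move=> hg g01 g0; have [K K1 hK] := schottky_le1.
  have bnd z : cabs (g z) <= K.
    have zz := cabs_ge0 z.
    apply: (hK g 0 (2 * cabs z + 2) _ (holo_sub (@subsetT _ _) hg)) => //; first by lra.
    by rewrite /disc /= subr0; lra.
  have [|p hp] := @entire_poly_growth R g 0 K 0 hg; first by move=> z _; rewrite expr0 mulr1.
  have sp : size p == 1%N.
    apply/negPn/negP => /closed_rootP[x]; rewrite /root -hp; apply/negP; exact: (g01 x).1.
  have [c c0 pc] : exists2 c, c != 0 & p = c%:P by apply/size_poly1P.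
  by move=> z; rewrite !hp pc !hornerC.
pose G z := (f z - u) / (v - u).
have hG : holo setT G by apply: holoM; [apply: holoB => //|]; exact: holo_const.
have GE z : f z = G z * (v - u) + u by rewrite /G; field.
have G01 z : G z != 0 /\ G z != 1.
  have [z1 z2] := fuv z; split; first by rewrite mulf_neq0 ?invr_eq0 // subr_eq0.
  by apply/eqP => G1; move: z2; rewrite GE G1 mul1r subrK eqxx.
suff GG z : G z = G 0 by move=> z; rewrite !GE GG.
have [h|h] := leP (cabs (G 0)) 1; first exact: core.
apply: invr_inj; apply: (core (fun z => (G z)^-1)).
- by apply: holoV => // w _; exact: (G01 w).1.
- by move=> w; have [w0 w1] := G01 w; rewrite invr_eq0 invr_eq1.
- by rewrite cabsV invf_le1 ?(lt_trans ltr01 h) // ltW.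
Qed.

End BigMontel.

(** * Discs and the topology of the plane *)

Section Topology.
Variable R : realType.
Notation C := R[i].
Implicit Types (a z w : C) (r s M : R) (A B K : set C).

Lemma lt0_real (e : C) : 0 < e -> exists2 r : R, 0 < r & e = r%:C.
Proof.
by rewrite ltcE /= => /andP[/eqP i0 r0]; exists (Re e) => //; rewrite [LHS]complexE i0 mulr0 addr0.
Qed.

Lemma norm_ltE (z : C) (r : R) : (`|z| < r%:C) = (cabs z < r).
Proof. by rewrite cabsE ltcR. Qed.

Lemma nbhs_discP z A : nbhs z A <-> exists2 r : R, 0 < r & disc z r `<=` A.
Proof.
rewrite nbhs_ballP; split=> [[e /= e0 h]|[r r0 h]].
  have [r r0 er] := lt0_real e0; exists r => // w wz; apply: h.
  by rewrite /ball /= er norm_ltE cabsB.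
exists r%:C => /=; first by rewrite ltcR.
by move=> w; rewrite /ball /= norm_ltE cabsB => wz; apply: h.
Qed.

Lemma open_discP A : open A <-> forall z, A z -> exists2 r : R, 0 < r & disc z r `<=` A.
Proof.
rewrite openE; split=> h z Az; first by apply/nbhs_discP; exact: h.
by apply/nbhs_discP; exact: h.
Qed.

Lemma open_disc a r : open (disc a r).
Proof. by apply/open_discP => z /disc_inner[s s0 hs]; exists s. Qed.

Lemma closed_cdisc a r : closed (cdisc a r).
Proof.
rewrite -openC; apply/open_discP => z; rewrite /setC /cdisc /= => /negP; rewrite -ltNge => h.
exists (cabs (z - a) - r); first by rewrite subr_gt0.
move=> w; rewrite /disc /= => wz; apply/negP; rewrite -ltNge.
have := cabs_tri z w a; rewrite (cabsB z w); lra.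
Qed.

Lemma continuous_ctn (f : C -> C) : (forall z, ctn setT f z) -> continuous f.
Proof.
move=> hf z A /= /nbhs_discP[e e0 he]; have [s s0 hs] := hf z e e0.
by apply/nbhs_discP; exists s => // w ws; apply: he; exact: hs.
Qed.

(** Compactness comes from a real square, of whose image in the plane the disc is a closed
    subset. *)
Lemma compact_cdisc a r : compact (cdisc a r).
Proof.
pose f (p : R * R) : C := p.1 +i* p.2.
have cf : continuous f.
  move=> [x y] A /= /nbhs_discP[e e0 he]; have e2 : 0 < e / 2 by lra.
  exists (ball x (e / 2), ball y (e / 2)); first by split; exact: nbhsx_ballx.
  move=> [u v] [/= bu bv]; apply: he; rewrite /disc /=.
  apply: le_lt_trans (cabs_le_ReIm _) _ => /=.
  by move: bu bv; rewrite /ball /= ![`| _ - u|]distrC ![`| _ - v|]distrC; lra.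
pose M := cabs a + r.
have cM : compact (`[- M, M]%classic `*` `[- M, M]%classic : set (R * R)%type).
  by apply: compact_setX; exact: segment_compact.
have cK := continuous_compact (continuous_subspaceT cf) cM.
apply: (subclosed_compact _ cK); first exact: closed_cdisc.
move=> [x y]; rewrite /cdisc /= => h.
have xy : cabs (x +i* y) <= M by have := cabsD (x +i* y - a) a; rewrite subrK /M; lra.
exists (x, y) => //; split; rewrite /= in_itv /= -ler_norml.
  by apply: le_trans xy; exact: (Re_le_cabs (x +i* y)).
by apply: le_trans xy; exact: (Im_le_cabs (x +i* y)).
Qed.

Lemma nearE_nat (P : nat -> Prop) : (\forall n \near \oo, P n) <-> exists N, forall n, (N <= n)%N -> P n.
Proof. by split=> [[N _ hN]|[N hN]]; exists N => // n Nn; exact: hN. Qed.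

Lemma uniform_ucvg K (g : nat -> C -> C) h : {uniform K, g @ \oo --> h} <-> ucvg K g h.
Proof.
split=> [hg e e0|hg].
  have : nbhs (h : {uniform` K -> C}) [set u | forall y, K y -> ball (h y) e%:C (u y)].
    apply/uniform_nbhs; exists [set xy | ball xy.1 e%:C xy.2]; split => //.
    by apply: (@entourage_ball _ _ (PosNum (_ : 0 < e%:C))); rewrite ltcR.
  move=> /hg /= /nearE_nat[N hN]; exists N => k /hN hk w Kw.
  by have := hk w Kw; rewrite /ball /= norm_ltE cabsB.
move=> P /uniform_nbhs[E [+ EP]]; rewrite -entourage_ballE => -[e /= e0 eE].
have [r r0 er] := lt0_real e0.
have [N hN] := hg _ r0; apply/nearE_nat; exists N => k Nk; apply: EP => w Kw.
by apply: eE; rewrite /ball /= er norm_ltE cabsB; exact: hN.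
Qed.

Lemma compact_cvg_disc a r (V : set C) (g : nat -> C -> C) h : compact_cvg V g h ->
  cdisc a r `<=` V -> ucvg (cdisc a r) g h.
Proof. by move=> hg sub; apply/uniform_ucvg; apply: hg => //; exact: compact_cdisc. Qed.

Lemma compact_cvg_infty_disc a r (V : set C) (g : nat -> C -> C) : compact_cvg_infty V g ->
  cdisc a r `<=` V -> ucvg_infty (cdisc a r) g.
Proof.
move=> hg sub M; have /nearE_nat[N hN] := hg _ (@compact_cdisc a r) sub M.
by exists N => k /hN hk w dw; rewrite -ltcR -cabsE; exact: hk.
Qed.

Lemma entire_holo (f : C -> C) : entire f -> holo setT f.
Proof.
move=> hf z _; have := hf z; rewrite /derivable => /cvg_ex[/= l hl]; exists l.
apply: eps_hasd => // e e0.
have eC : (0 : C) < e%:C by rewrite ltcR.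
move/cvgrPdist_lt: hl => /(_ _ eC).
rewrite near_withinE => /nbhs_discP[s s0 hs]; exists s => // w _ ws.
have [->|wz] := eqVneq w z; first by rewrite !subrr mul0r subrr cabs0 mulr0.
have wz0 : w - z != 0 by rewrite subr_eq0.
have := hs (w - z); rewrite /disc /= subr0 => /(_ ws wz0).
rewrite cabsE ltcR (_ : (w - z) *: _ + z = w) => [h|]; last by rewrite -[X in X + _]/((w - z) * 1) mulr1 subrK.
have -> : f w - f z - (w - z) * l = - ((l - (w - z)^-1 * (f w - f z)) * (w - z)) by field.
by rewrite cabsN cabsM ler_wpM2r ?cabs_ge0 // ltW.
Qed.

Lemma connected_ind A (P : set C) z : connected A -> A z -> P z ->
  (forall w, A w -> exists2 r : R, 0 < r & forall u v, A u -> A v -> disc w r u -> disc w r v -> P u -> P v) ->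
  A `<=` P.
Proof.
move=> cA Az Pz loc.
(* Unions of discs on which [P] has the truth value [b]. Their traces on [A] are the points with
   that value, so each of the two is relatively open and the other relatively closed. *)
pose Q b := [set w | exists2 x, A x /\ (P x <-> b = true) & exists2 r : R, 0 < r & disc x r w /\ (forall y, A y -> disc x r y -> (P y <-> b = true))].
have oQ b : open (Q b).
  apply/open_discP => w [x Ax [r r0 [xr hx]]]; have [s s0 hs] := disc_inner xr.
  by exists s => // v vs; exists x => //; exists r => //; split => //; exact: hs.
have inQ w b : A w -> (P w <-> b = true) -> Q b w.
  move=> Aw Pw; exists w => //; have [r r0 hr] := loc w Aw; exists r => //.
  split=> [|y Ay ry]; first exact: disc_center.
  have ww := disc_center w r0.
  by split=> [/(hr _ _ Ay Aw ry ww)/Pw|/Pw/(hr _ _ Aw Ay ww ry)].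
have outQ w b : A w -> Q b w -> (P w <-> b = true).
  by move=> Aw [x _ [r r0 [dw]]]; apply.
have E : A `&` P = A.
  apply: cA; first by exists z.
  - exists (Q true) => //; apply/seteqP; split => w [Aw h]; split => //.
      by apply: inQ.
    by apply/(outQ w true Aw h).
  - exists (~` Q false); first by rewrite closedC.
    apply/seteqP; split => w [Aw h]; split => //.
      by move=> /(outQ w false Aw)[/(_ h)].
    by apply: contrapT => nP; apply: h; apply: inQ => //; split.
by rewrite -E => w [].
Qed.

Lemma connected_segment a z : connected [set a + t%:C * (z - a) | t in `[(0 : R), 1]%classic].
Proof.
apply: connected_continuous_connected; first exact: segment_connected.
apply: continuous_subspaceT => t A /= /nbhs_discP[e e0 he].
have c0 : 0 < cabs (z - a) + 1 by have := cabs_ge0 (z - a); lra.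
apply/nbhs_ballP; exists (e / (cabs (z - a) + 1)) => /=; first by rewrite divr_gt0.
move=> u; rewrite /ball /= => tu; apply: he; rewrite /disc /=.
have -> : a + u%:C * (z - a) - (a + t%:C * (z - a)) = (u - t)%:C * (z - a) by rewrite rmorphB; ring.
rewrite cabsM cabs_real distrC; move: tu; rewrite ltr_pdivlMr // => h.
by apply: le_lt_trans h; rewrite ler_wpM2l // lerDl.
Qed.

Lemma connected_star a A : A a -> (forall z (t : R), A z -> 0 <= t <= 1 -> A (a + t%:C * (z - a))) -> connected A.
Proof.
move=> Aa hA.
have -> : A = \bigcup_(z in A) [set a + t%:C * (z - a) | t in `[(0 : R), 1]%classic].
  apply/seteqP; split=> [z Az|_ [z Az [t t01 <-]]].
    by exists z => //; exists 1; rewrite /= ?in_itv /= ?ler01 ?lexx // mul1r addrC subrK.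
  by apply: hA => //; move: t01; rewrite /= in_itv.
apply: bigcup_connected; last by move=> z _; exact: connected_segment.
by exists a => z Az; exists 0; rewrite /= ?in_itv /= ?ler01 ?lexx // mul0r addr0.
Qed.

Lemma connected_disc a r : connected (disc a r).
Proof.
have [r0|r0] := ltP 0 r; last first.
  rewrite (_ : disc a r = set0); first exact: connected0.
  by apply/seteqP; split => // z; rewrite /disc /=; have := cabs_ge0 (z - a); lra.
apply: (@connected_star a); first exact: disc_center.
by move=> z t dz t01; apply: cdisc_convex => //; rewrite subrr cabs0.
Qed.

Lemma connected_image (f : C -> C) A : holo setT f -> connected A -> connected (f @` A).
Proof.
move=> hf cA; apply: connected_continuous_connected => //; apply: continuous_subspaceT.
by apply: continuous_ctn => z; exact: ctn_holo.
Qed.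

(** The exterior is the exponential image of a half-plane, or of the whole plane if [M = 0]; writing
    this domain with [expR] instead of a logarithm treats both cases together. It is star-shaped
    about [M] because [expR M > M]. *)
Lemma connected_exterior M : 0 <= M -> connected [set w : C | M < cabs w].
Proof.
move=> M0.
have -> : [set w : C | M < cabs w] = (@cexp R) @` [set w | M < expR (Re w)].
  apply/seteqP; split=> [w /= Mw|_ [w /= Mw <-]]; last by rewrite cabs_cexp.
  have w0 : w != 0 by rewrite -cabs_gt0; apply: le_lt_trans Mw.
  by have [v vw] := cexp_surj w0; exists v => //; rewrite /= -cabs_cexp vw.
apply: connected_image; first by move=> z _; exists (cexp z); exact: hasd_cexp.
apply: (@connected_star (M%:C)) => [|z t] /=.
  by apply: lt_le_trans (expR_ge1Dx _); rewrite ltr_pwDl.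
move=> Mz /andP[t0 t1].
have h1 : M < expR M by apply: lt_le_trans (expR_ge1Dx _); rewrite ltr_pwDl.
have E : Re (M%:C + t%:C * (z - M%:C)) = (1 - t) * M + t * Re z by case: z Mz => x y _ /=; ring.
rewrite E; have [h|h] := leP M (Re z).
  by apply: lt_le_trans h1 _; rewrite ler_expR; nra.
by apply: lt_le_trans Mz _; rewrite ler_expR; nra.
Qed.

End Topology.

(** * Iteration on the Fatou set *)

Section Dynamics.
Variable R : realType.
Notation C := R[i].
Variable f : C -> C.
Hypothesis hf : holo setT f.
Implicit Types (a z w : C) (r s M : R).

Lemma holo_iter n : holo setT (iter n f).
Proof.
elim: n => [|n IH]; first exact: holo_id.
by apply: (@holo_comp _ _ setT (iter n f) f).
Qed.

Lemma ctn_iter n D z : ctn D (iter n f) z.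
Proof. exact: ctn_holo (holo_iter n). Qed.

(** Sequences of iterates are given by their indices, in any order and with repetitions; convergence
    is uniform on the disc itself, which costs only a smaller radius. *)
Definition normal_at z r := forall n_ : nat -> nat, exists2 s, subsq s &
  (exists h, ucvg (disc z r) (fun k => iter (n_ (s k)) f) h) \/
  ucvg_infty (disc z r) (fun k => iter (n_ (s k)) f).

Lemma normal_at_sub z r w s : disc w s `<=` disc z r -> normal_at z r -> normal_at w s.
Proof.
move=> sub h n_; have [t ht hn] := h n_; exists t => //.
case: hn => [[l hl]|hi]; [left; exists l; exact: ucvg_sub hl|right; exact: ucvg_infty_sub hi].
Qed.

Lemma fatouP z : fatou_set f z <-> exists2 r : R, 0 < r & normal_at z r.
Proof.
split=> [[V [oV cV Vz hV]]|[r r0 hr]].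
  have [r r0 hr] := (proj1 (open_discP V) oV) z Vz.
  have sub : cdisc z (r / 2) `<=` V.
    by apply: subset_trans hr; apply: le_cdisc_disc; lra.
  have sub2 := @disc_cdisc R z (r / 2).
  exists (r / 2); first by rewrite divr_gt0.
  move=> n_; have [|s [/increasing_seqP hs hc]] := hV (fun k => iter (n_ k) f).
    by move=> k; exists (n_ k).
  exists s => //; case: hc => [[h hh]|hi]; [left; exists h|right].
    exact: ucvg_sub sub2 (compact_cvg_disc hh sub).
  exact: ucvg_infty_sub sub2 (compact_cvg_infty_disc hi sub).
exists (disc z r); split; [exact: open_disc|exact: connected_disc|exact: disc_center|].
move=> g hg; have /choice[n_ hn] : forall k, exists n, iter n f = g k.
  by move=> k; have [n _ <-] := hg k; exists n.
have [s hs hc] := hr n_; exists s; split; first by apply/increasing_seqP.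
have E : g \o s = fun k => iter (n_ (s k)) f by apply/funext => k /=; rewrite hn.
rewrite E; case: hc => [[h hh]|hi]; [left; exists h|right].
  by move=> K _ KV; apply/uniform_ucvg; exact: ucvg_sub hh.
move=> K _ KV M; have [N hN] := hi M; apply/nearE_nat; exists N => k /hN kN w /KV/kN.
by rewrite cabsE ltcR.
Qed.

Lemma fatou_open z : fatou_set f z -> exists2 r : R, 0 < r & disc z r `<=` fatou_set f /\ normal_at z r.
Proof.
move=> /fatouP[r r0 hr]; exists r => //; split=> // w /disc_inner[s s0 hs].
by apply/fatouP; exists s => //; exact: normal_at_sub hr.
Qed.

Lemma escP z : escaping_set f z <-> forall M : R, exists N, forall n, (N <= n)%N -> M < cabs (iter n f z).
Proof.
split=> h M; first by have /nearE_nat[N hN] := h M; exists N => n /hN; rewrite cabsE ltcR.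
by have [N hN] := h M; apply/nearE_nat; exists N => n /hN; rewrite cabsE ltcR.
Qed.

Lemma bddP z : bounded_orbit_set f z <-> exists M : R, forall n, cabs (iter n f z) <= M.
Proof.
split=> [[M _ hM]|[M hM]]; first by exists M => n; have := hM n; rewrite cabsE lecR.
exists (Num.max M 1) => [|n]; first by rewrite lt_max ltr01 orbT.
by rewrite cabsE lecR le_max hM.
Qed.

Lemma not_esc z : ~ escaping_set f z ->
  exists M : R, forall N, exists2 n, (N <= n)%N & cabs (iter n f z) <= M.
Proof.
move=> ne; apply: contrapT => h; apply: ne; apply/escP => M; apply: contrapT => h2; apply: h.
exists M => N; apply: contrapT => h3; apply: h2; exists N => n Nn; rewrite ltNge; apply/negP => le.
by apply: h3; exists n.
Qed.

Lemma not_bdd z : ~ bounded_orbit_set f z -> forall M : R, exists n, M < cabs (iter n f z).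
Proof.
move=> nb M; apply: contrapT => h; apply: nb; apply/bddP; exists M => n; rewrite leNgt; apply/negP => h2.
by apply: h; exists n.
Qed.

Lemma bungeeP z : bungee_set f z <-> ~ escaping_set f z /\ ~ bounded_orbit_set f z.
Proof. by rewrite /bungee_set setCU; split=> -[]. Qed.

(** Along times at which the orbit of [w'] stays bounded while that of [w] escapes, neither a finite
    nor an infinite limit function is possible. *)
Lemma normal_at_esc z r w w' : normal_at z r -> disc z r w -> disc z r w' ->
  escaping_set f w -> escaping_set f w'.
Proof.
move=> hr dw dw' /escP he; apply: contrapT => /not_esc[M hM].
have [n_ hn nM] := @subsq_extract (fun _ n => cabs (iter n f w') <= M) (fun _ N => hM N).
have [s hs [[h hh]|hi]] := hr n_.
  have [N1 hN1] := ucvg_pt hh dw ltr01; have [N2 hN2] := he (cabs (h w) + 1).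
  pose k := maxn N1 N2; have := hN1 k (leq_maxl _ _).
  have : (N2 <= n_ (s k))%N.
    by apply: leq_trans (leq_maxr N1 _) _; apply: leq_trans (subsq_ge hs _) (subsq_ge hn _).
  move=> /hN2; have := cabs_sub_ge (iter (n_ (s k)) f w) (h w); lra.
have [N hN] := hi M; have := hN N (leqnn N) _ dw'; rewrite ltNge; have := nM (s N); by move=> ->.
Qed.

Lemma normal_at_bdd z r w w' : normal_at z r -> disc z r w -> disc z r w' ->
  bounded_orbit_set f w -> bounded_orbit_set f w'.
Proof.
move=> hr dw dw' /bddP[M hM]; apply: contrapT => /not_bdd nb.
have /choice[n_ hn] : forall k : nat, exists n, k%:R < cabs (iter n f w') by move=> k; exact: nb.
have [s hs [[h hh]|hi]] := hr n_.
  have [N1 hN1] := ucvg_pt hh dw' ltr01.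
  pose k := maxn N1 (Num.truncn (cabs (h w') + 1)).+1; have := hN1 k (leq_maxl _ _).
  have : cabs (h w') + 1 < (s k)%:R.
    apply: lt_le_trans (truncnS_gt _) _; rewrite ler_nat.
    by apply: leq_trans (leq_maxr N1 _) (subsq_ge hs _).
  have := hn (s k); have := cabs_sub_ge (iter (n_ (s k)) f w') (h w'); lra.
by have [N hN] := hi M; have := hN N (leqnn N) _ dw; rewrite ltNge hM.
Qed.

Lemma normal_at_bungee z r w w' : normal_at z r -> disc z r w -> disc z r w' ->
  bungee_set f w -> bungee_set f w'.
Proof.
move=> hr dw dw' /bungeeP[h1 h2]; apply/bungeeP; split=> h.
  by apply: h1; exact: normal_at_esc hr dw' dw h.
by apply: h2; exact: normal_at_bdd hr dw' dw h.
Qed.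

Lemma fatou_connected_ind (A P : set C) z : connected A -> A `<=` fatou_set f -> A z -> P z ->
  (forall x r u v, normal_at x r -> disc x r u -> disc x r v -> P u -> P v) -> A `<=` P.
Proof.
move=> cA AF Az Pz hP; apply: (connected_ind cA Az Pz) => w /AF/fatouP[r r0 hr].
by exists r => // u v _ _; exact: hP.
Qed.

Lemma esc_f z : escaping_set f (f z) <-> escaping_set f z.
Proof.
split=> /escP h; apply/escP => M; have [N hN] := h M.
  by exists N.+1 => -[//|n] /hN; rewrite -iterSr.
by exists N => n Nn; rewrite -iterSr; apply: hN; exact: leqW.
Qed.

Lemma bdd_f z : bounded_orbit_set f (f z) <-> bounded_orbit_set f z.
Proof.
split=> /bddP[M hM]; apply/bddP.
  exists (Num.max M (cabs z)) => -[|n]; first by rewrite le_max lexx orbT.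
  by rewrite iterSr le_max hM.
by exists M => n; rewrite -iterSr.
Qed.

Lemma esc_iter n z : escaping_set f (iter n f z) <-> escaping_set f z.
Proof. by elim: n => //= n IH; rewrite esc_f. Qed.

Lemma bdd_iter n z : bounded_orbit_set f (iter n f z) <-> bounded_orbit_set f z.
Proof. by elim: n => //= n IH; rewrite bdd_f. Qed.

Lemma bungee_iter n z : bungee_set f (iter n f z) <-> bungee_set f z.
Proof. by rewrite !bungeeP esc_iter bdd_iter. Qed.

(** Bridges the at most [p] steps between an arbitrary time and a multiple of the period. *)
Lemma iter_bounded (M : R) p : exists B, forall w j, cabs w <= M -> (j <= p)%N -> cabs (iter j f w) <= B.
Proof.
elim: p => [|p [B hB]].
  by exists M => w j wM; rewrite leqn0 => /eqP ->.
have [B' _ hB'] := holo_bounded (holo_sub (@subsetT _ _) (holo_iter p.+1) : holo (cdisc 0 M) _).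
exists (Num.max B B') => w j wM; rewrite leq_eqVlt le_max => /orP[/eqP ->|jp].
  by rewrite hB' ?orbT // /cdisc /= subr0.
by rewrite hB.
Qed.

Hypothesis nonconst : ~ forall z, f z = f 0.

Lemma f_nonconst a : ~ forall z, f z = f a.
Proof. by move=> h; apply: nonconst => z; rewrite h -(h 0). Qed.

(** By the open mapping theorem the image of a disc of normality contains a disc about [f z]. The
    section [sg] may be discontinuous, as only uniform convergence is transported. *)
Lemma fatou_fwd z : fatou_set f z -> fatou_set f (f z).
Proof.
move=> /fatouP[r r0 hr].
have [e e0 he] := open_mapping (holo_sub (@subsetT _ _) hf) (entire_nonconst hf r0 (@f_nonconst z)).
have /choice[sg hsg] : forall b, exists x, disc (f z) e b -> disc z r x /\ f x = b.
  move=> b; have [/he[x dx fx]|nb] := pselect (disc (f z) e b); first by exists x.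
  by exists 0.
apply/fatouP; exists e => // n_; have [s hs hc] := hr (fun k => (n_ k).+1).
have E k b : disc (f z) e b -> iter (n_ (s k)) f b = iter (n_ (s k)).+1 f (sg b).
  by move=> /hsg[_ sb]; rewrite iterSr sb.
exists s => //; case: hc => [[h hh]|hi]; [left|right].
  exists (h \o sg) => x x0; have [N hN] := hh _ x0; exists N => k Nk b db.
  by rewrite E //; apply: hN => //; have [] := hsg b db.
move=> M; have [N hN] := hi M; exists N => k Nk b db; rewrite E //; apply: hN => //.
by have [] := hsg b db.
Qed.

Lemma fatou_bwd z : fatou_set f (f z) -> fatou_set f z.
Proof.
move=> /fatouP[r r0 hr].
have [d /hasd_ctn /(_ _ r0)[e e0 he]] := @hf z I.
apply/fatouP; exists e => // n_.
(* The identity is not an iterate composed with [f], so index 0 is treated apart. *)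
have cases k : n_ k = 0%N \/ n_ k = (n_ k).-1.+1 by case: (n_ k); [left|right].
have [s hs [h0|hS]] := frequently_or cases.
  exists s => //; left; exists id => x x0; exists 0%N => k _ w _.
  by rewrite h0 subrr cabs0.
have [t ht hc] := hr (fun k => (n_ (s k)).-1).
exists (s \o t); first exact: subsq_comp.
have E k w : iter (n_ ((s \o t) k)) f w = iter (n_ (s (t k))).-1 f (f w) by rewrite /= hS iterSr.
have sub w : disc z e w -> disc (f z) r (f w) by move=> dw; exact: he.
case: hc => [[h hh]|hi]; [left|right].
  by exists (h \o f) => x /hh[N hN]; exists N => k /hN kN w /sub/kN; rewrite E.
by move=> M; have [N hN] := hi M; exists N => k /hN kN w /sub/kN; rewrite E.
Qed.

Lemma fatou_iter n z : fatou_set f (iter n f z) <-> fatou_set f z.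
Proof.
elim: n => //= n IH; rewrite -IH; split; [exact: fatou_bwd|exact: fatou_fwd].
Qed.

Lemma fatou_component_sub W : fatou_component f W -> W `<=` fatou_set f.
Proof. by move=> [z Fz ->]; exact: connected_component_sub. Qed.

Lemma fatou_component_connected W : fatou_component f W -> connected W.
Proof. by move=> [z Fz ->]; exact: component_connected. Qed.

Lemma fatou_component_max W A x : fatou_component f W -> W x -> A x -> connected A ->
  A `<=` fatou_set f -> A `<=` W.
Proof.
move=> [z Fz ->] Wx Ax cA AF; rewrite (same_connected_component Wx).
exact: connected_component_max.
Qed.

Lemma fatou_component_open W w : fatou_component f W -> W w ->
  exists2 r : R, 0 < r & disc w r `<=` W /\ normal_at w r.
Proof.
move=> hW Ww; have [r r0 [h1 h2]] := fatou_open (fatou_component_sub hW Ww).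
exists r => //; split => //; apply: (fatou_component_max hW Ww) => //; first exact: disc_center.
exact: connected_disc.
Qed.

Lemma bungee_component W : fatou_component f W -> W `&` bungee_set f !=set0 -> W `<=` bungee_set f.
Proof.
move=> hW [z [Wz Bz]].
apply: (fatou_connected_ind (fatou_component_connected hW) (fatou_component_sub hW) Wz Bz).
by move=> x r u v; exact: normal_at_bungee.
Qed.

End Dynamics.

(** * Periodic components in the bungee set are impossible *)

Section Periodic.
Variable R : realType.
Notation C := R[i].
Variable f : C -> C.
Hypothesis hf : holo setT f.
Hypothesis nonconst : ~ forall z, f z = f 0.
Implicit Types (a z w x : C) (r s M e : R).

(** The convergent images exclude an infinite limit, and a finite limit function is continuous at
    [a]; so [a] may replace the points that approach it. *)
Lemma normal_at_eqcont a r (m : nat -> nat) (x : nat -> C) b : 0 < r -> normal_at f a r ->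
  cvgc x a -> cvgc (fun k => iter (m k) f (x k)) b ->
  exists2 s, subsq s & cvgc (fun k => iter (m (s k)) f a) b.
Proof.
move=> r0 hr xa xb; have [s hs hc] := hr m; exists s => //.
have da := disc_center a r0.
have xa' := cvgc_subsq hs xa; have xb' := cvgc_subsq hs xb.
case: hc => [[h hh]|hi]; last first.
  have [N1 h1] := hi (cabs b + 1); have [N2 h2] := xb' _ ltr01; have [N3 h3] := xa' _ r0.
  pose k := maxn N1 (maxn N2 N3).
  have k1 := h1 k (leq_maxl _ _) _ (h3 k (leq_trans (leq_maxr _ _) (leq_maxr _ _))).
  have k2 := h2 k (leq_trans (leq_maxl _ _) (leq_maxr _ _)); rewrite /= in k2.
  have := cabs_sub_ge (iter (m (s k)) f (x (s k))) b; rewrite /= in k1; lra.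
have ch : ctn (disc a r) h a by apply: (ucvg_ctn hh) => // k; exact: ctn_iter.
move=> e e0; have e4 : 0 < e / 4 by lra.
have [N1 h1] := hh _ e4; have [N2 h2] := xb' _ e4; have [d d0 hd] := ch _ e4.
have dr : 0 < Num.min d r by rewrite lt_min d0.
have [N3 h3] := xa' _ dr; exists (maxn N1 (maxn N2 N3)) => k; rewrite !geq_max => /and3P[k1 k2 k3].
have := h3 k k3; rewrite lt_min /= => /andP[xd xr].
have q1 := h1 k k1 a da; have q2 := h1 k k1 _ xr; have q3 := hd _ xr xd; have q4 := h2 k k2.
rewrite /= in q1 q2 q4.
have t1 := cabs_tri (iter (m (s k)) f a) (h a) b.
have t2 := cabs_tri (h a) (h (x (s k))) b.
have t3 := cabs_tri (h (x (s k))) (iter (m (s k)) f (x (s k))) b.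
rewrite (cabsB (h a) (h _)) in t2; rewrite (cabsB (h _) (iter _ _ _)) in t3; lra.
Qed.

Variables (W : set C) (p : nat).
Hypothesis W_comp : fatou_component f W.
Hypothesis p_gt0 : (0 < p)%N.
Hypothesis W_inv : forall z, W z -> W (iter p f z).

Let g := iter p f.

Lemma iter_gE n z : iter n g z = iter (n * p) f z.
Proof. by rewrite iterM. Qed.

Lemma holo_g n : holo setT (iter n g).
Proof.
elim: n => [|n IH]; first exact: holo_id.
by apply: (@holo_comp _ _ setT (iter n g) g) => //; exact: holo_iter.
Qed.

Lemma W_iter n z : W z -> W (iter n g z).
Proof. by move=> Wz; elim: n => //= n; exact: W_inv. Qed.

Hypothesis W_bungee : W `<=` bungee_set f.

Lemma g_unbounded z M N : W z -> exists2 n, (N <= n)%N & M < cabs (iter n g z).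
Proof.
move=> Wz; apply: contrapT => h.
have /bungeeP[_] := W_bungee (W_iter N Wz); apply; apply/bddP.
have [B hB] := iter_bounded hf M p; exists B => n.
rewrite (divn_eq n p) addnC iterD -iter_gE; apply: hB; last by rewrite ltnW // ltn_pmod.
rewrite leNgt; apply/negP => h2; apply: h; exists (n %/ p + N)%N; first exact: leq_addl.
by rewrite iterD.
Qed.

Lemma next_multiple n : (p - n %% p + n = (n %/ p).+1 * p)%N.
Proof.
have := ltn_pmod n p_gt0; move: (divn_eq n p).
move: (n %/ p)%N (n %% p)%N => q r -> rp.
by rewrite mulSn addnCA addnC subnK // ltnW.
Qed.

(** A time at which the orbit under [f] is bounded is moved forward to the next multiple of [p],
    where the orbit is still controlled. *)
Lemma g_recurrent_bounded z : W z -> exists B : R, forall N, exists2 n, (N <= n)%N & cabs (iter n g z) <= B.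
Proof.
move=> Wz; have /bungeeP[/not_esc[M hM] _] := W_bungee Wz.
have [B hB] := iter_bounded hf M p; exists B => N.
have [n Nn nM] := hM (N * p)%N; exists (n %/ p).+1.
  by rewrite leqW // leq_divRL.
rewrite iter_gE -next_multiple iterD; apply: hB nM _; exact: leq_subr.
Qed.

Lemma limit_recurrent (n_ : nat -> nat) w a : W a -> subsq n_ -> cvgc (fun k => iter (n_ k) g w) a ->
  exists2 m : nat -> nat, (forall k, (k <= m k)%N) & cvgc (fun k => iter (m k) g a) a.
Proof.
move=> Wa hn hw; have [r r0 [_ hr]] := fatou_component_open W_comp Wa.
(* The difference of two visits near [a] is a return time. Jumping to the index [n_ k + k] makes it
   at least [k]. *)
pose l k := (n_ k + k)%N; pose m k := (n_ (l k) - n_ k)%N.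
have lk k : (n_ k <= n_ (l k))%N by apply: leq_trans (subsq_ge hn _); rewrite leq_addr.
have mk k : (k <= m k)%N by rewrite leq_subRL //; apply: (subsq_ge hn).
have sl : subsq l by move=> k; rewrite /l addnS ltnS leq_add2r ltnW.
have hb : cvgc (fun k => iter (m k * p)%N f (iter (n_ k) g w)) a.
  move=> e e0; have [K hK] := cvgc_subsq sl hw e0; exists K => k /hK.
  by rewrite -iter_gE -iterD subnK.
have [s hs hsa] := normal_at_eqcont r0 hr hw hb.
exists (m \o s) => [k|e /hsa[K hK]]; first exact: leq_trans (subsq_ge hs k) (mk _).
by exists K => k /hK; rewrite iter_gE.
Qed.

Section Recurrent.
Variables (a : C) (m : nat -> nat).
Hypothesis Wa : W a.
Hypothesis m_ge : forall k, (k <= m k)%N.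
Hypothesis ma : cvgc (fun k => iter (m k) g a) a.

(** The closure of the orbit of [a] under [g]: [q] need not tend to infinity, so the orbit itself is
    included. *)
Let X := [set x | exists q : nat -> nat, cvgc (fun k => iter (q k) g a) x].

(** If [iter (q k) g a] approaches [x], the remaining time from [q k] to a later return of [a]
    carries these points back to [a], hence also [x] along a subsequence. [k.+1] keeps this time
    positive. *)
Lemma orbit_closure_return x e : X x -> W x -> 0 < e -> exists2 n, (0 < n)%N & cabs (iter n g x - a) < e.
Proof.
move=> [q hq] Wx e0; have [r r0 [_ hr]] := fatou_component_open W_comp Wx.
pose l k := (q k + k.+1)%N; pose u k := (m (l k) - q k)%N.
have lk k : (q k <= m (l k))%N by apply: leq_trans (m_ge _); exact: leq_addr.
have uk k : (k < u k)%N by rewrite ltn_subRL; apply: leq_trans (m_ge _); rewrite /l addnS.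
have hb : cvgc (fun k => iter (u k * p)%N f (iter (q k) g a)) a.
  move=> d d0; have [K hK] := ma d0; exists K => k Kk.
  rewrite -iter_gE -iterD subnK //; apply: hK; apply: leq_trans Kk _.
  by rewrite /l addnS; apply: leqW; exact: leq_addl.
have [s hs hsa] := normal_at_eqcont r0 hr hq hb.
have [K hK] := hsa _ e0; exists (u (s K)); first by apply: leq_ltn_trans (uk _).
by rewrite iter_gE; exact: hK.
Qed.

Lemma orbit_closure_closed (x : nat -> C) l : (forall k, X (x k)) -> cvgc x l -> X l.
Proof.
move=> hx xl.
have /choice[q hq] : forall k, exists q, cabs (iter q g a - x k) < (2 ^+ k)^-1.
  move=> k; have [q0 hq0] := hx k; have e0 : 0 < (2 ^+ k)^-1 :> R by rewrite invr_gt0 exprn_gt0.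
  by have [N hN] := hq0 _ e0; exists (q0 N); exact: hN.
exists q => e e0; have e2 : 0 < e / 2 by lra.
have [N1 h1] := xl _ e2; have [N2 h2] := pow2_lt 0 e2; exists (maxn N1 N2) => k.
rewrite geq_max => /andP[k1 k2].
have := h1 k k1; have := h2 k k2; have := hq k; have := cabs_tri (iter (q k) g a) (x k) l; lra.
Qed.

Lemma orbit_closure_g n x : X x -> X (iter n g x).
Proof.
move=> [q hq]; exists (fun k => n + q k)%N.
have := ctn_cvgc (ctn_holo setT _ (holo_g n)) (fun _ => I) hq.
by move=> h e /h[N hN]; exists N => k /hN; rewrite /= iterD.
Qed.

(* Returns to a compact neighbourhood of [a] happen within a bounded time, so
   the orbit of [a] is bounded. *)
Lemma recurrent_contradiction : False.
Proof.
have [r r0 [rW _]] := fatou_component_open W_comp Wa.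
pose e := r / 2; have e0 : 0 < e by rewrite divr_gt0.
have BW : cdisc a e `<=` W by apply: subset_trans rW; apply: le_cdisc_disc; rewrite /e; lra.
(* Otherwise points [x k] without return up to time [k] accumulate at some [l], which returns at a
   fixed time [n]; by continuity so do the nearby [x k]. *)
have [T hT] : exists T, forall x, X x -> cdisc a e x -> exists2 n, (0 < n <= T)%N & cdisc a e (iter n g x).
  apply: contrapT => bad.
  have /choice[x hx] : forall k : nat, exists x, [/\ X x, cdisc a e x & forall n, (0 < n <= k)%N -> ~ cdisc a e (iter n g x)].
    move=> k; apply: contrapT => h; apply: bad; exists k => x Xx dx; apply: contrapT => h2; apply: h.
    exists x; split => // n nk dn; apply: h2; by exists n.
  have [s hs [l dl hl]] := @cdisc_subsq R a e x (fun k => let: And3 _ h _ := hx k in h).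
  have Xl : X l by apply: (orbit_closure_closed _ hl) => k /=; have [] := hx (s k).
  have [n n0 nl] := orbit_closure_return Xl (BW _ dl) e0.
  have d0 : 0 < e - cabs (iter n g l - a) by lra.
  have [N hN] := ctn_cvgc (ctn_holo setT _ (holo_g n)) (fun _ => I) hl d0.
  pose k := maxn N n; have := hN k (leq_maxl _ _); have [_ _ hk] := hx (s k) => h.
  apply: (hk n); first by rewrite n0 /=; apply: leq_trans (leq_maxr N n) (subsq_ge hs _).
  by rewrite /cdisc /=; rewrite /= in h; have := cabs_tri (iter n g (x (s k))) (iter n g l) a; lra.
(* [x] is a visit to the disc and [j] the time elapsed since; once [j.+1] reaches a return time [t]
   of [x], the visit is replaced by [iter t g x]. *)
have key n : exists j x, [/\ (j <= T)%N, X x, cdisc a e x & iter n g a = iter j g x].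
  elim: n => [|n [j [x [jT Xx dx E]]]].
    exists 0%N, a; split => //; last by rewrite /cdisc /= subrr cabs0 ltW.
    by exists (fun=> 0%N) => d d0; exists 0%N => k _; rewrite /= subrr cabs0.
  have [t /andP[t0 tT] dt] := hT x Xx dx.
  have [jt|tj] := ltnP j.+1 t.
    by exists j.+1, x; split => //; [apply: leq_trans tT; exact: ltnW|rewrite !iterS E].
  exists (j.+1 - t)%N, (iter t g x); split => //.
  - by rewrite leq_subLR; apply: (leq_trans (n := T.+1)); rewrite ?ltnS // -addn1 addnC leq_add2r.
  - exact: orbit_closure_g.
  - by rewrite -iterD subnK // iterS E -iterS.
have [B hB] := iter_bounded hf (cabs a + e) (T * p).
have [n _ hn] := g_unbounded B 0 Wa.
have [j [x [jT Xx dx E]]] := key n.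
move: hn; rewrite E iter_gE ltNge => /negP; apply; apply: hB; last by rewrite leq_mul2r jT orbT.
by move: dx; rewrite /cdisc /=; have := cabsD (x - a) a; rewrite subrK; lra.
Qed.

End Recurrent.

Lemma no_limit_in_W (n_ : nat -> nat) w a : W a -> subsq n_ -> cvgc (fun k => iter (n_ k) g w) a -> False.
Proof.
move=> Wa hn hw; have [m m1 m2] := limit_recurrent Wa hn hw.
exact: recurrent_contradiction Wa m1 m2.
Qed.

(* A finite limit function of the iterates on [W] takes values outside [W],
   hence is constant by Hurwitz' theorem. *)
Lemma limit_constant (n_ : nat -> nat) z a : W z -> subsq n_ -> cvgc (fun k => iter (n_ k) g z) a ->
  forall w, W w -> cvgc (fun k => iter (n_ k) g w) a.
Proof.
move=> Wz hn hz.
apply: (connected_ind (P := fun w => cvgc (fun k => iter (n_ k) g w) a) (fatou_component_connected W_comp) Wz hz).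
move=> w Ww; have [r r0 [rW hr]] := fatou_component_open W_comp Ww; exists r => // u v _ _ du dv hu.
apply: contrapT => nv.
have [e e0 he] : exists2 e : R, 0 < e & forall N, exists2 k, (N <= k)%N & e <= cabs (iter (n_ k) g v - a).
  apply: contrapT => h; apply: nv => e e0; apply: contrapT => h2; apply: h; exists e => // N.
  apply: contrapT => h3; apply: h2; exists N => k Nk; rewrite ltNge; apply/negP => h4; apply: h3.
  by exists k.
have [t ht tP] := @subsq_extract (fun _ k => e <= cabs (iter (n_ k) g v - a)) (fun _ N => he N).
have [s hs hc] := hr (fun k => n_ (t k) * p)%N.
have st := subsq_comp ht hs; have hu' := cvgc_subsq st hu.
case: hc => [[h hh]|hi]; last first.
  have [N1 h1] := hi (cabs a + 1); have [N2 h2] := hu' _ ltr01.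
  have := h1 _ (leq_maxl N1 N2) _ du; have := h2 _ (leq_maxr N1 N2); rewrite /= iter_gE.
  set y := iter _ f u; have := cabs_sub_ge y a; lra.
have hU : h u = a.
  apply: cvgc_unique (ucvg_pt hh du) _ => d /hu'[N hN]; exists N => k /hN; by rewrite /= iter_gE.
have hV : h v <> a.
  move=> hva; have [N hN] := ucvg_pt hh dv e0; have := hN N (leqnn N); have := tP (s N).
  by rewrite iter_gE hva; lra.
have [|N hN] := hurwitz (fun k => holo_sub (@subsetT _ _) (holo_iter hf (n_ (t (s k)) * p))) hh.
  have [huw|huw] := eqVneq (h u) (h w); last by exists u.
  by exists v => //; apply/eqP => hvw; apply: hV; rewrite hvw -huw hU.
have [x dx hx] := hN N (leqnn N).
have Whw : W (h w) by rewrite -hx -iter_gE; apply: W_iter; exact: rW.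
(* By Hurwitz' theorem [h w] is a value of an iterate on the disc, hence in [W], and the orbit of
   [w] accumulates there. *)
apply: (@no_limit_in_W (n_ \o (t \o s)) w (h w) Whw); first exact: subsq_comp.
move=> d d0; have [K hK] := ucvg_pt hh (disc_center w r0) d0; exists K => k /hK.
by rewrite /= iter_gE.
Qed.

(** [z] and [g z] have the same limit [a] by [limit_constant], while continuity gives [g a] for the
    second. *)
Lemma limit_fixed (n_ : nat -> nat) z a : W z -> subsq n_ -> cvgc (fun k => iter (n_ k) g z) a -> g a = a.
Proof.
move=> Wz hn hz; have h1 := limit_constant Wz hn hz (W_iter 1 Wz).
apply: cvgc_unique (_ : cvgc (fun k => g (iter (n_ k) g z)) _) _.
  exact: (ctn_cvgc (ctn_holo setT _ (holo_g 1)) (fun _ => I) hz).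
by move=> e /h1[N hN]; exists N => k /hN; rewrite -iterSr.
Qed.

Lemma periodic_contradiction z : W z -> False.
Proof.
move=> Wz; have [B hB] := g_recurrent_bounded Wz.
have [n_ hn nB] := @subsq_extract (fun _ n => cabs (iter n g z) <= B) (fun _ N => hB N).
have [s hs [a ha]] := @bounded_subsq R (fun k => iter (n_ k) g z) B nB.
have hns := subsq_comp hn hs.
have ga := limit_fixed Wz hns ha.
have hF : holo setT (fun w => g w - w).
  by apply: holoB; [exact: (holo_g 1)|exact: holo_id].
(* Either [g] is the identity, against unboundedness, or no fixed point other than [a] lies within
   [s0] of [a]. *)
have [h0|[s0 /andP[s00 _] hs0]] := zero_dichotomy ltr01 (holo_sub (@subsetT _ _) hF : holo (cdisc a 1) _).
  have gid w : g w = w.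
    by apply/eqP; rewrite -subr_eq0; apply/eqP; exact: (entire_zero hF ltr01 h0).
  have [n _] := g_unbounded (cabs z) 0 Wz.
  by rewrite (_ : iter n g z = z) ?ltxx //; elim: n => //= n ->.
have isol w : g w = w -> 0 < cabs (w - a) <= s0 -> False.
  by move=> gw /hs0[m m0 /(_ w erefl)]; rewrite gw subrr cabs0; lra.
have [d d0 hd] := ctn_holo setT a (holo_g 1) s00.
pose d' := Num.min d s0; have d'0 : 0 < d' by rewrite lt_min d0.
have step w : cabs (w - a) < d' -> cabs (g w - a) < s0.
  by rewrite lt_min => /andP[wd _]; have := hd w I wd; rewrite /= -/g ga.
(* After a visit near [a] the first exit from the disc of radius [d'] is taken; its predecessor is
   still inside, so by [step] the exit stays within [s0]. *)
have annulus N : exists2 n, (N <= n)%N & d' <= cabs (iter n g z - a) <= s0.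
  have [K hK] := ha _ d'0; pose n1 := n_ (s (maxn K N)).
  have n1N : (N <= n1)%N.
    by apply: leq_trans (leq_maxr K N) _; apply: leq_trans (subsq_ge hs _) (subsq_ge hn _).
  have n1d : cabs (iter n1 g z - a) < d' by apply: hK; exact: leq_maxl.
  have ex : exists j, d' <= cabs (iter (j + n1) g z - a).
    have [n nn hn2] := g_unbounded (cabs a + d') n1 Wz; exists (n - n1)%N; rewrite subnK //.
    have := cabs_sub_ge (iter n g z) a; lra.
  case: (ex_minnP ex) => -[|j] hj minj; first by move: hj; rewrite add0n leNgt n1d.
  exists (j.+1 + n1)%N; first by apply: leq_trans n1N (leq_addl _ _).
  rewrite hj addSn iterS /= ltW //; apply: step; rewrite ltNge; apply/negP => /minj.
  by rewrite ltnn.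
have [u hu uP] := @subsq_extract (fun _ n => d' <= cabs (iter n g z - a) <= s0) (fun _ N => annulus N).
have uB k : cdisc a s0 (iter (u k) g z) by have /andP[] := uP k.
have [t ht [b db hb]] := cdisc_subsq uB.
have gb := limit_fixed Wz (subsq_comp hu ht) hb.
apply: (isol b gb); rewrite db andbT; apply: lt_le_trans d'0 _.
rewrite leNgt; apply/negP => h.
have e0 : 0 < d' - cabs (b - a) by lra.
have [N hN] := hb _ e0; have := hN N (leqnn N); have /andP[h1 _] := uP (t N).
rewrite /= => h2; have := cabs_tri (iter (u (t N)) g z) b a; lra.
Qed.

End Periodic.

(** * Iteration near the Julia set *)

Section Bungee.
Variable R : realType.
Notation C := R[i].
Variable f : C -> C.
Hypothesis hf : holo setT f.
Hypothesis ntr : ~ exists p : {poly C}, forall z, f z = p.[z].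
Implicit Types (a z w x u v : C) (r s M e : R).

Lemma transcendental_nonconst : ~ forall z, f z = f 0.
Proof. by move=> h; apply: ntr; exists (f 0)%:P => z; rewrite hornerC. Qed.

Lemma transcendental_nonaffine a b c : ~ forall z, f z = a * (z - b) + c.
Proof. by move=> h; apply: ntr; exists (a *: ('X - b%:P) + c%:P) => z; rewrite !hornerE h. Qed.

Lemma fatou_component_cc z : fatou_set f z -> fatou_component f (connected_component (fatou_set f) z).
Proof. by exists z. Qed.

(** The components [W n] are followed along a single point [u]. A coincidence [W n = W m] makes
    [W n] invariant under [iter (m - n) f], a case already excluded. *)
Lemma bungee_wandering U : fatou_component f U -> U `&` bungee_set f !=set0 -> wandering_domain f U.
Proof.
move=> hU UB; have UBU := bungee_component hU UB; split => //.
have [u [Uu Bu]] := UB; have Fu := fatou_component_sub hU Uu.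
have nc := transcendental_nonconst.
have Fn n : fatou_set f (iter n f u) by apply/(fatou_iter hf nc).
pose W n := connected_component (fatou_set f) (iter n f u).
have cW n : fatou_component f (W n) by exact: fatou_component_cc.
have uW n : W n (iter n f u) by exact: connected_component_refl.
have subF n A : A `<=` fatou_set f -> iter n f @` A `<=` fatou_set f.
  by move=> AF _ [x /AF Fx <-]; apply/(fatou_iter hf nc).
have key n m : (n < m)%N -> W n <> W m.
  move=> nm E; have p0 : (0 < m - n)%N by rewrite subn_gt0.
  have Winv z : W n z -> W n (iter (m - n) f z).
    move=> Wz; suff : iter (m - n) f @` W n `<=` W n by apply; exists z.
    apply: (fatou_component_max (cW n) (x := iter m f u)).
    - by rewrite E.
    - by exists (iter n f u) => //; rewrite -iterD subnK // ltnW.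
    - apply: connected_image; [exact: holo_iter|exact: component_connected].
    - by apply: subF; exact: connected_component_sub.
  have WB : W n `<=` bungee_set f.
    apply: bungee_component => //; exists (iter n f u); split => //.
    by apply/bungee_iter.
  exact: (periodic_contradiction hf (cW n) p0 Winv WB (uW n)).
exists W; split=> [n|n m E].
  split => //; apply: (fatou_component_max (cW n) (uW n)).
  - by exists u.
  - by apply: connected_image; [exact: holo_iter|exact: fatou_component_connected hU].
  - by apply: subF; exact: fatou_component_sub.
by have [/key|/key h|//] := ltngtP n m => //; case: h.
Qed.

Lemma bounded_constant_subsq (n_ : nat -> nat) N : (forall k, (n_ k < N)%N) ->
  exists2 s, subsq s & exists c, forall k, n_ (s k) = c.
Proof.
elim: N n_ => [|N IH] n_ hn; first by have := hn 0%N.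
have cases k : n_ k = N \/ (n_ k < N)%N.
  by have := hn k; rewrite ltnS leq_eqVlt => /orP[/eqP|]; [left|right].
have [s hs [h|h]] := frequently_or cases; first by exists s => //; exists N.
have [t ht [c hc]] := IH (n_ \o s) h.
by exists (s \o t); [exact: subsq_comp|exists c].
Qed.

(** Otherwise Montel's theorem makes [z] a Fatou point. Sequences with infinitely many indices below
    [N] have a constant subsequence, which converges trivially. *)
Lemma blowup z r N u v : ~ fatou_set f z -> 0 < r -> u != v ->
  exists2 n, (N <= n)%N & exists2 x, disc z r x & iter n f x = u \/ iter n f x = v.
Proof.
move=> Jz r0 uv; apply: contrapT => bad; apply: Jz; apply/fatouP.
exists (r / 64); first by rewrite divr_gt0.
move=> n_.
have cases k : (N <= n_ k)%N \/ (n_ k < N)%N by case: leqP; [left|right].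
have [s hs [h|h]] := frequently_or cases; last first.
  have [t ht [c hc]] := bounded_constant_subsq h.
  exists (s \o t); first exact: subsq_comp.
  by left; exists (iter c f) => e e0; exists 0%N => k _ w _; rewrite /= hc subrr cabs0.
have [||t ht hg] := @montel R (fun k => iter (n_ (s k)) f) u v z r uv r0.
- by move=> k; apply: holo_sub (holo_iter hf _).
- move=> k x dx; split; apply/eqP => E; apply: bad; exists (n_ (s k)) => //; exists x => //; [by left|by right].
by exists (s \o t); [exact: subsq_comp|].
Qed.

Lemma julia_iter n z : ~ fatou_set f (iter n f z) <-> ~ fatou_set f z.
Proof.
have E := fatou_iter hf transcendental_nonconst n z.
by split=> h h2; apply: h; [exact: (proj2 E h2)|exact: (proj1 E h2)].
Qed.

(* The image of [O] is open, and closed relative to [disc 0 L]. *)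
Lemma image_covers_disc (g : C -> C) (O : set C) (B L : R) : holo setT g -> ~ (forall z, g z = g 0) ->
  open O -> O `<=` cdisc 0 B ->
  (forall (x : nat -> C) l, (forall k, O (x k)) -> cvgc x l -> ~ O l -> L <= cabs (g l)) ->
  (exists2 x, O x & cabs (g x) < L) -> forall y, cabs y < L -> exists2 x, O x & g x = y.
Proof.
move=> hg gnc oO OB bd [x0 Ox0 gx0] y yL.
pose P := [set y | exists2 x, O x & g x = y].
have dL : disc 0 L (g x0) by rewrite /disc /= subr0.
have sub : disc 0 L `<=` P.
  apply: (connected_ind (P := P) (@connected_disc R 0 L) dL); first by exists x0.
  move=> w; rewrite /disc /= subr0 => wL.
  have [[x Ox gx]|nP] := pselect (P w).
    have [r r0 hr] := proj1 (open_discP O) oO x Ox.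
    have gnx : ~ forall z, g z = g x by move=> h; apply: gnc => z; rewrite h -(h 0).
    have [e e0 he] := open_mapping (holo_sub (@subsetT _ _) hg) (entire_nonconst hg r0 gnx).
    exists e => // u v _ _ _ dv _; have [|x' dx' gx'] := he v; first by rewrite gx.
    by exists x' => //; exact: hr.
  have [r r0 hr] : exists2 r, 0 < r & forall v, disc w r v -> ~ P v.
    apply: contrapT => bad.
    have /choice[x hx] : forall k : nat, exists x, O x /\ cabs (g x - w) < (2 ^+ k)^-1.
      move=> k; apply: contrapT => h; apply: bad; exists (2 ^+ k)^-1; first by rewrite invr_gt0 exprn_gt0.
      by move=> v dv [x Ox gx]; apply: h; exists x; rewrite gx.
    have [s hs [l dl hl]] := @cdisc_subsq R 0 B x (fun k => OB _ (hx k).1).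
    have gl : g l = w.
      apply: cvgc_unique (ctn_cvgc (ctn_holo setT _ hg) (fun _ => I) hl) _ => e e0.
      have [N hN] := pow2_lt 0 e0; exists N => k Nk; apply: lt_trans (hx (s k)).2 _; apply: hN.
      exact: leq_trans Nk (subsq_ge hs k).
    have nO : ~ O l by move=> Ol; apply: nP; exists l.
    by have := bd (x \o s) l (fun k => (hx (s k)).1) hl nO; rewrite gl; lra.
  by exists r => // u v _ _ du _ /(hr _ du).
by apply: sub; rewrite /disc /= subr0.
Qed.

Lemma cvgc_cabs_ge (x : nat -> C) l M : cvgc x l -> (forall k, M <= cabs (x k)) -> M <= cabs l.
Proof.
move=> hx hM; rewrite leNgt; apply/negP => h; have e0 : 0 < M - cabs l by lra.
have [N hN] := hx _ e0; have := hN N (leqnn N); have := hM N; have := cabs_sub_ge (x N) l; lra.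
Qed.

(** * The exterior of a bounded Julia set *)

Section BoundedJulia.
Variables (M : R) (z0 : C).
Hypothesis M0 : 0 <= M.
Hypothesis Jz0 : ~ fatou_set f z0.
Hypothesis J_bounded : forall z, ~ fatou_set f z -> cabs z <= M.
Let rho := M + 1.
Let A := [set w : C | M < cabs w].

Lemma exterior_fatou : A `<=` fatou_set f.
Proof. by move=> w /= Mw; apply: contrapT => /J_bounded; rewrite leNgt Mw. Qed.

Lemma circle_limit (c : nat -> C) : (forall k, cabs (c k) = rho) ->
  exists2 s, subsq s & exists l, [/\ cvgc (c \o s) l, A l & exists2 r, 0 < r & normal_at f l r].
Proof.
move=> hc; have hc' k : cabs (c k) <= rho by rewrite hc.
have [s hs [l hl]] := @bounded_subsq R c rho hc'.
have lA : A l.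
  by apply: (@lt_le_trans _ _ rho); [rewrite /rho; lra|apply: (cvgc_cabs_ge hl) => k /=; rewrite hc].
exists s => //; exists l; split => //; by apply/fatouP; exact: exterior_fatou.
Qed.

(* The iterates would be uniformly bounded on the circle of radius [rho], hence
   on the disc it bounds, and [z0] would lie in the Fatou set. *)
Lemma exterior_not_bounded : ~ A `<=` bounded_orbit_set f.
Proof.
move=> hA; have rho0 : 0 < rho by apply: le_lt_trans M0 _; rewrite /rho ltrDl ltr01.
(* A failure yields points of the circle accumulating at some [l]. The orbit of [l] is bounded, so
   the limit function there is finite and continuous, too small for the values assumed. *)
have [B hB] : exists B, forall n c, cabs c = rho -> cabs (iter n f c) <= B.
  apply: contrapT => bad.
  have /choice[nc hnc] : forall k : nat, exists p : nat * C, cabs p.2 = rho /\ k%:R < cabs (iter p.1 f p.2).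
    move=> k; apply: contrapT => h; apply: bad; exists k%:R => n c cr; rewrite leNgt; apply/negP => h2.
    by apply: h; exists (n, c).
  have [s hs [l [hl Al [r r0 hr]]]] := circle_limit (fun k => (hnc k).1).
  have [t ht [[h hh]|hi]] := hr (fun k => (nc (s k)).1); last first.
    have /bddP[B hB] := hA _ Al; have [N hN] := hi B.
    by have := hN N (leqnn N) _ (disc_center l r0); rewrite ltNge hB.
  have ch : ctn (disc l r) h l.
    by apply: (ucvg_ctn hh (disc_center l r0)) => k; apply: ctn_iter.
  have [d d0 hd] := ch _ ltr01; have e0 : 0 < Num.min d r by rewrite lt_min d0.
  have [N1 h1] := hl _ e0; have [N2 h2] := hh _ ltr01.
  pose k := maxn (maxn N1 N2) (Num.truncn (cabs (h l) + 2)).+1.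
  have tk : (k <= t k)%N := subsq_ge ht k; have stk : (k <= s (t k))%N := leq_trans tk (subsq_ge hs _).
  have N1k : (N1 <= t k)%N by apply: leq_trans tk; rewrite /k !leq_max leqnn.
  have N2k : (N2 <= k)%N by rewrite /k !leq_max leqnn orbT.
  have := h1 _ N1k; rewrite lt_min /= => /andP[cd cr].
  have q1 := h2 _ N2k _ cr; have q2 := hd _ cr cd; rewrite /= in q1.
  have q3 := (hnc (s (t k))).2.
  have q4 : cabs (h l) + 2 < (s (t k))%:R.
    apply: lt_le_trans (truncnS_gt _) _; rewrite ler_nat; apply: leq_trans stk; exact: leq_maxr.
  set y := iter _ f _ in q1 q3; have := cabs_sub_ge y (h (nc (s (t k))).2).
  have := cabs_sub_ge (h (nc (s (t k))).2) (h l); lra.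
apply: Jz0; apply/fatouP; have z0M := J_bounded Jz0.
have h2 : (0 : R) < 1 / 2 by lra.
exists (1 / 4); first by lra.
move=> n_.
have bnd k w : cdisc z0 (1 / 2) w -> cabs (iter (n_ k) f w) <= B.
  move=> dw; apply: (@max_modulus R (iter (n_ k) f) 0 rho B w rho0).
  - exact: holo_sub (@subsetT _ _) (holo_iter hf _).
  - by move=> c; rewrite subr0; exact: hB.
  - by move: dw; rewrite /cdisc /= subr0 /rho; have := cabsD (w - z0) z0; rewrite subrK; lra.
have [s hs [h hh]] := montel_bounded h2 (fun k => holo_sub (@subsetT _ _) (holo_iter hf (n_ k))) bnd.
exists s => //; left; exists h; apply: ucvg_sub hh.
by move=> w; rewrite /disc /cdisc /=; lra.
Qed.

(* Late iterates map the circle of radius [rho] far away, so that the images of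
   its disc [D] cover large discs. As [f] is small at some large [w], the set [O]
   of points of the [n]-th image of [D] outside the [n0]-th one has an image that
   covers [z0]; but [O] lies outside [disc 0 L], so it contains no Julia point. *)
Lemma exterior_not_escaping : ~ A `<=` escaping_set f.
Proof.
move=> hA; have rho0 : 0 < rho by apply: le_lt_trans M0 _; rewrite /rho ltrDl ltr01.
have nc := transcendental_nonconst.
have nc_iter n : ~ forall z, iter n f z = iter n f 0.
  elim: n => [h|n IH h].
    by have := h 1; rewrite /= => /eqP; rewrite oner_eq0.
  have [e e0 he] := open_mapping (holo_sub (@subsetT _ _) (holo_iter hf n)) (entire_nonconst (a := 0) (holo_iter hf n) ltr01 IH).
  apply: nc; have h2 : forall y, disc (iter n f 0) e y -> f y = f (iter n f 0).
    by move=> y /he[x _ <-]; rewrite -!iterS h.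
  have hF : holo setT (fun w => f w - f (iter n f 0)) by apply: holoB => //; exact: holo_const.
  have h3 z : f z - f (iter n f 0) = 0.
    by move: z; apply: (entire_zero hF e0) => z /h2 ->; rewrite subrr.
  by move=> z; apply/eqP; rewrite -subr_eq0 -[f z](subrK (f (iter n f 0))) h3 add0r -opprB h3 oppr0.
(* Near a limit point of the circle only the infinite limit is possible, as that point escapes; by
   compactness the escape is uniform on the circle. *)
have [Ncirc hcirc] : exists Nc : R -> nat, forall B n c, (Nc B <= n)%N -> cabs c = rho -> B < cabs (iter n f c).
  suff /choice[Nc hNc] : forall B : R, exists N, forall n c, (N <= n)%N -> cabs c = rho -> B < cabs (iter n f c).
    by exists Nc.
  move=> B; apply: contrapT => bad.
  have [n_ hn /choice[c hc]] : exists2 n_, subsq n_ & forall k : nat, exists c, cabs c = rho /\ cabs (iter (n_ k) f c) <= B.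
    apply: (@subsq_extract (fun _ n => exists c, cabs c = rho /\ cabs (iter n f c) <= B)) => _ N.
    apply: contrapT => h; apply: bad; exists N => n c Nn cr; rewrite ltNge; apply/negP => h2.
    by apply: h; exists n => //; exists c.
  have [s hs [l [hl Al [r r0 hr]]]] := circle_limit (fun k => (hc k).1).
  have [t ht [[h hh]|hi]] := hr (n_ \o s).
    have /escP/(_ (cabs (h l) + 1))[N hN] := hA _ Al.
    have [K hK] := ucvg_pt hh (disc_center l r0) ltr01.
    have := hK (maxn K N) (leq_maxl _ _); have := hN (n_ (s (t (maxn K N)))).
    have le1 : (N <= n_ (s (t (maxn K N))))%N.
      apply: leq_trans (leq_maxr K N) _; apply: leq_trans (subsq_ge ht _) _.
      by apply: leq_trans (subsq_ge hs _) (subsq_ge hn _).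
    move=> /(_ le1) /=; set y := iter _ f l; have := cabs_sub_ge y (h l); lra.
  have [K1 h1] := hi B; have [K2 h2] := cvgc_subsq ht hl r0.
  have := h1 _ (leq_maxl K1 K2) _ (h2 _ (leq_maxr K1 K2)).
  by rewrite ltNge; have [_] := hc (s (t (maxn K1 K2))) => /= ->.
pose D := disc (0 : C) rho.
have inD c : cabs c < rho -> D c by rewrite /D /disc /= subr0.
have cover L n : M < L -> (Ncirc L <= n)%N -> forall y, cabs y < L -> exists2 x, D x & iter n f x = y.
  move=> ML nL; have DD : D `<=` cdisc 0 rho by move=> x; exact: ltW.
  apply: (image_covers_disc (L := L) (holo_iter hf n) (nc_iter n) (@open_disc R 0 rho) DD).
    move=> x l Dx xl nDl; apply: ltW; apply: hcirc nL _; apply/eqP; rewrite eq_le.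
    have -> : cabs l <= rho.
      by rewrite -[l]subr0; apply: (cvgc_le (N := 0) xl) => k _; exact: ltW (Dx k).
    by rewrite leNgt; apply/negP => /inD.
  exists z0; first by apply: inD; have := J_bounded Jz0; rewrite /rho; lra.
  by apply: le_lt_trans ML; apply: J_bounded; apply/julia_iter.
(* Larger than [M], so that discs of radius [L] contain all Julia points, and than 1, so that [f w]
   falls in this disc. *)
pose L := M + 2; have ML : M < L by rewrite /L; lra.
pose n0 := Ncirc L.
have [B0 B00 hB0] := holo_bounded (holo_sub (@subsetT _ _) (holo_iter hf n0) : holo (cdisc 0 rho) _).
(* [w] lies beyond the whole [n0]-th image of the closed disc, and [n] is chosen so late that the
   [n]-th image of [D] reaches it. *)
have [w wB fw1] := transcendental_small (Num.max B0 M) hf ntr; move: wB; rewrite gt_max => /andP[wB wM].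
pose n := maxn n0 (Ncirc (cabs w + 1)).
have [B1 B10 hB1] := holo_bounded (holo_sub (@subsetT _ _) (holo_iter hf n) : holo (cdisc 0 rho) _).
(* Removing the image of the closed disc makes [O] open. A limit of points of [O] outside [O] is
   then the [n]-th or [n0]-th image of a point of the circle, and one more application of [f] sends
   it beyond [L]. *)
pose O := [set x | (exists2 d, D d & iter n f d = x) /\ ~ exists2 d, cdisc 0 rho d & iter n0 f d = x].
have open_img k x d : D d -> iter k f d = x -> exists2 e, 0 < e & forall b, disc x e b -> exists2 d, D d & iter k f d = b.
  move=> Dd <-; have [s s0 hs] := disc_inner Dd.
  have nd : ~ forall z, iter k f z = iter k f d by move=> h; apply: (nc_iter k) => z; rewrite h -(h 0).
  have [e e0 he] := open_mapping (holo_sub (@subsetT _ _) (holo_iter hf k)) (entire_nonconst (holo_iter hf k) s0 nd).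
  by exists e => // b /he[d' dd' E]; exists d' => //; exact: hs.
have closed_img k (x d : nat -> C) l : (forall j, cdisc 0 rho (d j) /\ iter k f (d j) = x j) -> cvgc x l ->
    exists2 d, cdisc 0 rho d & iter k f d = l.
  move=> hd xl; have [s hs [d' dd' hd']] := @cdisc_subsq R 0 rho d (fun j => (hd j).1).
  exists d' => //; apply: cvgc_unique (ctn_cvgc (ctn_holo setT _ (holo_iter hf k)) (fun _ => I) hd') _.
  by move=> e /(cvgc_subsq hs xl)[N hN]; exists N => j /hN; rewrite /= (hd (s j)).2.
have [x [[d Dd Ed] nx] fx] : exists2 x, O x & f x = z0.
  apply: (@image_covers_disc f O B1 L hf nc); last first.
  - exact: le_lt_trans (J_bounded Jz0) ML.
  - exists w; last by apply: lt_trans fw1 _; move: (M0); rewrite /L; lra.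
    split; last by move=> [d dd Ed]; have := hB0 d dd; rewrite Ed; lra.
    by apply: (cover (cabs w + 1) n); [lra|exact: leq_maxr|lra].
  - move=> x l Ox xl nOl.
    have /choice[d hd] : forall j, exists d, cdisc 0 rho d /\ iter n f d = x j.
      by move=> j; have [[d Dd Ed] _] := Ox j; exists d; split => //; exact: ltW.
    have [d' dd' Ed'] := closed_img n x d l hd xl.
    have on_circle k c : (n0 <= k)%N -> cdisc 0 rho c -> iter k f c = l -> ~ D c -> L <= cabs (f l).
      move=> kn dc Ec nDc; rewrite -Ec -iterS ltW //; apply: hcirc; first by apply: leq_trans kn _.
      by apply/eqP; rewrite eq_le; move: dc; rewrite /cdisc /= subr0 => ->; rewrite leNgt; apply/negP => /inD.
    have [Dd'|] := pselect (D d'); last by apply: (on_circle n) => //; exact: leq_maxl.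
    have [c dc Ec] : exists2 c, cdisc 0 rho c & iter n0 f c = l.
      by apply: contrapT => h; apply: nOl; split => //; exists d'.
    apply: (on_circle n0 c) => // Dc.
    have [e e0 he] := open_img n0 l c Dc Ec; have [N hN] := xl _ e0.
    have [_ h] := Ox N; apply: h; have [c' Dc' Ec'] := he _ (hN N (leqnn N)).
    by exists c' => //; exact: ltW.
  - move=> _ [[d Dd <-] _]; rewrite /cdisc /= subr0; apply: hB1; exact: ltW.
  apply/open_discP => x [[d Dd Ed] nx].
  have [e1 e10 he1] := open_img n x d Dd Ed.
  have [e2 e20 he2] : exists2 e2, 0 < e2 & forall b, disc x e2 b -> ~ exists2 d, cdisc 0 rho d & iter n0 f d = b.
    apply: contrapT => bad; apply: nx.
    have /choice[c hc] : forall k : nat, exists c, cdisc 0 rho c /\ cabs (iter n0 f c - x) < (2 ^+ k)^-1.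
      move=> k; apply: contrapT => h; apply: bad; exists (2 ^+ k)^-1; first by rewrite invr_gt0 exprn_gt0.
      by move=> b db [c dc Ec]; apply: h; exists c; rewrite Ec.
    apply: (closed_img n0 (fun k => iter n0 f (c k)) c) => [j|e e0]; first by split => //; have [] := hc j.
    have [N hN] := pow2_lt 0 e0; exists N => k Nk; apply: lt_trans (hc k).2 _; exact: hN.
  exists (Num.min e1 e2); first by rewrite lt_min e10.
  by move=> b; rewrite /disc /= lt_min => /andP[b1 b2]; split; [exact: he1|exact: he2].
have Jx : ~ fatou_set f x by apply/(julia_iter 1); rewrite /= fx.
have [d' Dd' Ed'] := cover L n0 ML (leqnn _) x (le_lt_trans (J_bounded Jx) ML).
by apply: nx; exists d' => //; exact: ltW.
Qed.

End BoundedJulia.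

(** If there are no bungee points, escape or boundedness spreads from one point over the connected
    exterior of a disc containing J(f). *)
Lemma julia_unbounded z0 : (forall z, ~ bungee_set f z) -> ~ fatou_set f z0 ->
  forall M, exists2 w, ~ fatou_set f w & M < cabs w.
Proof.
move=> nB Jz0 M; apply: contrapT => bad; pose M' := Num.max M 0.
have M'0 : 0 <= M' by rewrite le_max lexx orbT.
have JM z : ~ fatou_set f z -> cabs z <= M'.
  by move=> Jz; rewrite leNgt; apply/negP; rewrite gt_max => /andP[h _]; apply: bad; exists z.
have AF := exterior_fatou JM; have cA := @connected_exterior R M' M'0.
have w0A : M' < cabs (M' + 1)%:C by rewrite cabs_real ger0_norm; lra.
have : escaping_set f (M' + 1)%:C \/ bounded_orbit_set f (M' + 1)%:C.
  by apply: contrapT => h; apply: (nB (M' + 1)%:C); apply/bungeeP; split=> h2; apply: h; [left|right].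
move=> [he|hb].
  apply: (exterior_not_escaping M'0 Jz0 JM); apply: (fatou_connected_ind cA AF w0A he).
  by move=> x r u v; exact: normal_at_esc.
apply: (exterior_not_bounded M'0 Jz0 JM); apply: (fatou_connected_ind cA AF w0A hb).
by move=> x r u v; exact: normal_at_bdd.
Qed.

End Bungee.

(** * Every disc about a Julia point meets the bungee set and its complement *)

Section BungeeBoundary.
Variable R : realType.
Notation C := R[i].
Variable f : C -> C.
Hypothesis hf : holo setT f.
Hypothesis ntr : ~ exists p : {poly C}, forall z, f z = p.[z].
Implicit Types (a z w x u v : C) (r s M e : R).

(* Without such a [p], [(f (f z) - z) / (f z - z)] omits 0 and 1, so it is a
   constant [c], and then [f' (f z)] omits 0 and [c]. *)
Lemma period2 : exists p, f (f p) = p.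
Proof.
apply: contrapT => no.
have no2 p : f (f p) != p by apply/eqP => h; apply: no; exists p.
have no1 p : f p != p by apply: contra (no2 p) => /eqP h; rewrite !h.
have d1 z : f z - z != 0 by rewrite subr_eq0.
(* A zero of [phi] would solve [f (f z) = z], and a value 1 would make [f z] a fixed point. *)
pose phi z := (f (f z) - z) / (f z - z).
have hphi : holo setT phi.
  apply: holo_div (fun w _ => d1 w); last by apply: holoB => //; exact: holo_id.
  by apply: holoB; [exact: holo_comp hf hf _|exact: holo_id].
have phi0 z : phi z != 0 by rewrite mulf_neq0 ?invr_neq0 // subr_eq0.
have phi1 z : phi z != 1.
  apply/eqP => h; have := no1 (f z); rewrite -(inj_eq (@subIr _ z)) => /eqP; apply.
  by rewrite -[LHS](divfK (d1 z)) -/(phi z) h mul1r.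
pose c := phi 0.
have phic z : phi z = c.
  by apply: (@picard R phi 0 1) => //; rewrite eq_sym oner_neq0.
have E z : f (f z) - z = c * (f z - z) by rewrite -(phic z) /phi divfK.
have c1 : 1 - c != 0 by rewrite subr_eq0 eq_sym phi1.
have /choice[f' hf'] : forall z, exists d, hasd setT f z d by move=> z; exact: hf.
have holof' : holo setT f'.
  move=> z _; apply: (holo_deriv (f := f) (a := z) (r := 1)).
  - exact: (holo_sub (@subsetT _ _) hf).
  - by move=> w _; exact: hf'.
  - exact: disc_center.
(* The derivative of [E], factored; as [c != 1], neither factor vanishes. *)
have D z : f' z * (f' (f z) - c) = 1 - c.
  have h1 := hasdB (hasd_comp (hf' z) (hf' (f z)) (fun _ _ => I)) (hasd_id setT z).
  have h2 := hasdZ c (hasdB (hf' z) (hasd_id setT z)).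
  have h3 : f' (f z) * f' z - 1 = c * (f' z - 1).
    by apply: hasd_uniq h1 _; apply: hasd_ext h2 => [w _|] /=; rewrite E.
  have -> : f' z * (f' (f z) - c) = f' (f z) * f' z - 1 - c * f' z + 1 by ring.
  by rewrite h3; ring.
have f'0 z : f' z != 0 by apply: contra c1 => /eqP h; rewrite -(D z) h mul0r.
have f'c z : f' (f z) != c by apply: contra c1 => /eqP h; rewrite -(D z) h subrr mulr0.
have cst z : f' (f z) = f' (f 0).
  apply: (@picard R (fun z => f' (f z)) 0 c); first by rewrite eq_sym phi0.
  - exact: holo_comp hf holof' _.
  - by move=> w; split.
(* [f'] is constant on the range of [f], which contains a disc, hence constant everywhere. *)
have [e e0 he] := open_mapping (holo_sub (@subsetT _ _) hf) (entire_nonconst (a := 0) hf ltr01 (transcendental_nonconst ntr)).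
pose d := f' (f 0).
have f'd z : f' z - d = 0.
  have hF : holo setT (fun w => f' w - d) by apply: holoB => //; exact: holo_const.
  by move: z; apply: (entire_zero hF e0) => z /he[x _ <-]; rewrite cst subrr.
apply: (@transcendental_nonaffine R f ntr d 0 (f 0 - d * 0)) => z.
have : f z - d * z = f 0 - d * 0.
  apply: (deriv0_const (f := fun w => f w - d * w) (a := 0) (r := cabs z + 1)) => [w _|].
    by have := hasdB (hf' w) (hasdZ d (hasd_id setT w)); rewrite mulr1 f'd.
  by rewrite /disc /= subr0; lra.
by move=> <-; rewrite subr0; ring.
Qed.

(* Two non-bungee points would both be exceptional values, so the point [p] of
   [period2] is the only one: it is fixed, has no other preimage, and [f] has no
   other fixed point. *)
Lemma julia_not_bungee z r : ~ fatou_set f z -> 0 < r -> ~ (disc z r `<=` bungee_set f).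
Proof.
move=> Jz r0 sub.
have uniq u v : ~ bungee_set f u -> ~ bungee_set f v -> u = v.
  move=> Bu Bv; apply/eqP; apply/negPn/negP => uv.
  have [n _ [x /sub Bx [E|E]]] := blowup hf 0 Jz r0 uv.
    by apply: Bu; rewrite -E; apply/bungee_iter.
  by apply: Bv; rewrite -E; apply/bungee_iter.
have [p hp] := period2.
have orb n : iter n f p = p \/ iter n f p = f p.
  by elim: n => [|n [E|E]]; [left|right; rewrite /= E|left; rewrite /= E].
have Bp : ~ bungee_set f p.
  move=> /bungeeP[_]; apply; apply/bddP; exists (Num.max (cabs p) (cabs (f p))) => n.
  by rewrite le_max; have [->|->] := orb n; rewrite lexx ?orbT.
have back w : ~ bungee_set f (f w) -> ~ bungee_set f w by move=> h Bw; apply: h; apply/(bungee_iter f 1).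
have fp : f p = p by apply: uniq => // /(bungee_iter f 1).
have pre w : f w = p -> w = p by move=> h; apply: uniq => //; apply: back; rewrite h.
have fix_ w : f w = w -> w = p.
  move=> h; apply: uniq => // /bungeeP[_]; apply; apply/bddP; exists (cabs w) => n.
  by have -> : iter n f w = w by elim: n => //= n ->.
(* 0 is omitted because [p] has no other preimage, 1 because there is no other fixed point. The
   exponential covers the plane punctured at [p], so [F] is entire and Picard's theorem applies. *)
pose F u := (f (p + cexp u) - p) / cexp u.
have nz u : p + cexp u <> p by move/eqP; rewrite -subr_eq0 addrC addKr (negbTE (cexp_neq0 u)).
have hF : holo setT F.
  have he : holo setT (fun u => cexp u) by apply: holo_cexp; exact: holo_id.
  apply: holo_div => // [|w _]; last exact: cexp_neq0.
  apply: holoB; last exact: holo_const.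
  by apply: holo_comp hf _ => //; apply: holoD => //; exact: holo_const.
have Fc u : F u = F 0.
  apply: (@picard R F 0 1) => //; first by rewrite eq_sym oner_neq0.
  move=> w.
  split; apply/eqP => h.
    have := cexp_neq0 w; rewrite -invr_eq0 => e0; apply: (nz w); apply: pre; apply/eqP.
    by move/eqP: h; rewrite /F mulf_eq0 (negbTE e0) orbF subr_eq0.
  have E : f (p + cexp w) - p = cexp w by rewrite -[LHS](divfK (cexp_neq0 w)) -/(F w) h mul1r.
  by apply: (nz w); apply: fix_; rewrite -[in RHS]E [RHS]addrC subrK.
apply: (@transcendental_nonaffine R f ntr (F 0) p p) => w.
have [->|wp] := eqVneq w p; first by rewrite subrr mulr0 add0r.
have [|u hu] := @cexp_surj R (w - p); first by rewrite subr_eq0.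
by rewrite -(Fc u) -hu /F divfK ?cexp_neq0 // subrK hu addrC subrK.
Qed.

(** Two targets are offered because one may be exceptional. The new centre is a preimage of the one
    that is hit, hence again a Julia point, and the construction can be repeated. *)
Lemma julia_hit x r N u v : ~ fatou_set f x -> 0 < r -> ~ fatou_set f u -> ~ fatou_set f v -> u != v ->
  exists m x' r', [/\ (N <= m)%N, ~ fatou_set f x', 0 < r', cdisc x' r' `<=` cdisc x r &
    exists2 t, t = u \/ t = v & forall w, cdisc x' r' w -> cabs (iter m f w - t) < 1].
Proof.
move=> Jx r0 Ju Jv uv; have [m Nm [y dy hy]] := blowup hf N Jx r0 uv.
have [s s0 hs] := disc_inner dy; have [e e0 he] := ctn_iter hf m setT y ltr01.
have m0 : 0 < Num.min s e by rewrite lt_min s0.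
exists m, y, (Num.min s e / 2); split => //.
- by apply/(julia_iter hf ntr m); case: hy => ->.
- by rewrite divr_gt0.
- move=> w; rewrite /cdisc /= => dw; apply: ltW; apply: hs; rewrite /disc /=.
  by have := ge_min s s e; rewrite lexx /= => h; lra.
- exists (iter m f y) => // w; rewrite /cdisc /= => dw; apply: he => //.
  by have := ge_min e s e; rewrite lexx orbT => h; lra.
Qed.

(* A bungee point [u] would be exceptional together with [f u], so there would be
   none at all and the Julia set would be unbounded; nested discs hitting in turn
   a fixed pair of Julia points and remote ones then shrink to a bungee point. *)
Lemma julia_meets_bungee z r : ~ fatou_set f z -> 0 < r -> exists2 w, disc z r w & bungee_set f w.
Proof.
move=> Jz r0; apply: contrapT => bad.
have nB u : ~ bungee_set f u.
  (* A bungee point is not fixed, so [u] and [f u] form a pair of distinct bungee points, and a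
     preimage in the disc would be one too. *)
  move=> Bu; have [E|uv] := eqVneq u (f u).
    move/bungeeP: Bu => [_]; apply; apply/bddP; exists (cabs u) => n.
    by have -> : iter n f u = u by elim: n => //= n ->.
  have [n _ [x dx hx]] := blowup hf 0 Jz r0 uv; apply: bad; exists x => //.
  by apply/(bungee_iter f n); case: hx => -> //; apply/(bungee_iter f 1).
have far M : exists p : C * C, [/\ ~ fatou_set f p.1, ~ fatou_set f p.2, p.1 != p.2, M < cabs p.1 & M < cabs p.2].
  have [c Jc Mc] := julia_unbounded hf ntr nB Jz M.
  have [c' Jc' Mc'] := julia_unbounded hf ntr nB Jz (cabs c).
  exists (c, c'); split => //=; last exact: lt_trans Mc'.
  by apply/eqP => E; move: Mc'; rewrite E ltxx.
have [[b0 b1] [/= J0 J1 b01 _ _]] := far 0.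
(* [julia_hit] stops within distance 1 of its target. *)
pose B := Num.max (cabs b0) (cabs b1) + 1.
pose P (n : nat) (p : C * R) := ~ fatou_set f p.1 /\ 0 < p.2.
(* The times [m >= n] with values below [B] prevent escape of the limit point; the values of modulus
   at least [n] prevent boundedness. *)
pose Q (n : nat) (p q : C * R) := [/\ cdisc q.1 q.2 `<=` cdisc p.1 p.2,
  exists2 m, (n <= m)%N & forall w, cdisc q.1 q.2 w -> cabs (iter m f w) <= B &
  exists m, forall w, cdisc q.1 q.2 w -> n%:R <= cabs (iter m f w)].
have step n p : P n p -> exists2 q, P n.+1 q & Q n p q.
  move=> [Jp p0]; have [m [x1 [r1 [nm Jx1 r10 s1 [t1 ht1 h1]]]]] := julia_hit n Jp p0 J0 J1 b01.
  have [[c c'] [/= Jc Jc' cc' nc nc']] := far (n%:R + 1).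
  have [m' [x2 [r2 [_ Jx2 r20 s2 [t2 ht2 h2]]]]] := julia_hit 0 Jx1 r10 Jc Jc' cc'.
  exists (x2, r2) => //; split => /=; first exact: subset_trans s2 s1.
    exists m => // w /s2 /h1; have := cabs_sub_ge (iter m f w) t1.
    have : cabs t1 <= B - 1 by rewrite /B addrK le_max; case: ht1 => ->; rewrite lexx ?orbT.
    lra.
  exists m' => w /h2; rewrite cabsB; have := cabs_sub_ge t2 (iter m' f w).
  have : n%:R + 1 < cabs t2 by case: ht2 => ->.
  lra.
have P0 : P 0%N (z, r / 2) by split => //=; rewrite divr_gt0.
have [p [_ hp]] := dep_choice P0 step.
have nest j k : (j <= k)%N -> cdisc (p k).1 (p k).2 `<=` cdisc (p j).1 (p j).2.
  elim: k => [|k IH]; first by rewrite leqn0 => /eqP ->.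
  rewrite leq_eqVlt => /orP[/eqP -> //|]; rewrite ltnS => /IH; apply: subset_trans.
  by have [_ []] := hp k.
have inp j k : (j <= k)%N -> cdisc (p j).1 (p j).2 (p k).1.
  by move=> jk; apply: (nest _ _ jk); rewrite /cdisc /= subrr cabs0; have [[_ /ltW]] := hp k.
have [s hs [l _ hl]] := cdisc_subsq (fun k => inp 0%N k (leq0n k)).
have lp j : cdisc (p j).1 (p j).2 l.
  by apply: (cvgc_le (N := j) hl) => k jk; apply: inp; apply: leq_trans jk (subsq_ge hs k).
apply: (nB l); apply/bungeeP; split.
  move=> /escP/(_ B)[N hN]; have [_ [_ [m Nm hm] _]] := hp N.
  by have := hN m Nm; rewrite ltNge hm //; exact: lp.
move=> /bddP[M hM]; pose n := (Num.truncn M).+1; have [_ [_ _ [m hm]]] := hp n.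
have := hm l (lp n.+1); have := hM m; have := truncnS_gt M; rewrite -/n; lra.
Qed.

Lemma julia_boundary_bungee : julia_set f = boundary (bungee_set f).
Proof.
apply/seteqP; split=> [z Jz|z [clz intz]].
  split.
    move=> A /nbhs_discP[r r0 hr]; have [w dw Bw] := julia_meets_bungee Jz r0.
    by exists w; split => //; exact: hr.
  by move=> /nbhs_discP[r r0]; exact: julia_not_bungee.
move=> /fatouP[r r0 hr]; have nr : nbhs z (disc z r) by apply/nbhs_discP; exists r.
have [w [Bw dw]] := clz _ nr; apply: intz; apply/nbhs_discP; exists r => // v dv.
exact: normal_at_bungee hr dw dv Bw.
Qed.

End BungeeBoundary.

Theorem theorem1p1 (R : realType) (f : R[i] -> R[i])
    (hf : transcendental_entire f) :
  (forall U : set R[i], fatou_component f U ->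
     U `&` bungee_set f !=set0 ->
     U `<=` bungee_set f /\ wandering_domain f U) /\
  julia_set f = boundary (bungee_set f).
Proof.
have [/entire_holo hol ntr] := hf; split=> [U hU UB|]; last exact: julia_boundary_bungee.
by split; [exact: bungee_component|exact: bungee_wandering].
Qed.
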